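(* Let $\alpha$ and $\beta$ be two finite Blaschke products of degree $m>0$ and $n>0$, respectively. Let $\{e_{\eta_1}^{\alpha},\ldots,e_{\eta_m}^{\alpha}\}$ be the modified Clark basis for $K_{\alpha}$ corresponding to $\lambda_1\in\partial\mathbb{D}$, let $\{e_{\zeta_1}^{\beta},\ldots,e_{\zeta_n}^{\beta}\}$ be the modified Clark basis for $K_{\beta}$ corresponding to $\lambda_2\in\partial\mathbb{D}$, and assume that the sets $\{\eta_1,\ldots,\eta_m\}$ and $\{\zeta_1,\ldots,\zeta_n\}$ have precisely $l$ elements in common, namely $\eta_j=\zeta_j$ for $j\leq l$ ($l=0$ if there are no elements in common). Let $A$ be any linear transformation from $K_{\alpha}$ into $K_{\beta}$ and let $\widetilde{M}_A=(t_{s,p})_{1\le s\le n,\,1\le p\le m}$ be the matrix representation of $A$ with respect to the bases $\{e_{\eta_1}^{\alpha},\ldots,e_{\eta_m}^{\alpha}\}$ and $\{e_{\zeta_1}^{\beta},\ldots,e_{\zeta_n}^{\beta}\}$. (a) If $l=0$, then $A\in\mathscr{T}(\alpha,\beta)$ if and only if $$t_{s,p}=\frac{\sqrt{|\alpha'(\eta_1)|}}{\sqrt{|\alpha'(\eta_p)|}}\frac{\omega_1^{\alpha}}{\omega_p^{\alpha}}\frac{\eta_1-\zeta_s}{\eta_p-\zeta_s}t_{s,1}+\frac{\sqrt{|\alpha'(\eta_1)|}\sqrt{|\beta'(\zeta_1)|}}{\sqrt{|\alpha'(\eta_p)|}\sqrt{|\beta'(\zeta_s)|}}\frac{\omega_1^{\alpha}\omega_1^{\beta}}{\omega_p^{\alpha}\omega_s^{\beta}}\frac{\zeta_1-\eta_1}{\eta_p-\zeta_s}t_{1,1}+\frac{\sqrt{|\beta'(\zeta_1)|}}{\sqrt{|\beta'(\zeta_s)|}}\frac{\omega_1^{\beta}}{\omega_s^{\beta}}\frac{\eta_p-\zeta_1}{\eta_p-\zeta_s}t_{1,p}$$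 for all $1\leq p\leq m$ and $1\leq s\leq n$. (b) If $l>0$, then $A\in\mathscr{T}(\alpha,\beta)$ if and only if $$t_{s,p}=\frac{\sqrt{|\alpha'(\eta_s)|}\sqrt{|\beta'(\zeta_1)|}}{\sqrt{|\alpha'(\eta_p)|}\sqrt{|\beta'(\zeta_s)|}}\frac{\omega_s^{\alpha}\omega_1^{\beta}}{\omega_p^{\alpha}\omega_s^{\beta}}\frac{\eta_1-\zeta_s}{\eta_p-\zeta_s}t_{1,s}+\frac{\sqrt{|\beta'(\zeta_1)|}}{\sqrt{|\beta'(\zeta_s)|}}\frac{\omega_1^{\beta}}{\omega_s^{\beta}}\frac{\eta_p-\zeta_1}{\eta_p-\zeta_s}t_{1,p}$$ for all $p,s$ such that $1\leq p\leq m$, $1\leq s\leq l$, $s\neq p$, and $$t_{s,p}=\frac{\sqrt{|\alpha'(\eta_1)|}}{\sqrt{|\alpha'(\eta_p)|}}\frac{\omega_1^{\alpha}}{\omega_p^{\alpha}}\frac{\eta_1-\zeta_s}{\eta_p-\zeta_s}t_{s,1}+\frac{\sqrt{|\beta'(\zeta_1)|}}{\sqrt{|\beta'(\zeta_s)|}}\frac{\omega_1^{\beta}}{\omega_s^{\beta}}\frac{\eta_p-\zeta_1}{\eta_p-\zeta_s}t_{1,p}$$ for all $p,s$ such that $1\leq p\leq m$, $l<s\leq n$.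
   Context: $H^2$ is the classical Hardy space of the unit disk $\mathbb{D}$, identified via boundary values with a closed subspace of $L^2(\partial\mathbb{D})$. The finite Blaschke products are $$\alpha(z)=\prod_{i=1}^{m}\frac{a_i-z}{1-\overline{a}_iz},\qquad \beta(z)=\prod_{j=1}^{n}\frac{b_j-z}{1-\overline{b}_jz},\qquad a_i,b_j\in\mathbb{D},$$ where zeros may be repeated. They are analytic in a neighbourhood of the closed unit disk. The model space of an inner function $\alpha$ is $K_{\alpha}=H^2\ominus\alpha H^2$; $P_{\alpha}$ is the orthogonal projection from $L^2(\partial\mathbb{D})$ onto $K_\alpha$. For $\eta\in\partial\mathbb{D}$ put $k_{\eta}^{\alpha}(z)=\frac{1-\overline{\alpha(\eta)}\alpha(z)}{1-\overline{\eta}z}$, which belongs to $K_\alpha$ and satisfies $\|k_\eta^\alpha\|^2=|\alpha'(\eta)|$; similarly for $\beta$. Clark bases: for $\lambda_1\in\partial\mathbb{D}$ let $\alpha_{\lambda_1}=\frac{\lambda_1+\alpha(0)}{1+\overline{\alpha(0)}\lambda_1}\in\partial\mathbb{D}$. The equation $\alpha(\eta)=\alpha_{\lambda_1}$ has precisely $m$ distinct solutions $\eta_1,\ldots,\eta_m$, all on $\partial\mathbb{D}$, and the functions $v_{\eta_j}^{\alpha}=\|k_{\eta_j}^{\alpha}\|^{-1}k_{\eta_j}^{\alpha}$, $j=1,\ldots,m$, form an orthonormal basis of $K_\alpha$ (the Clark basis). The modified Clark basis corresponding to $\lambda_1$ is the orthonormal basis $e_{\eta_j}^{\alpha}=\omega_j^{\alpha}v_{\eta_j}^{\alpha}$,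 where $\omega_j^{\alpha}=e^{-\frac{i}{2}(\arg\eta_j-\arg\lambda_1)}$, $j=1,\ldots,m$. Likewise for $\lambda_2\in\partial\mathbb{D}$, $\zeta_1,\ldots,\zeta_n\in\partial\mathbb{D}$ are the $n$ distinct solutions of $\beta(\zeta)=\beta_{\lambda_2}=\frac{\lambda_2+\beta(0)}{1+\overline{\beta(0)}\lambda_2}$, $v_{\zeta_j}^{\beta}=\|k_{\zeta_j}^{\beta}\|^{-1}k_{\zeta_j}^{\beta}$, and the modified Clark basis of $K_\beta$ corresponding to $\lambda_2$ is $e_{\zeta_j}^{\beta}=\omega_j^{\beta}v_{\zeta_j}^{\beta}$ with $\omega_j^{\beta}=e^{-\frac{i}{2}(\arg\zeta_j-\arg\lambda_2)}$, $j=1,\ldots,n$. Here $\arg$ is a fixed choice of argument on $\partial\mathbb{D}$, i.e. a real-valued function with $e^{i\arg z}=z$. ''Precisely $l$ elements in common'' means that $\{\eta_1,\ldots,\eta_m\}\cap\{\zeta_1,\ldots,\zeta_n\}$ has exactly $l$ elements, indexed so that these are $\eta_j=\zeta_j$, $1\le j\leq l$. The matrix $\widetilde{M}_A=(t_{s,p})$ is defined by $Ae_{\eta_p}^{\alpha}=\sum_{s=1}^{n}t_{s,p}e_{\zeta_s}^{\beta}$, i.e. $t_{s,p}=\langle Ae_{\eta_p}^{\alpha},e_{\zeta_s}^{\beta}\rangle$. For $\varphi\in L^2(\partial\mathbb{D})$ the asymmetric truncated Toeplitz operator $A_{\varphi}^{\alpha,\beta}\colon K_\alpha\to K_\beta$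 is $A_{\varphi}^{\alpha,\beta}f=P_{\beta}(\varphi f)$ (functions in the finite-dimensional space $K_\alpha$ are bounded), and $\mathscr{T}(\alpha,\beta)=\{A_{\varphi}^{\alpha,\beta}\colon \varphi\in L^2(\partial\mathbb{D})\text{ and }A_{\varphi}^{\alpha,\beta}\text{ is bounded}\}$. *)

(* Defs.v *)
From HB Require Import structures.
From mathcomp Require Import all_boot all_order all_algebra.
From mathcomp Require Import complex.
From mathcomp Require Import all_classical all_reals all_analysis.
Set Implicit Arguments.
Unset Strict Implicit.
Unset Printing Implicit Defensive.
Import Order.TTheory GRing.Theory Num.Theory.
Import numFieldNormedType.Exports.
Import ComplexField.Normc.

Local Open Scope classical_set_scope.
Local Open Scope ring_scope.
Local Open Scope complex_scope.

(* Functions on the unit circle are represented by functions f : R[i] -> R[i]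
   of which only the values f (expi t), 0 <= t <= 2 pi, matter, up to a.e.
   equality; the codomain is written R[i]^o where its topology is used. *)

Section CircleFunctions.
Variable R : realType.
Local Notation C := R[i].
Local Notation mu := (@lebesgue_measure R).
Implicit Types (f g h : C -> C) (K : set (C -> C)).

Definition expi (t : R) : C := cos t +i* sin t.

Definition period : set R := `[0, 2 * pi]%classic.

Definition ae_circle (P : C -> Prop) : Prop :=
  {ae mu, forall t, period t -> P (expi t)}.

Definition eq_circle f g : Prop := ae_circle (fun z => f z = g z).

(* Integral with respect to normalized arc length *)
Definition circle_integral h : C :=
  ((2 * pi)^-1 * \int[mu]_(t in period) complex.Re (h (expi t))) +i*
  ((2 * pi)^-1 * \int[mu]_(t in period) complex.Im (h (expi t))).

Definition L2 : set (C -> C) := [set f : C -> C |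
  [/\ measurable_fun period (fun t => complex.Re (f (expi t))),
      measurable_fun period (fun t => complex.Im (f (expi t))) &
      mu.-integrable period
        (fun t => (normc (f (expi t)) ^+ 2)%:E)]].

Definition inner f g : C := circle_integral (fun z => f z * (g z)^*).

Definition L2norm f : C := sqrtC (inner f f).

Definition hardy_disk (F : C -> C) : Prop := exists a : nat -> C,
  cvgn (series (fun k => normc (a k) ^+ 2)) /\
  forall z : C, `|z| < 1 ->
    series (fun k => a k * z ^+ k : C^o) @ \oo --> (F z : C^o).

Definition boundary_values (F f : C -> C) : Prop :=
  ae_circle (fun z => (F (r%:C * z) : C^o) @[r --> (1 : R)^'-] --> (f z : C^o)).

Definition H2 : set (C -> C) := [set f : C -> C |
  L2 f /\ exists F, hardy_disk F /\ boundary_values F f].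

Definition model_space (alpha : C -> C) : set (C -> C) := [set f : C -> C |
  H2 f /\ forall h, H2 h -> inner f (fun z => alpha z * h z) = 0].

(* A representative of the orthogonal projection of g onto K *)
Definition orth_proj K g : C -> C :=
  xget (fun _ => 0)
    [set u | K u /\ forall v, K v -> inner (fun z => g z - u z) v = 0].

(* Linear maps between spaces of a.e. classes, acting on representatives *)
Definition linear_transformation (K1 K2 : set (C -> C))
    (A : (C -> C) -> (C -> C)) : Prop :=
  [/\ forall f, K1 f -> K2 (A f),
      forall f g, K1 f -> K1 g -> eq_circle f g -> eq_circle (A f) (A g) &
      forall (c : C) f g, K1 f -> K1 g ->
        eq_circle (A (fun z => c * f z + g z)) (fun z => c * A f z + A g z)].

Definition bounded_on K (A : (C -> C) -> (C -> C)) : Prop :=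
  exists M : R, forall f, K f -> L2norm (A f) <= M%:C * L2norm f.

Definition asym_toeplitz_op (beta phi f : C -> C) : C -> C :=
  orth_proj (model_space beta) (fun z => phi z * f z).

Definition asym_truncated_toeplitz (alpha beta : C -> C)
    : set ((C -> C) -> (C -> C)) := [set A |
  exists phi, [/\ L2 phi, bounded_on (model_space alpha) (asym_toeplitz_op beta phi) &
    forall f, model_space alpha f -> eq_circle (A f) (asym_toeplitz_op beta phi f)]].

Definition finite_blaschke (m : nat) (alpha : C -> C) : Prop :=
  exists a : 'I_m -> C, (forall i, `|a i| < 1) /\
    alpha = fun z => \prod_(i < m) ((a i - z) / (1 - (a i)^* * z)).

(* At z = eta the quotient is 0 by the convention x / 0 = 0; this is a single
   point of the circle, hence irrelevant up to a.e. equality. *)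
Definition boundary_kernel (alpha : C -> C) (eta : C) : C -> C :=
  fun z => (1 - (alpha eta)^* * alpha z) / (1 - eta^* * z).

Definition clark_value (alpha : C -> C) (lambda : C) : C :=
  (lambda + alpha 0) / (1 + (alpha 0)^* * lambda).

Definition clark_points (alpha : C -> C) (lambda : C) (m : nat)
    (eta : 'I_m -> C) : Prop :=
  [/\ injective eta, forall j, `|eta j| = 1 &
      forall z, alpha z = clark_value alpha lambda <-> exists j, eta j = z].

Definition is_arg (arg : C -> R) : Prop :=
  forall z : C, `|z| = 1 -> expi (arg z) = z.

Definition clark_vector (alpha : C -> C) (eta : C) : C -> C :=
  fun z => (L2norm (boundary_kernel alpha eta))^-1 * boundary_kernel alpha eta z.

Definition clark_weight (arg : C -> R) (lambda eta : C) : C :=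
  expi (- ((arg eta - arg lambda) / 2)).

Definition modified_clark_vector (arg : C -> R) (alpha : C -> C)
    (lambda eta : C) : C -> C :=
  fun z => clark_weight arg lambda eta * clark_vector alpha eta z.

Definition matrix_representation (m n : nat) (e : 'I_m -> (C -> C))
    (e' : 'I_n -> (C -> C)) (A : (C -> C) -> (C -> C))
    (t : 'M[C]_(n, m)) : Prop :=
  forall p, eq_circle (A (e p)) (fun z => \sum_(s < n) t s p * e' s z).

Definition abs_deriv (alpha : C -> C) (eta : C) : C :=
  `| derive1 (alpha : C -> C^o) eta |.

End CircleFunctions.

(* Main.v *)
Require Import Defs.
From HB Require Import structures.
From mathcomp Require Import all_boot all_order all_algebra.
From mathcomp Require Import complex.
From mathcomp Require Import ring lra.
From mathcomp Require Import all_classical all_reals all_analysis.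
From mathcomp Require Import measurable_realfun.
Set Implicit Arguments.
Unset Strict Implicit.
Unset Printing Implicit Defensive.
Import Order.TTheory GRing.Theory Num.Theory.
Import numFieldNormedType.Exports.
Import ComplexField.Normc.

Local Open Scope complex_scope.
Local Open Scope classical_set_scope.
Local Open Scope card_scope.
Local Open Scope ring_scope.

(** Write alpha = A/Q with polynomials A, Q, let d be the common value of alpha
    at the Clark points eta_p, and factor A - d Q = (X - eta_p) P_p; do the same
    for beta = B/S with value d' and polynomials P'_s at the points zeta_s.

    On the circle the boundary kernel at eta_p is conj(d) eta_p P_p / Q, and the
    conjugate of the kernel at zeta_s is z P'_s / B. Hence, for a symbol phi,
    the matrix entry at (s, p) is an explicit non-zero factor times the linear
    form f |-> (integral of phi z f / (Q B)) evaluated at the polynomial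
    P_p P'_s. Every linear form on polynomials of degree < m + n arises from
    some phi, namely from a trigonometric polynomial times Q B. So the operator A
    is a truncated Toeplitz operator exactly when its rescaled entries D(s, p)
    have the form L(P_p P'_s) for one linear form L
    ([toeplitz_iff_representable]). The rescaling also uses that the squared
    weight of eta_p is lambda1 / eta_p, which replaces the factor eta_p by the
    weights in the formulas.

    Such matrices D are described by separation of variables
    ([representable_iff_separated]). With U and V the products of the linear
    factors at all eta and at all zeta,
      (eta_p - zeta_s) P_p P'_s = P_p V - U P'_s,
    so (eta_p - zeta_s) D(s, p) = x_p - y_s. Conversely the P_p V, the U P'_s
    with zeta_s private to the second family, and the P_p P'_s with
    zeta_s = eta_p are linearly independent (they are the Hermite basis at the
    roots of U V), so the values of L on them can be prescribed. Eliminating x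
    and y gives the formulas (a) and (b).

    The analytic input is that the Clark vectors behave as they should for
    model spaces defined by radial boundary values of square-summable power
    series. Its core is [H2_integral_mulz]: the positive moments of a Hardy
    function vanish, since the partial sums of its dilations converge to it
    almost everywhere and are bounded in L2. With division of Hardy functions by
    1 - c z and by z - b, the model space becomes the space of fractions p / S
    with deg p < n ([model_ratfun], [model_span]), the boundary kernels
    reproduce values there ([ratfun_reproducing]), and the Clark vectors form an
    orthonormal basis with the norms predicted by the derivative of beta
    ([clark_orthonormal], [clark_expansion]); the latter also makes orthogonal
    projections exist ([orth_projP]). *)

(** * Complex arithmetic and measurability on the unit circle *)

Section CircleMeasurable.
Variable R : realType.
Local Notation C := R[i].
Local Notation mu := (@lebesgue_measure R).
Local Notation D := (@period R).
Local Notation Re := complex.Re.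
Local Notation Im := complex.Im.
Implicit Types (f g h : C -> C) (z w : C).

Lemma cReD z w : Re (z + w) = Re z + Re w. Proof. by case: z w => ? ? [? ?]. Qed.
Lemma cImD z w : Im (z + w) = Im z + Im w. Proof. by case: z w => ? ? [? ?]. Qed.
Lemma cReM z w : Re (z * w) = Re z * Re w - Im z * Im w.
Proof. by case: z w => ? ? [? ?]. Qed.
Lemma cImM z w : Im (z * w) = Re z * Im w + Im z * Re w.
Proof. by case: z w => a b [c d]. Qed.
Lemma cReJ z : Re z^* = Re z. Proof. by case: z. Qed.
Lemma cImJ z : Im z^* = - Im z. Proof. by case: z. Qed.
Lemma normc_sqrE z : normc z ^+ 2 = Re z ^+ 2 + Im z ^+ 2.
Proof.
by case: z => a b /=; rewrite sqr_sqrtr// addr_ge0// sqr_ge0.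
Qed.
Lemma norm_normc z : `|z| = (normc z)%:C. Proof. by []. Qed.
Lemma normc_ge0 z : 0 <= normc z. Proof. by case: z => a b; exact: sqrtr_ge0. Qed.
Lemma mulr_conj z : z * z^* = (normc z ^+ 2)%:C.
Proof. by rewrite -[z^*]/(conjc z) -sqr_normc rmorphXn. Qed.
Lemma normc_conj z : normc z^* = normc z.
Proof. by have [] := normcJ z. Qed.
Lemma cReV z : Re z^-1 = Re z * (normc z ^+ 2)^-1.
Proof. by rewrite normc_sqrE; case: z. Qed.
Lemma cImV z : Im z^-1 = - Im z * (normc z ^+ 2)^-1.
Proof. by rewrite normc_sqrE; case: z => a b /=; rewrite mulNr. Qed.
Lemma Re_le z : `|Re z| <= normc z.
Proof. by have := normc_ge_Re z; rewrite lecR. Qed.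
Lemma Im_le z : `|Im z| <= normc z.
Proof.
have := Re_le ('i * z); rewrite normcM cReM /= mul0r mul1r sub0r normrN.
by rewrite expr0n expr1n/= add0r sqrtr1 mul1r.
Qed.
Lemma normc_le_ReIm z : normc z <= `|Re z| + `|Im z|.
Proof.
have h : 0 <= `|Re z| + `|Im z| by rewrite addr_ge0.
rewrite -(@ler_pXn2r _ 2)// ?nnegrE ?normc_ge0// normc_sqrE sqrrD !real_normK ?num_real//.
by rewrite addrAC lerDl mulrn_wge0// mulr_ge0.
Qed.

(** The conjugation of the ordered field structure coincides with the one of the
    complex type only up to conversion; these restate the morphism laws for it. *)
Lemma conjX z k : (z ^+ k)^* = z^* ^+ k. Proof. exact: rmorphXn. Qed.
Lemma conjM z w : (z * w)^* = z^* * w^*. Proof. exact: rmorphM. Qed.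
Lemma conjB z w : (z - w)^* = z^* - w^*. Proof. exact: rmorphB. Qed.
Lemma conjN z : (- z)^* = - z^*. Proof. exact: rmorphN. Qed.
Lemma conj1 : (1 : C)^* = 1. Proof. exact: rmorph1. Qed.
Lemma conj0 : (0 : C)^* = 0. Proof. exact: rmorph0. Qed.
Lemma conjV z : (z^-1)^* = (z^*)^-1. Proof. exact: conjc_inv. Qed.
Lemma conj_nat k : (k%:R : C)^* = k%:R. Proof. exact: rmorph_nat. Qed.
Lemma conjK z : (z^*)^* = z. Proof. exact: conjcK. Qed.

Lemma expi_norm (t : R) : normc (expi t) = 1.
Proof. by rewrite /expi/= cos2Dsin2 sqrtr1. Qed.
Lemma expi_norm1 (t : R) : `|expi t| = 1.
Proof. by rewrite norm_normc expi_norm. Qed.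
Lemma expi_neq0 (t : R) : expi t != 0.
Proof. by rewrite -normr_gt0 expi_norm1. Qed.

Lemma expiD (s t : R) : expi (s + t) = expi s * expi t.
Proof.
by rewrite /expi cosD sinD; simpc; rewrite (addrC (sin s * _)).
Qed.
Lemma expi0 : expi 0 = 1 :> C.
Proof. by rewrite /expi cos0 sin0. Qed.
Lemma expiX (t : R) k : expi t ^+ k = expi (t *+ k).
Proof. by elim: k => [|k IH]; rewrite ?expr0 ?mulr0n ?expi0// exprS IH mulrS expiD. Qed.
Lemma unimod_conj z : `|z| = 1 -> z^* = z^-1.
Proof.
move=> hz; have z0 : z != 0 by rewrite -normr_gt0 hz.
by apply: (mulfI z0); rewrite mulr_conj divff// -[normc z]/(complex.Re `|z|) hz expr1n.
Qed.
Lemma expi_conj (t : R) : (expi t)^* = (expi t)^-1.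
Proof. exact/unimod_conj/expi_norm1. Qed.

Lemma measurable_period : measurable D.
Proof. exact: measurable_itv. Qed.
Hint Resolve measurable_period : core.

Lemma period_finite : (mu D < +oo)%E.
Proof. by rewrite /period lebesgue_measure_itv/=; case: ifP => _; rewrite ?ltry. Qed.

(** Functions on the circle are handled through their real and imaginary parts
    along the parametrization [expi] of one period. *)
Definition cmeasurable h := measurable_fun D (fun t => Re (h (expi t))) /\
  measurable_fun D (fun t => Im (h (expi t))).

Lemma cmeasurable_ext f g : (forall t, f (expi t) = g (expi t)) -> cmeasurable f -> cmeasurable g.
Proof.
move=> fg [h1 h2]; split; [move: h1|move: h2];
  by apply: eq_measurable_fun => t _; rewrite fg.
Qed.

Lemma cmeasurable_cst c : cmeasurable (fun _ => c).
Proof. by split; exact: measurable_cst. Qed.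

Lemma cmeasurable_id : cmeasurable id.
Proof.
split; apply: measurable_funTS => /=; apply: continuous_measurable_fun.
- exact: continuous_cos.
- exact: continuous_sin.
Qed.

Lemma cmeasurableD f g : cmeasurable f -> cmeasurable g -> cmeasurable (fun z => f z + g z).
Proof.
move=> [f1 f2] [g1 g2]; split.
- under eq_fun do rewrite cReD; exact: measurable_funD.
- under eq_fun do rewrite cImD; exact: measurable_funD.
Qed.

Lemma cmeasurableM f g : cmeasurable f -> cmeasurable g -> cmeasurable (fun z => f z * g z).
Proof.
move=> [f1 f2] [g1 g2]; split.
- under eq_fun do rewrite cReM.
  by apply: measurable_funB; exact: measurable_funM.
- under eq_fun do rewrite cImM.
  by apply: measurable_funD; exact: measurable_funM.
Qed.

Lemma cmeasurableN f : cmeasurable f -> cmeasurable (fun z => - f z).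
Proof.
move=> h; apply: (@cmeasurable_ext (fun z => (-1) * f z)); first by move=> t; rewrite mulN1r.
by apply: cmeasurableM => //; exact: cmeasurable_cst.
Qed.

Lemma cmeasurableB f g : cmeasurable f -> cmeasurable g -> cmeasurable (fun z => f z - g z).
Proof. by move=> hf hg; apply: cmeasurableD => //; exact: cmeasurableN. Qed.

Lemma cmeasurableJ f : cmeasurable f -> cmeasurable (fun z => (f z)^*).
Proof.
move=> [f1 f2]; split; first by under eq_fun do rewrite cReJ.
under eq_fun do rewrite cImJ; exact: measurableT_comp.
Qed.

Lemma cmeasurable_norm2 f : cmeasurable f -> measurable_fun D (fun t => normc (f (expi t)) ^+ 2).
Proof.
move=> [f1 f2]; under eq_fun do rewrite normc_sqrE.
by apply: measurable_funD; exact: measurable_funX.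
Qed.

Lemma cmeasurable_normc f : cmeasurable f -> measurable_fun D (fun t => normc (f (expi t))).
Proof.
move=> hf; have h := cmeasurable_norm2 hf.
have e t : normc (f (expi t)) = Num.sqrt (normc (f (expi t)) ^+ 2).
  by rewrite sqrtr_sqr ger0_norm// normc_ge0.
under eq_fun do rewrite e.
apply: (@measurableT_comp _ _ _ _ _ _ (@Num.sqrt R)) => //.
exact: (continuous_measurable_fun (@sqrt_continuous R)).
Qed.

Lemma measurable_invr : measurable_fun setT (fun x : R => x^-1).
Proof.
have -> : [set: R] = [set 0] `|` ~` [set 0] by rewrite setUv.
have m1 : measurable [set (0:R)] by exact: measurable_set1.
apply/(measurable_funU _ m1); first exact: measurableC.
split; first exact: measurable_fun_set1.
apply: open_continuous_measurable_fun.
  by apply: closed_openC; exact: closed_eq.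
move=> x; rewrite inE /= => /eqP x0; exact: inv_continuous.
Qed.

(** Kernels have a pole at a boundary point, so inverses are needed without any
    lower bound on the modulus; the convention 0^-1 = 0 keeps this measurable. *)
Lemma cmeasurableV f : cmeasurable f -> cmeasurable (fun z => (f z)^-1).
Proof.
move=> hf; have [f1 f2] := hf; split.
- under eq_fun do rewrite cReV.
  apply: measurable_funM => //; apply: (measurableT_comp measurable_invr).
  exact: cmeasurable_norm2.
- under eq_fun do rewrite cImV.
  apply: measurable_funM; first exact: measurableT_comp.
  apply: (measurableT_comp measurable_invr).
  exact: cmeasurable_norm2.
Qed.

Lemma cmeasurable_sum (I : Type) (r : seq I) (F : I -> C -> C) : (forall i, cmeasurable (F i)) ->
  cmeasurable (fun z => \sum_(i <- r) F i z).
Proof.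
move=> h; elim: r => [|i r IH].
  by apply: (cmeasurable_ext _ (cmeasurable_cst 0)) => t; rewrite big_nil.
apply: (cmeasurable_ext _ (cmeasurableD (h i) IH)) => t; by rewrite big_cons.
Qed.

Lemma cmeasurable_horner (p : {poly C}) : cmeasurable (fun z => p.[z]).
Proof.
elim/poly_ind: p => [|p c IH].
  by apply: (cmeasurable_ext _ (cmeasurable_cst 0)) => t; rewrite horner0.
apply: (cmeasurable_ext _ (cmeasurableD (cmeasurableM IH cmeasurable_id) (cmeasurable_cst c))) => t.
by rewrite !hornerE.
Qed.

End CircleMeasurable.
Arguments measurable_period {R}.
Arguments measurable_invr {R}.
Arguments period_finite {R}.
Arguments cmeasurable_id {R}.
Arguments conj1 {R}.
Arguments conj0 {R}.

(** * Integrals and inner products over the unit circle *)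

Section CircleIntegral.
Variable R : realType.
Local Notation C := R[i].
Local Notation mu := (@lebesgue_measure R).
Local Notation D := (@period R).
Local Notation Re := complex.Re.
Local Notation Im := complex.Im.
Local Notation I := (@circle_integral R).
Implicit Types (f g h : C -> C) (z w : C).

#[local] Hint Extern 0 (measurable _) => solve [exact: measurable_period] : core.

Let aeF := @ae_filter_ringOfSetsType _ _ _ mu.

(** Transfer of almost everywhere statements, with the modulus 1 of the point
    made available. *)
Lemma ae_circle_imp (P Q : C -> Prop) : (forall z, `|z| = 1 -> P z -> Q z) ->
  ae_circle P -> ae_circle Q.
Proof. by rewrite /ae_circle => PQ; apply: (@filterS _ _ aeF) => t h Dt; apply/PQ/h => //; exact: expi_norm1. Qed.

Lemma ae_circle_imp2 (P1 P2 Q : C -> Prop) :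
  (forall z, `|z| = 1 -> P1 z -> P2 z -> Q z) ->
  ae_circle P1 -> ae_circle P2 -> ae_circle Q.
Proof.
rewrite /ae_circle => PQ; apply: (@filterS2 _ _ aeF) => t h1 h2 Dt; apply: PQ (h1 Dt) (h2 Dt); exact: expi_norm1.
Qed.

Lemma ae_circleW (P : C -> Prop) : (forall z, `|z| = 1 -> P z) -> ae_circle P.
Proof. by move=> h; apply: aeW => t _; exact/h/expi_norm1. Qed.

Definition cintegrable h := mu.-integrable D (EFin \o (fun t => Re (h (expi t)))) /\
  mu.-integrable D (EFin \o (fun t => Im (h (expi t)))).

Lemma cintegrable_cmeasurable h : cintegrable h -> cmeasurable h.
Proof.
by move=> [/integrableP[h1 _] /integrableP[h2 _]]; split; apply/measurable_EFinP.
Qed.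

Lemma cintegrable_le h (g : R -> R) : cmeasurable h -> mu.-integrable D (EFin \o g) ->
  (forall t, normc (h (expi t)) <= g t) -> cintegrable h.
Proof.
move=> [h1 h2] ig hg; split; refine (@le_integrable _ _ _ mu D measurable_period _ (EFin \o g) _ _ ig).
- exact/measurable_EFinP.
- move=> t _; rewrite lee_fin (le_trans (Re_le _))// (le_trans (hg t))//.
  exact: ler_norm.
- exact/measurable_EFinP.
- move=> t _; rewrite lee_fin (le_trans (Im_le _))// (le_trans (hg t))//.
  exact: ler_norm.
Qed.

Lemma integrable_period_cst (M : R) : mu.-integrable D (EFin \o (fun _ => M)).
Proof.
apply/integrableP; split; first by apply/measurable_EFinP; exact: measurable_cst.
rewrite -[X in (X < _)%E]/(\int[mu]_(x in D) cst (`|M|%:E) x)%E integral_cst//.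
apply: lte_mul_pinfty => //; exact: period_finite.
Qed.

Lemma integrable_normc f : cintegrable f -> mu.-integrable D (EFin \o (fun t => normc (f (expi t)))).
Proof.
move=> hf; have [f1 f2] := hf.
apply: (@le_integrable _ _ _ mu D measurable_period _
   (EFin \o (fun t => `|Re (f (expi t))| + `|Im (f (expi t))|))) => //.
- by apply/measurable_EFinP; apply: cmeasurable_normc; exact: cintegrable_cmeasurable.
- move=> t _ /=; rewrite lee_fin (ger0_norm (normc_ge0 _)).
  by rewrite (ger0_norm (addr_ge0 (normr_ge0 _) (normr_ge0 _))) normc_le_ReIm.
- rewrite (_ : EFin \o _ = ((fun t => `|(Re (f (expi t)))%:E|) \+ (fun t => `|(Im (f (expi t)))%:E|))%E)//.
  by apply: integrableD => //; exact: integrable_abse.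
Qed.

Lemma cintegrable_ext f g : (forall t, f (expi t) = g (expi t)) -> cintegrable f -> cintegrable g.
Proof.
move=> fg [h1 h2]; split; [move: h1|move: h2]; apply: eq_integrable => // t _ /=;
  by rewrite fg.
Qed.

Lemma eq_circle_integral f g : (forall t, f (expi t) = g (expi t)) -> I f = I g.
Proof.
move=> fg; rewrite /circle_integral; congr (_ * _ +i* (_ * _));
 by apply: eq_Rintegral => t _; rewrite fg.
Qed.

Lemma cintegrableD f g : cintegrable f -> cintegrable g -> cintegrable (fun z => f z + g z).
Proof.
move=> [f1 f2] [g1 g2]; split.
- rewrite (_ : EFin \o _ = (EFin \o (fun t => Re (f (expi t)))) \+ (EFin \o (fun t => Re (g (expi t)))))%E.
    exact: integrableD.
  by apply/funext => t /=; rewrite cReD EFinD.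
- rewrite (_ : EFin \o _ = (EFin \o (fun t => Im (f (expi t)))) \+ (EFin \o (fun t => Im (g (expi t)))))%E.
    exact: integrableD.
  by apply/funext => t /=; rewrite cImD EFinD.
Qed.

Lemma circle_integralD f g : cintegrable f -> cintegrable g -> I (fun z => f z + g z) = I f + I g.
Proof.
move=> [f1 f2] [g1 g2]; rewrite /circle_integral.
under eq_Rintegral do rewrite cReD.
rewrite RintegralD//.
under [X in _ +i* (_ * X)]eq_Rintegral do rewrite cImD.
by rewrite RintegralD// !mulrDr.
Qed.

Lemma cintegrableJ f : cintegrable f -> cintegrable (fun z => (f z)^*).
Proof.
move=> hf; apply: cintegrable_le (integrable_normc hf) _; first exact/cmeasurableJ/cintegrable_cmeasurable.
by move=> t; rewrite normc_conj.
Qed.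

Lemma circle_integral_conj f : cintegrable f -> I (fun z => (f z)^*) = (I f)^*.
Proof.
move=> [f1 f2]; rewrite /circle_integral/=.
under eq_Rintegral do rewrite cReJ.
under [X in _ +i* (_ * X)]eq_Rintegral do rewrite cImJ -mulN1r.
by rewrite RintegralZl// mulN1r mulrN.
Qed.

Lemma integrable_realM (c : R) (g : R -> R) : mu.-integrable D (EFin \o g) ->
  mu.-integrable D (EFin \o (fun t => c * g t)).
Proof.
move=> ig; rewrite (_ : EFin \o _ = (fun t => c%:E * (EFin \o g) t)%E).
  exact: integrableZl.
by apply/funext => t /=; rewrite EFinM.
Qed.

Lemma integrable_realD (f g : R -> R) : mu.-integrable D (EFin \o f) ->
  mu.-integrable D (EFin \o g) ->
  mu.-integrable D (EFin \o (fun t => f t + g t)).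
Proof.
move=> hf hg; rewrite (_ : EFin \o _ = ((EFin \o f) \+ (EFin \o g))%E)//.
exact: integrableD.
Qed.

Lemma cintegrableZ c f : cintegrable f -> cintegrable (fun z => c * f z).
Proof.
move=> hf; apply: (@cintegrable_le _ (fun t => normc c * normc (f (expi t)))).
- by apply: cmeasurableM; [exact: cmeasurable_cst|exact: cintegrable_cmeasurable].
- exact/integrable_realM/integrable_normc.
- by move=> t; rewrite normcM.
Qed.

Lemma circle_integralZ c f : cintegrable f -> I (fun z => c * f z) = c * I f.
Proof.
move=> [f1 f2]; rewrite /circle_integral; case: c => a b.
have iM (x : R) (g : R -> R) := @integrable_realM x g.
simpc; congr (_ +i* _).
- under eq_Rintegral do rewrite cReM/=.
  rewrite RintegralB//; try exact: iM.
  by rewrite !RintegralZl// mulrBr !mulrA !(mulrC _ (_^-1)) .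
- under eq_Rintegral do rewrite cImM/=.
  rewrite RintegralD//; try exact: iM.
  by rewrite !RintegralZl// mulrDr !mulrA !(mulrC _ (_^-1)) .
Qed.

Lemma circle_integral_ae f g : cmeasurable f -> cmeasurable g -> eq_circle f g -> I f = I g.
Proof.
move=> [f1 f2] [g1 g2] fg; rewrite /circle_integral/Rintegral.
congr (_ * fine _ +i* (_ * fine _)); apply: ae_eq_integral; try exact: measurable_period.
all: try exact/measurable_EFinP.
- by move: fg; apply: (@filterS _ _ aeF) => t h Dt /=; rewrite h.
- by move: fg; apply: (@filterS _ _ aeF) => t h Dt /=; rewrite h.
Qed.

Lemma cintegrable_cst c : cintegrable (fun _ => c).
Proof.
exact: (@cintegrable_le _ (fun _ => normc c) (cmeasurable_cst c) (integrable_period_cst _)).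
Qed.

Lemma circle_integral0 : I (fun _ => 0) = 0.
Proof.
have h := cintegrable_cst 0.
transitivity (0 * I (fun _ => 0)); last exact: mul0r.
by rewrite -circle_integralZ//; apply: eq_circle_integral => t; rewrite mul0r.
Qed.

Lemma circle_integral_sum (J : Type) (r : seq J) (F : J -> C -> C) : (forall i, cintegrable (F i)) ->
  cintegrable (fun z => \sum_(i <- r) F i z) /\
  I (fun z => \sum_(i <- r) F i z) = \sum_(i <- r) I (F i).
Proof.
move=> h; elim: r => [|i r [IH1 IH2]].
  split; last by rewrite big_nil -[RHS]circle_integral0; apply: eq_circle_integral => t; rewrite big_nil.
  apply: (@cintegrable_ext (fun _ => 0)); [by move=> t; rewrite big_nil|exact: cintegrable_cst].
have e t : F i (expi t) + (\sum_(i <- r) F i (expi t)) = \sum_(i <- i :: r) F i (expi t).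
  by rewrite big_cons.
split; first exact: cintegrable_ext e (cintegrableD (h i) IH1).
rewrite big_cons -IH2 -(circle_integralD (h i) IH1); apply: eq_circle_integral => t; by rewrite big_cons.
Qed.

(** Bounded multipliers: they lie in L2 and multiply L2 into itself. Kernels, Clark
    vectors and the symbols constructed from given entries are of this kind. *)
Definition cbounded h := cmeasurable h /\ exists M : R, forall t, normc (h (expi t)) <= M.

Lemma cbounded_cst c : cbounded (fun _ => c).
Proof. by split; [exact: cmeasurable_cst|exists (normc c)]. Qed.
Lemma cbounded_id : cbounded id.
Proof. by split; [exact: cmeasurable_id|exists 1 => t; rewrite expi_norm]. Qed.
Lemma cboundedD f g : cbounded f -> cbounded g -> cbounded (fun z => f z + g z).
Proof.
move=> [mf [M hM]] [mg [N hN]]; split; first exact: cmeasurableD.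
by exists (M + N) => t; rewrite (le_trans (le_normcD _ _))// lerD.
Qed.
Lemma cboundedM f g : cbounded f -> cbounded g -> cbounded (fun z => f z * g z).
Proof.
move=> [mf [M hM]] [mg [N hN]]; split; first exact: cmeasurableM.
by exists (M * N) => t; rewrite normcM ler_pM// normc_ge0.
Qed.
Lemma cboundedJ f : cbounded f -> cbounded (fun z => (f z)^*).
Proof.
move=> [mf [M hM]]; split; first exact: cmeasurableJ.
by exists M => t; rewrite normc_conj.
Qed.
Lemma cbounded_cintegrable f : cbounded f -> cintegrable f.
Proof. by move=> [mf [M hM]]; apply: cintegrable_le mf (integrable_period_cst M) hM. Qed.
Lemma cbounded_ext f g : (forall t, f (expi t) = g (expi t)) -> cbounded f -> cbounded g.
Proof.
move=> fg [mf [M hM]]; split; first exact: cmeasurable_ext fg mf.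
by exists M => t; rewrite -fg.
Qed.
Lemma cbounded_horner (p : {poly C}) : cbounded (fun z => p.[z]).
Proof.
elim/poly_ind: p => [|p c IH].
  by apply: (cbounded_ext _ (cbounded_cst 0)) => t; rewrite horner0.
apply: (cbounded_ext _ (cboundedD (cboundedM IH cbounded_id) (cbounded_cst c))) => t.
by rewrite !hornerE.
Qed.
Lemma cboundedX f k : cbounded f -> cbounded (fun z => f z ^+ k).
Proof.
move=> hf; elim: k => [|k IH]; first exact: cbounded_cst.
by apply: (cbounded_ext _ (cboundedM hf IH)) => t; rewrite exprS.
Qed.

Lemma cbounded_invX k : cbounded (fun z => z^-1 ^+ k).
Proof.
apply: cboundedX; split; first exact/cmeasurableV/cmeasurable_id.
by exists 1 => t; rewrite normcV expi_norm invr1.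
Qed.

Lemma L2E f : L2 f <-> cmeasurable f /\
  mu.-integrable D (EFin \o (fun t => normc (f (expi t)) ^+ 2)).
Proof. by split=> [[]|[[]]]. Qed.

Lemma L2_cmeasurable f : L2 f -> cmeasurable f. Proof. by move/L2E => []. Qed.

Lemma L2_le f (g : R -> R) : cmeasurable f -> mu.-integrable D (EFin \o g) ->
  (forall t, normc (f (expi t)) ^+ 2 <= g t) -> L2 f.
Proof.
move=> hf ig hg; apply/L2E; split => //.
refine (@le_integrable _ _ _ mu D measurable_period _ (EFin \o g) _ _ ig).
- by apply/measurable_EFinP; exact: cmeasurable_norm2.
- move=> t _; rewrite lee_fin ger0_norm ?sqr_ge0// (le_trans (hg t))//.
  exact: ler_norm.
Qed.

Lemma cbounded_L2 f : cbounded f -> L2 f.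
Proof.
move=> [mf [M hM]]; apply: L2_le mf (integrable_period_cst (M ^+ 2)) _ => t.
by rewrite lerXn2r ?nnegrE ?normc_ge0//; exact: le_trans (normc_ge0 _) (hM t).
Qed.

Lemma L2_cboundedM f g : cbounded f -> L2 g -> L2 (fun z => f z * g z).
Proof.
move=> [mf [M hM]] /L2E[mg ig].
apply: (L2_le (cmeasurableM mf mg) (integrable_realM (M ^+ 2) ig)) => t.
rewrite normcM exprMn ler_wpM2r ?sqr_ge0// lerXn2r ?nnegrE ?normc_ge0//.
exact: le_trans (normc_ge0 _) (hM t).
Qed.

Lemma L2D f g : L2 f -> L2 g -> L2 (fun z => f z + g z).
Proof.
move=> /L2E[mf if_] /L2E[mg ig].
apply: (L2_le (cmeasurableD mf mg) (integrable_realM 2 (integrable_realD if_ ig))) => t.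
have h := le_normcD (f (expi t)) (g (expi t)).
have : normc (f (expi t) + g (expi t)) ^+ 2 <= (normc (f (expi t)) + normc (g (expi t))) ^+ 2.
  by rewrite lerXn2r ?nnegrE ?addr_ge0 ?normc_ge0.
move/le_trans; apply.
have := sqr_ge0 (normc (f (expi t)) - normc (g (expi t))); nra.
Qed.

Lemma L2Z c f : L2 f -> L2 (fun z => c * f z).
Proof. exact/L2_cboundedM/cbounded_cst. Qed.

Lemma L2_ext f g : (forall t, f (expi t) = g (expi t)) -> L2 f -> L2 g.
Proof.
move=> fg /L2E[mf hf]; apply: (L2_le (cmeasurable_ext fg mf) hf) => t; by rewrite fg.
Qed.

Lemma L2B f g : L2 f -> L2 g -> L2 (fun z => f z - g z).
Proof.
move=> hf hg; apply: (L2_ext _ (L2D hf (L2Z (-1) hg))) => t.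
by rewrite mulN1r.
Qed.

Lemma cintegrable_inner f g : L2 f -> L2 g -> cintegrable (fun z => f z * (g z)^*).
Proof.
move=> /L2E[mf if_] /L2E[mg ig].
apply: (cintegrable_le (cmeasurableM mf (cmeasurableJ mg)) (integrable_realD if_ ig)) => t.
rewrite normcM normc_conj.
have := sqr_ge0 (normc (f (expi t)) - normc (g (expi t))).
have := normc_ge0 (f (expi t)); have := normc_ge0 (g (expi t)); nra.
Qed.

Lemma L2_cintegrable f : L2 f -> cintegrable f.
Proof.
move=> hf; apply: (cintegrable_ext _ (cintegrable_inner hf (cbounded_L2 (cbounded_cst 1)))) => t.
by rewrite conj1 mulr1.
Qed.

Lemma innerDl f g h : L2 f -> L2 g -> L2 h ->
  inner (fun z => f z + g z) h = inner f h + inner g h.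
Proof.
move=> hf hg hh; rewrite /inner -circle_integralD; try exact: cintegrable_inner.
by apply: eq_circle_integral => t; rewrite mulrDl.
Qed.

Lemma innerZl c f h : L2 f -> L2 h ->
  inner (fun z => c * f z) h = c * inner f h.
Proof.
move=> hf hh; rewrite /inner -circle_integralZ; try exact: cintegrable_inner.
by apply: eq_circle_integral => t; rewrite mulrA.
Qed.

Lemma inner_conj f g : L2 f -> L2 g -> inner g f = (inner f g)^*.
Proof.
move=> hf hg; rewrite /inner -circle_integral_conj; last exact: cintegrable_inner.
by apply: eq_circle_integral => t; rewrite conjM conjK mulrC.
Qed.

Lemma innerBl f g h : L2 f -> L2 g -> L2 h ->
  inner (fun z => f z - g z) h = inner f h - inner g h.
Proof.
move=> hf hg hh; rewrite -mulN1r -innerZl// -innerDl//; last exact: L2Z.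
by apply: eq_circle_integral => t; rewrite mulN1r.
Qed.

Lemma inner_ae f f' g g' : cmeasurable f -> cmeasurable f' -> cmeasurable g -> cmeasurable g' ->
  eq_circle f f' -> eq_circle g g' -> inner f g = inner f' g'.
Proof.
move=> hf hf' hg hg' ff' gg'; apply: circle_integral_ae.
- by apply: cmeasurableM => //; exact: cmeasurableJ.
- by apply: cmeasurableM => //; exact: cmeasurableJ.
- by move: ff' gg'; apply: ae_circle_imp2 => z _ -> ->.
Qed.

Lemma L2_sum (J : Type) (r : seq J) (F : J -> C -> C) : (forall i, L2 (F i)) ->
  L2 (fun z => \sum_(i <- r) F i z).
Proof.
move=> h; elim: r => [|i r IH].
  by apply: (L2_ext _ (cbounded_L2 (cbounded_cst 0))) => t; rewrite big_nil.
by apply: (L2_ext _ (L2D (h i) IH)) => t; rewrite big_cons.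
Qed.

Lemma inner_suml (J : Type) (r : seq J) (c : J -> C) (F : J -> C -> C) g :
  (forall i, L2 (F i)) -> L2 g ->
  inner (fun z => \sum_(i <- r) c i * F i z) g = \sum_(i <- r) c i * inner (F i) g.
Proof.
move=> h hg; rewrite /inner.
have -> : I (fun z => (\sum_(i <- r) c i * F i z) * (g z)^*) =
   I (fun z => \sum_(i <- r) c i * (F i z * (g z)^*)).
  by apply: eq_circle_integral => t; rewrite mulr_suml; apply: eq_bigr => i _; rewrite mulrA.
rewrite (circle_integral_sum _ _).2; last by move=> i; exact/cintegrableZ/cintegrable_inner.
by apply: eq_bigr => i _; rewrite circle_integralZ//; exact: cintegrable_inner.
Qed.

Lemma innerxx f : inner f f = ((2 * pi)^-1 * \int[mu]_(t in D) (normc (f (expi t)) ^+ 2))%:C.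
Proof.
rewrite /inner /circle_integral.
congr (_ * _ +i* _).
  by apply: eq_Rintegral => t _; rewrite mulr_conj.
rewrite (_ : Rintegral _ _ _ = 0) ?mulr0//.
under eq_Rintegral do rewrite mulr_conj/=.
by rewrite Rintegral_cst// mul0r.
Qed.

Lemma inner_ge0 f : 0 <= inner f f.
Proof.
rewrite innerxx ler0c mulr_ge0 ?invr_ge0 ?mulr_ge0 ?pi_ge0//.
by apply: Rintegral_ge0 => t _; exact: sqr_ge0.
Qed.

(** The inner product only sees almost everywhere classes, so definiteness is
    almost everywhere equality. *)
Lemma inner_eq0 f : L2 f -> inner f f = 0 -> eq_circle f (fun _ => 0).
Proof.
move=> /L2E[mf if_]; rewrite innerxx => -[] /eqP.
rewrite mulf_eq0 invr_eq0 mulf_eq0 pnatr_eq0/= gt_eqF ?pi_gt0//= => /eqP h.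
have mm : measurable_fun D (EFin \o (fun t => normc (f (expi t)) ^+ 2)).
  by apply/measurable_EFinP; exact: cmeasurable_norm2.
have : (\int[mu]_(t in D) `|(EFin \o (fun t => (normc (f (expi t)) ^+ 2)%R)) t| = 0)%E.
  transitivity (\int[mu]_(t in D) (EFin \o (fun t => (normc (f (expi t)) ^+ 2)%R)) t)%E.
    by apply: eq_integral => t _; rewrite gee0_abs//= lee_fin sqr_ge0.
  have fn : (\int[mu]_(t in D) (EFin \o (fun t => (normc (f (expi t)) ^+ 2)%R)) t)%E \is a fin_num.
    by apply: integrable_fin_num if_; exact: measurable_period.
  by rewrite -(fineK fn); congr EFin.
move/ae_eq_integral_abs => /(_ measurable_period mm).
apply: (@filterS _ _ aeF) => t ht Dt; apply: eq0_normc.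
by have /= [] := ht Dt => /eqP; rewrite expf_eq0/= => /eqP.
Qed.

End CircleIntegral.
Arguments cbounded_id {R}.

(** * Orthogonality of the powers of z *)

Section CircleTrig.
Variable R : realType.
Local Notation C := R[i].
Local Notation mu := (@lebesgue_measure R).
Local Notation D := (@period R).
Local Notation Re := complex.Re.
Local Notation I := (@circle_integral R).
Implicit Types (f g h : C -> C) (z w : C).

#[local] Hint Extern 0 (measurable _) => solve [exact: measurable_period] : core.

(** A point of the circle is attained by [expi] at most twice in a closed period:
    at the arc cosine of its real part, or at the reflection of it. *)
Lemma ae_circle_neq w : ae_circle (fun z => z <> w).
Proof.
pose a := acos (Re w); pose b := 2 * pi - a.
have hs : mu.-negligible ([set a] `|` [set b]).
  by apply: negligibleU; (apply/negligibleP;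
    [exact: measurable_set1|exact: lebesgue_measure_set1]).
apply: negligibleS hs => t /= /not_implyP[Dt]; rewrite not_notE => tw.
have ct : cos t = Re w by rewrite -tw.
move: Dt; rewrite /period/= in_itv/= => /andP[t0 t2].
have [tpi|tpi] := leP t pi; [left|right].
  by rewrite /a -ct cosK// in_itv/= t0.
have : cos (2 * pi - t) = Re w.
  by rewrite -ct mulr_natl addrC cosD2pi cosN.
rewrite /= /b /a => <-; rewrite cosK; first by rewrite opprB addrCA subrr addr0.
by rewrite in_itv/= subr_ge0 t2/= lerBlDr; have := tpi; lra.
Qed.

(** An integral over the period vanishes when the primitive is periodic. *)
Lemma FTC_period (f F : R -> R) : continuous f -> (forall x : R, is_derive x 1 F (f x)) ->
  F (2 * pi) = F 0 -> \int[mu]_(t in D) f t = 0.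
Proof.
move=> cf dF h.
have cF : continuous F.
  move=> x; apply: differentiable_continuous; apply/derivable1_diffP.
  by have [] := dF x.
rewrite /Rintegral /period (@continuous_FTC2 _ f F) ?h ?subee//.
- by rewrite mulr_gt0// pi_gt0.
- by apply: continuous_subspaceT.
- split.
  + by move=> x _; have [] := dF x.
  + by apply: cvg_at_right_filter; exact: cF.
  + by apply: cvg_at_left_filter; exact: cF.
- by move=> x _; rewrite derive1E; have [_ ->] := dF x.
Qed.

Lemma circle_integral_expS k : I (fun z => z ^+ k.+1) = 0.
Proof.
have kn0 : k.+1%:R != 0 :> R by rewrite pnatr_eq0.
have c2 : cos (2 * pi * k.+1%:R) = 1 :> R.
  by rewrite mulr_natl mulr_natr -[X in cos X]add0r (periodicn (@cosD2pi R)) cos0.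
have s2 : sin (2 * pi * k.+1%:R) = 0 :> R.
  by rewrite mulr_natl mulr_natr -[X in sin X]add0r (periodicn (@sinD2pi R)) sin0.
have cont (c : R) : continuous (fun t : R => t * c).
  by move=> x; apply: cvgMl; exact: cvg_id.
rewrite /circle_integral.
under eq_Rintegral do rewrite expiX/= -mulr_natr.
under [X in _ +i* (_ * X)]eq_Rintegral do rewrite expiX/= -mulr_natr.
have hc : \int[mu]_(t in D) cos (t * k.+1%:R) = 0.
  apply: (@FTC_period _ (fun t => sin (t * k.+1%:R) * k.+1%:R^-1)).
  - by move=> x; apply: continuous_comp; [exact: cont|exact: continuous_cos].
  - move=> x; apply: is_derive_eq; rewrite /GRing.scale/=; field; by rewrite addrC natr1.
  - by rewrite s2 !mul0r sin0 mul0r.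
have hs : \int[mu]_(t in D) sin (t * k.+1%:R) = 0.
  apply: (@FTC_period _ (fun t => - cos (t * k.+1%:R) * k.+1%:R^-1)).
  - by move=> x; apply: continuous_comp; [exact: cont|exact: continuous_sin].
  - move=> x; apply: is_derive_eq; rewrite /GRing.scale/=; field; by rewrite addrC natr1.
  - by rewrite c2 mul0r cos0.
by rewrite hc hs !mulr0.
Qed.

Lemma circle_integral1 : I (fun _ => 1) = 1.
Proof.
rewrite /circle_integral/= !Rintegral_cst// mul0r mulr0.
rewrite [X in fine X](_ : _ = (2 * pi)%:E); last first.
  by rewrite -[LHS]/(mu `[0, 2 * pi]) lebesgue_measure_itv/= lte_fin mulr_gt0 ?pi_gt0//= sube0.
rewrite mul1r mulVf//.
by rewrite gt_eqF// mulr_gt0 ?pi_gt0.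
Qed.

Lemma inner_exp j k : inner (fun z : C => z ^+ j) (fun z => z ^+ k) = (j == k)%:R.
Proof.
wlog jk : j k / (k <= j)%N => [h|].
  have [kj|jk] := leqP k j; first exact: h.
  rewrite inner_conj; [|exact/cbounded_L2/cboundedX/cbounded_id..].
  by rewrite h ?(ltnW jk)// conj_nat eq_sym.
rewrite /inner -(subnK jk); move: (j - k)%N => d.
rewrite (@eq_circle_integral _ _ (fun z => z ^+ d)); last first.
  move=> t; rewrite exprD conjX -mulrA -exprMn expi_conj divff ?expi_neq0//.
  by rewrite expr1n mulr1.
case: d => [|d]; first by rewrite circle_integral1 add0n eqxx.
by rewrite circle_integral_expS addSn gtn_eqF// ltnS leq_addl.
Qed.

(** Fourier coefficients and Parseval for finite orthonormal families; used both
    for powers of z and for Clark bases. *)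
Lemma inner_orthonormal_sum (J : finType) (e : J -> C -> C) (c : J -> C) :
  (forall j, L2 (e j)) -> (forall i j, inner (e i) (e j) = (i == j)%:R) ->
  (forall k, inner (fun z => \sum_j c j * e j z) (e k) = c k) /\
  inner (fun z => \sum_j c j * e j z) (fun z => \sum_j c j * e j z) =
    (\sum_j normc (c j) ^+ 2)%:C.
Proof.
move=> he ho.
have h1 k : inner (fun z => \sum_j c j * e j z) (e k) = c k.
  rewrite inner_suml// (bigD1 k)//= ho eqxx mulr1 big1 ?addr0// => i ik.
  by rewrite ho (negbTE ik) mulr0.
have hS : L2 (fun z => \sum_j c j * e j z) by apply: L2_sum => j; exact: L2Z.
split => //; rewrite inner_suml// rmorph_sum/=; apply: eq_bigr => j _.
by rewrite inner_conj// h1 mulr_conj.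
Qed.

End CircleTrig.
Arguments inner_exp {R}.
Arguments circle_integral_expS {R}.
Arguments circle_integral1 {R}.
Arguments ae_circle_neq {R}.

(** * Positive moments of Hardy functions vanish *)

Section HardyMean.
Variable R : realType.
Local Notation C := R[i].
Local Notation mu := (@lebesgue_measure R).
Local Notation D := (@period R).
Local Notation Re := complex.Re.
Local Notation I := (@circle_integral R).
Implicit Types (f g h F : C -> C) (z w : C) (a : nat -> C).

#[local] Hint Extern 0 (measurable _) => solve [exact: measurable_period] : core.

Let aeF := @ae_filter_ringOfSetsType _ _ _ mu.

(** Limits of complex sequences in terms of the real-valued modulus, to be able to
    use real inequalities. *)
Lemma cvgcP (u : nat -> C) (l : C) :
  (u @ \oo --> (l : C^o)) <->
  (forall e : R, 0 < e -> exists N, forall n, (N <= n)%N -> normc (u n - l) < e).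
Proof.
split.
- move=> h e e0.
  have /(_ _ e%:C) := proj1 (@cvgrPdist_lt C C^o _ _ _ u l) h.
  rewrite ltcR => /(_ e0)[N _ hN].
  exists N => n Nn; have := hN n Nn.
  by rewrite /= distrC norm_normc ltcR.
- move=> h; apply: (proj2 (@cvgrPdist_lt C C^o _ _ _ u l)) => e e0.
  have eR : e = (Re e)%:C by rewrite RRe_real// gtr0_real.
  have /h [N hN] : 0 < Re e by rewrite -ltcR -eR.
  exists N => // n /= /hN; by rewrite eR distrC norm_normc ltcR.
Qed.

Lemma cvgrP (u : nat -> R) (l : R) :
  (u @ \oo --> l) <->
  (forall e : R, 0 < e -> exists N, forall n, (N <= n)%N -> `|u n - l| < e).
Proof.
split.
- move/cvgrPdist_lt => h e /h[N _ hN].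
  by exists N => n /hN; rewrite /= distrC.
- move=> h; apply/cvgrPdist_lt => e /h[N hN].
  by exists N => // n /= /hN; rewrite distrC.
Qed.

Lemma normc_sum (J : Type) (r : seq J) (F : J -> C) :
  normc (\sum_(i <- r) F i) <= \sum_(i <- r) normc (F i).
Proof.
elim: r => [|i r IH]; first by rewrite !big_nil normc0.
by rewrite !big_cons (le_trans (le_normcD _ _))// lerD2l.
Qed.

Lemma normcX z k : normc (z ^+ k) = normc z ^+ k.
Proof. by elim: k => [|k IH]; rewrite ?expr0 ?normc1// !exprS normcM IH. Qed.

Lemma normc_real (r : R) : 0 <= r -> normc r%:C = r.
Proof. by move=> r0; rewrite /= expr0n/= addr0 sqrtr_sqr ger0_norm. Qed.

Lemma normcB z w : normc (z - w) = normc (w - z).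
Proof. by rewrite -normcN opprB. Qed.

Lemma hardy_bounded a : cvgn (series (fun k => normc (a k) ^+ 2)) ->
  exists A : R, [/\ 0 <= A, forall k, normc (a k) <= A &
    forall n, \sum_(k < n) normc (a k) ^+ 2 <= A].
Proof.
move=> ca; pose A := limn (series (fun k => normc (a k) ^+ 2)).
have le n : \sum_(k < n) normc (a k) ^+ 2 <= A.
  have := @nondecreasing_cvgn_le _ (series (fun k => normc (a k) ^+ 2)) _ ca n.
  rewrite /series/= big_mkord; apply.
  apply: nondecreasing_series => k _ _; exact: sqr_ge0.
have A0 : 0 <= A by have := le 0%N; rewrite big_ord0.
have le1 k : normc (a k) <= 1 + A.
  have h : normc (a k) ^+ 2 <= A.
    have := le k.+1; rewrite big_ord_recr/=; apply: le_trans.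
    by rewrite lerDr sumr_ge0// => i _; exact: sqr_ge0.
  have := normc_ge0 (a k); nra.
exists (1 + A); split => // [|n]; first by rewrite addr_ge0.
by rewrite (le_trans (le n))// lerDr.
Qed.

(** Bounded coefficients give geometric tails, uniformly on a smaller disk. *)
Lemma geometric_tail (A r : R) (c : nat -> C) z (n m : nat) : 0 <= A -> 0 <= r < 1 ->
  (forall k, normc (c k) <= A) -> normc z <= r ->
  normc (\sum_(n <= k < n + m) c k * z ^+ k) <= A * r ^+ n / (1 - r).
Proof.
move=> A0 /andP[r0 r1] hc hz; have r10 : 0 < 1 - r by rewrite subr_gt0.
rewrite (le_trans (normc_sum _ _))//.
rewrite (@le_trans _ _ (\sum_(n <= k < n + m) A * r ^+ k))//.
  apply: ler_sum => k _; rewrite normcM normcX ler_pM ?exprn_ge0 ?normc_ge0//.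
  by rewrite lerXn2r// nnegrE normc_ge0.
rewrite -mulr_sumr -mulrA ler_wpM2l// ler_pdivlMr//.
have : (\sum_(n <= k < n + m) r ^+ k) * (1 - r) = r ^+ n - r ^+ (n + m).
  elim: m => [|m IH]; first by rewrite addn0 big_geq// mul0r subrr.
  rewrite addnS big_nat_recr ?leq_addr//= mulrDl IH exprS; ring.
by move=> ->; rewrite lerBlDr lerDl exprn_ge0.
Qed.

Lemma expr_small (A r e : R) : 0 <= r < 1 -> 0 < e -> exists n, A * r ^+ n < e.
Proof.
move=> /andP[r0 r1] e0.
have h : (fun n => A * r ^+ n) @ \oo --> A * 0.
  by apply: cvgMr; apply: cvg_expr; rewrite ger0_norm.
move: h; rewrite mulr0 => /cvgrP/(_ e e0)[N hN].
by exists N; apply: le_lt_trans (hN N (leqnn _)); rewrite subr0 ler_norm.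
Qed.

Lemma hardy_uniform F a (r e : R) : cvgn (series (fun k => normc (a k) ^+ 2)) ->
  (forall z : C, `|z| < 1 ->
    series (fun k => a k * z ^+ k : C^o) @ \oo --> (F z : C^o)) ->
  0 <= r < 1 -> 0 < e -> exists N, forall z, normc z <= r ->
    normc (F z - \sum_(k < N) a k * z ^+ k) <= e.
Proof.
move=> ca hF hr e0; have [A [A0 hA _]] := hardy_bounded ca.
have [r0 r1] := andP hr; have r10 : 0 < 1 - r by rewrite subr_gt0.
have [N hN] : exists N, A * r ^+ N < e * (1 - r).
  by apply: expr_small => //; rewrite mulr_gt0.
exists N => z hz; apply/ler_addgt0Pr => d d0.
have z1 : `|z| < 1 by rewrite norm_normc ltcR (le_lt_trans hz).
have /cvgcP/(_ d d0)[M hM] := hF z z1.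
have := hM (N + M)%N (leq_addl _ _).
rewrite /series/= (big_cat_nat_idem _ (n := N))//= ?leq_addr ?addr0//.
rewrite big_mkord => h.
have g := geometric_tail N M A0 hr hA hz.
have -> : F z - \sum_(k < N) a k * z ^+ k =
   (\sum_(N <= k < N + M) a k * z ^+ k) -
   (\sum_(k < N) a k * z ^+ k + \sum_(N <= k < N + M) a k * z ^+ k - F z) by ring.
rewrite (le_trans (le_normcD _ _))// normcN lerD//; last exact: ltW.
by rewrite (le_trans g)// ler_pdivrMr// ltW.
Qed.

(** Almost everywhere convergence to 0 together with a bound in L2 gives
    arbitrarily small integrals: the truncation at height K is controlled by
    dominated convergence, and the rest by d <= d^2 / K above K. *)
Lemma integral_small (d : nat -> R -> R) (B : R) :
  (forall n, measurable_fun D (d n)) -> (forall n t, 0 <= d n t) ->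
  {ae mu, forall t, D t -> d n t @[n --> \oo] --> 0} ->
  (forall n, mu.-integrable D (EFin \o (fun t => d n t ^+ 2))) ->
  (forall n, \int[mu]_(t in D) (d n t ^+ 2) <= B) ->
  forall e, 0 < e -> exists n, \int[mu]_(t in D) d n t <= e.
Proof.
move=> md d0 dcvg id2 hB e e0.
have B0 : 0 <= B by rewrite (le_trans _ (hB 0%N))//; apply: Rintegral_ge0 => t _; exact: sqr_ge0.
(* K is chosen such that the part above K contributes at most B / K <= e / 2. *)
pose K := 2 * B / e + 1.
have K0 : 0 < K by rewrite ltr_wpDl// divr_ge0 ?mulr_ge0// ltW.
pose m n t := Num.min (d n t) K.
have m0 n t : 0 <= m n t by rewrite /m le_min d0 ltW.
have mm n : measurable_fun D (m n).
  apply: measurable_minr; [exact: md|exact: measurable_cst].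
have iK := integrable_period_cst K.
have im n : mu.-integrable D (EFin \o m n).
  refine (@le_integrable _ _ _ mu D measurable_period _ (EFin \o (fun=> K))
     (proj2 (measurable_EFinP _ _) (mm n)) _ iK).
  by move=> t _ /=; rewrite lee_fin !ger0_norm ?(ltW K0)// /m ge_min lexx orbT.
have id_ n : mu.-integrable D (EFin \o (fun t => m n t + K^-1 * d n t ^+ 2)).
  by apply: integrable_realD => //; exact: integrable_realM.
have le n t : d n t <= m n t + K^-1 * d n t ^+ 2.
  have [h|/ltW h] := lerP (d n t) K.
    by rewrite /m (min_idPl h) lerDl mulr_ge0 ?invr_ge0 ?sqr_ge0 ?(ltW K0).
  have : d n t <= K^-1 * d n t ^+ 2.
    by rewrite mulrC ler_pdivlMr// expr2 ler_wpM2l ?d0// ltW.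
  by move/le_trans; apply; rewrite lerDr m0.
have id1 n : mu.-integrable D (EFin \o d n).
  refine (@le_integrable _ _ _ mu D measurable_period _
    (EFin \o (fun t => m n t + K^-1 * d n t ^+ 2))
    (proj2 (measurable_EFinP _ _) (md n)) _ (id_ n)).
  by move=> t _ /=; rewrite lee_fin !ger0_norm ?le ?addr_ge0 ?mulr_ge0 ?invr_ge0 ?sqr_ge0 ?(ltW K0).
have c1 : {ae mu, forall t, D t -> (EFin \o m n) t @[n --> \oo] --> (0%E : \bar R)}.
  move: dcvg; apply: (@filterS _ _ aeF) => t h Dt.
  apply: cvg_EFin; first exact: nearW.
  apply/cvgrP => x x0; have /cvgrP/(_ x x0)[N hN] := h Dt.
  exists N => n /hN; rewrite !subr0 (ger0_norm (d0 _ _)).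
  rewrite -[X in `|X|]/(m n t) (ger0_norm (m0 _ _)).
  by apply: le_lt_trans; rewrite /m ge_min lexx.
have c2 : {ae mu, forall t n, D t -> (`|(EFin \o m n) t| <= (EFin \o (fun=> K)) t)%E}.
  apply: aeW => t n _; rewrite /= lee_fin (ger0_norm (m0 _ _)).
  by rewrite /m ge_min lexx orbT.
have [_ _] := @dominated_convergence _ _ _ mu D measurable_period
  (fun n => EFin \o m n) (cst 0%E) (EFin \o (fun=> K))
  (fun n => proj2 (measurable_EFinP _ _) (mm n)) (measurable_cst _) c1 iK c2.
rewrite integral_cst// mul0e => hlim.
have hl : (fun n => \int[mu]_(t in D) m n t) @ \oo --> (0 : R).
  exact: (fine_cvg hlim).
have /cvgrP/(_ (e / 2))[] := hl; first by rewrite divr_gt0.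
move=> N /(_ N (leqnn _)); rewrite subr0 => hN; exists N.
have le3 : \int[mu]_(t in D) d N t <=
    \int[mu]_(t in D) m N t + K^-1 * \int[mu]_(t in D) (d N t ^+ 2).
  rewrite -RintegralZl// -RintegralD//; last exact: integrable_realM.
  exact: le_Rintegral.
rewrite (le_trans le3)// (splitr e) lerD//.
  by rewrite ltW// (le_lt_trans _ hN)// ler_norm.
rewrite mulrC ler_pdivrMr// (le_trans (hB N))// /K mulrDr mulr1.
have -> : e / 2 * (2 * B / e) = B by field; rewrite gt_eqF.
by rewrite lerDl divr_ge0// ltW.
Qed.

Lemma Rintegral_norm2 f : \int[mu]_(t in D) (normc (f (expi t)) ^+ 2) =
  2 * pi * Re (inner f f).
Proof.
rewrite innerxx /= mulrA divff ?mul1r// gt_eqF// mulr_gt0 ?pi_gt0//.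
Qed.

Lemma normc_circle_integral f : cintegrable f ->
  normc (I f) <= 2 * ((2 * pi)^-1 * \int[mu]_(t in D) normc (f (expi t))).
Proof.
move=> hf; have [f1 f2] := hf; have nf := integrable_normc hf.
have p0 : 0 < (2 * pi : R)^-1 by rewrite invr_gt0 mulr_gt0 ?pi_gt0.
rewrite (le_trans (normc_le_ReIm _))// mulr2n mulrDl mul1r.
have h (g : R -> R) : mu.-integrable D (EFin \o g) ->
    (forall t, `|g t| <= normc (f (expi t))) ->
   `|(2 * pi)^-1 * \int[mu]_(t in D) g t| <=
     (2 * pi)^-1 * \int[mu]_(t in D) normc (f (expi t)).
  move=> ig le; rewrite normrM (gtr0_norm p0) ler_wpM2l ?(ltW p0)//.
  rewrite (le_trans (le_normr_Rintegral _ _))//.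
  apply: le_Rintegral => //.
  exact: integrable_norm ig.
by rewrite lerD//; apply: h => // t; [exact: Re_le|exact: Im_le].
Qed.

Lemma radial_cvgP (G : R -> C) (l : C) :
  (G s @[s --> (1 : R)^'-] --> (l : C^o)) ->
  (forall e : R, 0 < e -> exists2 d, 0 < d & forall s, 1 - d < s < 1 -> normc (G s - l) < e).
Proof.
move=> h e e0.
have /(_ _ e%:C) := proj1 (@cvgrPdist_lt C C^o _ _ _ G l) h.
rewrite ltcR => /(_ e0).
rewrite /at_left near_withinE => /nbhs_ballP[d /= d0 hd].
exists d => // s /andP[s1 s2].
have := hd s; rewrite /ball/= ltr_distlC s1 /= => /(_ _ s2).
rewrite (lt_trans s2) ?ltrDl// => /(_ isT).
by rewrite distrC norm_normc ltcR.
Qed.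

(** Partial sums of the dilations F (r z) have no moment of positive order, are
    bounded in L2 by Parseval, and tend almost everywhere to the boundary
    function when r tends to 1; [integral_small] passes to the limit. *)
Theorem H2_integral_mulz f : H2 f -> I (fun z => z * f z) = 0.
Proof.
move=> [L2f [F [[a [ca hF]] bF]]].
have [A [A0 hA hA2]] := hardy_bounded ca.
pose r n : R := 1 - n.+2%:R^-1.
have r01 n : 0 <= r n < 1.
  by rewrite /r subr_ge0 invf_le1 ?ltr0n// ler1n/= ltrBlDr ltrDl invr_gt0.
(* Uniform approximation of each dilation by a polynomial: a polynomial [p n]
   then replaces the dilation, and its moments are finite sums. *)
have /choice[N hN] : forall n, exists N, forall z, normc z <= r n ->
    normc (F z - \sum_(k < N) a k * z ^+ k) <= n.+1%:R^-1.
  by move=> n; apply: hardy_uniform => //.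
pose p n z := \sum_(k < N n) (a k * (r n)%:C ^+ k) * z ^+ k.
have bp n : cbounded (p n).
  apply: (cbounded_ext _ (cbounded_horner (\poly_(k < N n) (a k * (r n)%:C ^+ k)))) => t.
  by rewrite horner_poly.
have Lp n : L2 (p n) by exact: cbounded_L2.
have Ip n : I (fun z => z * p n z) = 0.
  transitivity (I (fun z => \sum_(k < N n) (a k * (r n)%:C ^+ k) * z ^+ k.+1)).
    apply: eq_circle_integral => t; rewrite mulr_sumr; apply: eq_bigr => k _.
    by rewrite mulrCA exprS.
  have hc (k : 'I_(N n)) : cintegrable (fun z : C => z ^+ k.+1) by exact/cbounded_cintegrable/cboundedX/cbounded_id.
  rewrite (circle_integral_sum _ _).2; last by move=> k; exact: cintegrableZ.
  by rewrite big1// => k _; rewrite circle_integralZ// circle_integral_expS mulr0.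
pose d n t := normc (p n (expi t) - f (expi t)).
have Ld n : L2 (fun z => p n z - f z) by exact: L2B.
have pn n : inner (p n) (p n) <= A%:C.
  have [_] := @inner_orthonormal_sum _ 'I_(N n) (fun k z => z ^+ k)
     (fun k => a k * (r n)%:C ^+ k)
     (fun k => cbounded_L2 (cboundedX k cbounded_id)) (fun i j => inner_exp i j).
  rewrite -/(p n) => ->; rewrite lecR (le_trans _ (hA2 (N n)))//.
  apply: ler_sum => k _; rewrite lerXn2r ?nnegrE ?normc_ge0//.
  have [r0 r1] := andP (r01 n).
  rewrite normcM normcX normc_real// ler_piMr ?normc_ge0//.
  by rewrite exprn_ile1// ltW.

apply: eq0_normc; apply/eqP; rewrite -(normr_le0 (normc _)) ger0_norm ?normc_ge0//.
apply/ler_addgt0Pr => e e0.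
have [n hn] : exists n, \int[mu]_(t in D) d n t <= e * pi.
  apply: (@integral_small d (2 * (2 * pi * A) + 2 * (2 * pi * Re (inner f f)))).
  - by move=> n; exact: (cmeasurable_normc (L2_cmeasurable (Ld n))).
  - by move=> n t; exact: normc_ge0.
  - move: bF; apply: (@filterS _ _ aeF) => t h Dt.
    have hc := radial_cvgP (h Dt).
    apply/cvgrP => x x0.
    have [del del0 hdel] := hc (x / 2) (divr_gt0 x0 (ltr0Sn _ _)).
    pose y := Num.min del (x / 2).
    have y0 : 0 < y by rewrite lt_min del0 divr_gt0.
    have [M hM] : exists M, forall n, (M <= n)%N -> n.+1%:R^-1 < y.
      exists (Num.truncn y^-1) => n hn.
      rewrite invf_plt ?posrE ?ltr0n//.
      by apply: lt_le_trans (truncnS_gt _) _; rewrite ler_nat.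
    exists M => n /[dup] Mn /hM; rewrite lt_min => /andP[h1 h2].
    rewrite subr0 ger0_norm ?normc_ge0// /d.
    have -> : p n (expi t) - f (expi t) =
       - (F ((r n)%:C * expi t) - \sum_(k < N n) a k * ((r n)%:C * expi t) ^+ k) +
        (F ((r n)%:C * expi t) - f (expi t)).
      rewrite opprB addrA subrK; congr (_ - _); apply: eq_bigr => k _.
      by rewrite exprMn mulrA.
    have [r0 r1] := andP (r01 n).
    rewrite (le_lt_trans (le_normcD _ _))// (splitr x) normcN ler_ltD//.
      apply: le_trans (ltW h2); apply: hN.
      by rewrite normcM expi_norm mulr1 normc_real.
    apply: hdel; rewrite r1 andbT /r ltrD2l ltrN2.
    by apply: lt_le_trans (hM n.+1 (leqW Mn)) _; rewrite ge_min lexx.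
  - by move=> n; have /L2E[] := Ld n.
  - move=> n.
    have /L2E[_ i1] := Ld n. have /L2E[_ i2] := Lp n. have /L2E[_ i3] := L2f.
    apply: (@le_trans _ _ (2 * (\int[mu]_(t in D) (normc (p n (expi t)) ^+ 2)) +
         2 * (\int[mu]_(t in D) (normc (f (expi t)) ^+ 2)))); last first.
      rewrite !Rintegral_norm2 lerD2r ler_wpM2l// ler_wpM2l ?mulr_ge0 ?pi_ge0//.
      by have := pn n; rewrite lecE => /andP[].
    rewrite -!RintegralZl// -RintegralD//; try exact: integrable_realM.
    apply: le_Rintegral => //.
      by apply: integrable_realD; exact: integrable_realM.
    move=> t _; rewrite /d.
    have h := le_normcD (p n (expi t)) (- f (expi t)).
    rewrite normcN in h.
    have := normc_ge0 (p n (expi t) - f (expi t)).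
    have := sqr_ge0 (normc (p n (expi t)) - normc (f (expi t))); nra.
  - by rewrite mulr_gt0 ?pi_gt0.
have -> : I (fun z => z * f z) = - I (fun z => z * (p n z - f z)).
  have cz g : L2 g -> cintegrable (fun z => z * g z).
    by move=> Lg; exact: L2_cintegrable (L2_cboundedM cbounded_id Lg).
  rewrite -[RHS]mulN1r -circle_integralZ; last exact: cz.
  transitivity (-1 * I (fun z => z * (p n z - f z)) + I (fun z => z * p n z)); last first.
    by rewrite Ip addr0 circle_integralZ//; exact: cz.
  rewrite -circle_integralZ; last exact: cz.
  rewrite -circle_integralD; last 2 first.
  - exact/cintegrableZ/cz.
  - exact: cz.
  by apply: eq_circle_integral => t; ring.
rewrite normcN add0r.
have Lz : cintegrable (fun z => z * (p n z - f z)).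
  exact: L2_cintegrable (L2_cboundedM cbounded_id (Ld n)).
rewrite (le_trans (normc_circle_integral Lz))//.
under eq_Rintegral do rewrite normcM expi_norm mul1r.
rewrite mulrA -[X in X * _](_ : pi^-1 = _); last first.
  by rewrite invfM mulrA divff ?mul1r// gt_eqF.
by rewrite mulrC ler_pdivrMr ?pi_gt0.
Qed.
End HardyMean.

(** * Operations preserving the Hardy space *)

Section HardyClosure.
Variable R : realType.
Local Notation C := R[i].
Local Notation Re := complex.Re.
Local Notation Im := complex.Im.
Implicit Types (f g h F : C -> C) (z w : C) (a : nat -> C).


Section ComplexLimits.
Context (T : Type) (G : set_system T) {FG : Filter G}.
Implicit Types (u v : T -> C).

Lemma cvgcD u v (a b : C) : (u @ G --> (a : C^o)) -> (v @ G --> (b : C^o)) ->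
  ((fun x => u x + v x) @ G --> (a + b : C^o)).
Proof. exact: (@cvgD C C^o T G FG u v a b). Qed.

Lemma cvgcM u v (a b : C) : (u @ G --> (a : C^o)) -> (v @ G --> (b : C^o)) ->
  ((fun x => u x * v x) @ G --> (a * b : C^o)).
Proof. exact: (@cvgM C T G FG u v a b). Qed.

Lemma cvgcV u (a : C) : a != 0 -> (u @ G --> (a : C^o)) ->
  ((fun x => (u x)^-1) @ G --> (a^-1 : C^o)).
Proof. by move=> a0; exact: (@cvgV C T G FG u a a0). Qed.

Lemma cvgc_cst (a : C) : ((fun _ : T => a) @ G --> (a : C^o)).
Proof. exact: (@cvg_cst C^o a T G FG). Qed.

Lemma cvgcB u v (a b : C) : (u @ G --> (a : C^o)) -> (v @ G --> (b : C^o)) ->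
  ((fun x => u x - v x) @ G --> (a - b : C^o)).
Proof. exact: (@cvgB C C^o T G FG u v a b). Qed.
End ComplexLimits.

(** Lets recurrences be solved with the initial term split off. *)
Lemma cvgc_shiftS (u : nat -> C) (l : C) :
  ((fun n => u n.+1) @ \oo --> (l : C^o)) -> (u @ \oo --> (l : C^o)).
Proof.
move=> /cvgcP h; apply/cvgcP => e /h[N hN]; exists N.+1 => -[//|n] /hN.
exact.
Qed.

Lemma cvgc_unique (u : nat -> C) (a b : C) : (u @ \oo --> (a : C^o)) -> (u @ \oo --> (b : C^o)) -> a = b.
Proof.
move=> /cvgcP ha /cvgcP hb; apply/eqP; rewrite -subr_eq0; apply/eqP/eq0_normc.
apply/eqP; rewrite eq_le normc_ge0 andbT; apply/ler_addgt0Pr => e e0.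
have [N hN] := ha (e / 2) (divr_gt0 e0 (ltr0Sn _ _)).
have [M hM] := hb (e / 2) (divr_gt0 e0 (ltr0Sn _ _)).
have h1 := hN (N + M)%N (leq_addr _ _); have h2 := hM (N + M)%N (leq_addl _ _).
have -> : a - b = (a - u (N + M)%N) + (u (N + M)%N - b) by ring.
by rewrite add0r (le_trans (le_normcD _ _))// (splitr e) lerD// ?ltW// normcB.
Qed.

(** Completeness of the complex numbers, used for geometrically dominated series
    only, by real and imaginary parts. *)
Lemma series_cvg (c : nat -> C) (A r : R) : 0 <= A -> 0 <= r < 1 ->
  (forall k, normc (c k) <= A * r ^+ k) ->
  exists l : C, series c @ \oo --> (l : C^o).
Proof.
move=> A0 /andP[r0 r1] hc.
have cg : cvgn (series (geometric A r)) by apply: is_cvg_geometric_series; rewrite ger0_norm.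
have cr (u : nat -> R) : (forall k, `|u k| <= normc (c k)) -> cvgn (series u).
  move=> hu; apply: normed_cvg.
  apply: (series_le_cvg _ _ _ cg) => k //=; first by rewrite mulr_ge0// exprn_ge0.
  by rewrite (le_trans (hu k)).
have /cvg_ex[x /cvgrP hx] := cr (fun k => Re (c k)) (fun k => Re_le _).
have /cvg_ex[y /cvgrP hy] := cr (fun k => Im (c k)) (fun k => Im_le _).
exists (x +i* y); apply/cvgcP => e e0.
have e2 : 0 < e / 2 by rewrite divr_gt0.
have [N hN] := hx _ e2; have [M hM] := hy _ e2.
exists (N + M)%N => n hn.
rewrite (le_lt_trans (normc_le_ReIm _))// (splitr e).
have sRe : Re (series c n) = series (fun k => Re (c k)) n.
  rewrite /series/=; elim/big_ind2: _ => // x1 x2 y1 y2 <- <-; exact: cReD.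
have sIm : Im (series c n) = series (fun k => Im (c k)) n.
  rewrite /series/=; elim/big_ind2: _ => // x1 x2 y1 y2 <- <-; exact: cImD.
have reB z w : Re (z - w) = Re z - Re w by case: z w => ? ? [? ?].
have imB z w : Im (z - w) = Im z - Im w by case: z w => ? ? [? ?].
rewrite reB imB sRe sIm/= ltrD//.
  exact/hN/(leq_trans (leq_addr _ _) hn).
exact/hM/(leq_trans (leq_addl _ _) hn).
Qed.

Definition l2seq a := cvgn (series (fun k => normc (a k) ^+ 2)).

Lemma l2seqP a (A : R) : (forall n, \sum_(k < n) normc (a k) ^+ 2 <= A) -> l2seq a.
Proof.
move=> h; apply: nondecreasing_is_cvgn.
  apply: nondecreasing_series => k _ _; exact: sqr_ge0.
by exists A => _ [n _ <-]; rewrite /series/= big_mkord.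
Qed.

Lemma expr_cvg0 z : `|z| < 1 -> (fun n => z ^+ n) @ \oo --> (0 : C^o).
Proof.
move=> hz; apply/cvgcP => e e0; rewrite norm_normc ltcR in hz.
have hr : 0 <= normc z < 1 by rewrite normc_ge0.
have [N hN] := @expr_small R 1 _ e hr e0; exists N => n Nn.
rewrite subr0 normcX; apply: le_lt_trans hN; rewrite mul1r.
by rewrite ler_wiXn2l ?normc_ge0// ltW.
Qed.

Lemma bounded_cvg0 (g : nat -> C) (A : R) z : (forall k, normc (g k) <= A) ->
  `|z| < 1 -> (fun n => g n * z ^+ n) @ \oo --> (0 : C^o).
Proof.
move=> hg hz; have A0 : 0 <= A := le_trans (normc_ge0 _) (hg 0%N).
have /cvgcP h := expr_cvg0 hz; apply/cvgcP => e e0.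
have [N hN] := h (e / (A + 1)) (divr_gt0 e0 (ltr_wpDl A0 ltr01)).
exists N => n /hN; rewrite !subr0 ltr_pdivlMr ?ltr_wpDl//; apply: le_lt_trans.
rewrite normcM mulrC ler_wpM2l ?normc_ge0// (le_trans (hg n))// lerDl//.
Qed.

(** Convexity of the square for the weights 1 - rho and rho. It turns a first
    order recurrence with contraction rho into an l2 bound for its solution. *)
Lemma sqr_convex (x y rho : R) : 0 <= rho < 1 ->
  (x + rho * y) ^+ 2 <= x ^+ 2 / (1 - rho) + rho * y ^+ 2.
Proof.
move=> /andP[r0 r1]; have h : 0 < 1 - rho by rewrite subr_gt0.
rewrite -(ler_pM2r h) mulrDl divfK ?gt_eqF//.
have := mulr_ge0 r0 (sqr_ge0 (x - (1 - rho) * y)); nra.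
Qed.

Lemma normc2_convex (x y c : C) : normc c < 1 ->
  normc (x + c * y) ^+ 2 <= normc x ^+ 2 / (1 - normc c) + normc c * normc y ^+ 2.
Proof.
move=> hc; apply: le_trans (sqr_convex _ _ _); last by rewrite normc_ge0.
rewrite lerXn2r ?nnegrE ?addr_ge0 ?mulr_ge0 ?normc_ge0//.
by rewrite -normcM le_normcD.
Qed.

(** The coefficients g of F / (1 - c z) satisfy g_(k+1) = a_(k+1) + c g_k, which
    is solved forwards; [normc2_convex] sums the squares. *)
Lemma hardy_div F (c : C) : hardy_disk F -> `|c| < 1 ->
  hardy_disk (fun z => F z / (1 - c * z)).
Proof.
move=> [a [ca hF]] hc; have [A [A0 hA hA2]] := hardy_bounded ca.
have hc' := hc; rewrite norm_normc ltcR in hc'; set rho := normc c in hc'.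
have h0 : 0 < 1 - rho by rewrite subr_gt0.
pose g := fix g n := if n is k.+1 then a k.+1 + c * g k else a 0%N.
have gS k : g k.+1 = a k.+1 + c * g k by [].
have S n : \sum_(k < n) normc (g k) ^+ 2 <= A / (1 - rho) / (1 - rho).
  rewrite ler_pdivlMr// mulrBr mulr1 lerBlDr.
  have : \sum_(k < n) normc (g k) ^+ 2 <=
     (\sum_(k < n) normc (a k) ^+ 2) / (1 - rho) + (\sum_(k < n) normc (g k) ^+ 2) * rho.
    case: n => [|n]; first by rewrite !big_ord0 !mul0r addr0.
    have : \sum_(k < n.+1) normc (g k) ^+ 2 <=
     (\sum_(k < n.+1) normc (a k) ^+ 2) / (1 - rho) + (\sum_(k < n) normc (g k) ^+ 2) * rho.
      rewrite !big_ord_recl /= mulrDl -addrA lerD//.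
        by rewrite ler_pdivlMr// ler_piMr ?sqr_ge0// gerBl normc_ge0.
      rewrite !mulr_suml -big_split/=; apply: ler_sum => k _.
      by rewrite [X in _ <= _ + X]mulrC; exact: normc2_convex.
    move/le_trans; apply; rewrite lerD2l ler_wpM2r ?normc_ge0//.
    by rewrite big_ord_recr/= lerDl sqr_ge0.
  move/le_trans; apply; rewrite lerD2r ler_wpM2r ?invr_ge0 ?(ltW h0)//.
have lg : l2seq g := l2seqP S.
have [B [B0 hB _]] := hardy_bounded lg.
exists g; split; first exact: lg.
move=> z hz.
have n0 : 1 - c * z != 0.
  rewrite subr_eq0; apply/eqP => h.
  have : `|c * z| < 1 by rewrite normrM -[ltRHS]mulr1 ltr_pM.
  by rewrite -h normr1 ltxx.
have e n : series (fun k => g k * z ^+ k) n =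
   (series (fun k => a k * z ^+ k) n - (if n is k.+1 then c * (g k * z ^+ k) * z else 0)) / (1 - c * z).
  apply: (mulIf n0); rewrite -mulrA mulVf// mulr1 /series/=.
  elim: n => [|n IH]; first by rewrite !big_geq// mul0r subr0.
  rewrite !big_nat_recr//= mulrDl IH; case: n {IH} => [|n]; rewrite /= ?expr0 ?exprS; ring.
rewrite (_ : series _ = fun n => (series (fun k => a k * z ^+ k) n - (if n is k.+1 then c * (g k * z ^+ k) * z else 0)) / (1 - c * z)); last by apply/funext.
apply: cvgcM; last exact: cvgc_cst.
rewrite -[F z]subr0; apply: cvgcB; first exact: hF.
have -> : (0 : C) = c * 0 * z by rewrite mulr0 mul0r.
apply: cvgc_shiftS => /=.
apply: cvgcM; last exact: cvgc_cst.
apply: cvgcM; first exact: cvgc_cst.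
exact: bounded_cvg0 hB hz.
Qed.

(** The coefficients of (F - F b) / (z - b) are s_(k+1), where s_j is the sum over
    i of a_(j+i) b^i. The backward recurrence s_j = a_j + b s_(j+1) telescopes
    the partial sums and, by [normc2_convex], bounds the squares. *)
Lemma hardy_divided_diff F b : hardy_disk F -> `|b| < 1 ->
  exists G, hardy_disk G /\
    forall z, `|z| < 1 -> z != b -> G z = (F z - F b) / (z - b).
Proof.
move=> [a [ca hF]] hb; have [A [A0 hA hA2]] := hardy_bounded ca.
have hb' := hb; rewrite norm_normc ltcR in hb'; set rho := normc b in hb'.
have hrho : 0 <= rho < 1 by rewrite normc_ge0.
have h0 : 0 < 1 - rho by rewrite subr_gt0.
have /choice[s hs] : forall j, exists l : C,
    series (fun i => a (j + i)%N * b ^+ i) @ \oo --> (l : C^o).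
  move=> j; apply: (@series_cvg _ A rho) => // k.
  by rewrite normcM normcX ler_wpM2r// exprn_ge0// normc_ge0.
have s0 : s 0%N = F b by apply: cvgc_unique (hs 0%N) (hF b hb).
have sS j : s j = a j + b * s j.+1.
  apply: cvgc_unique (hs j) _; apply: cvgc_shiftS.
  rewrite (_ : (fun n => _) = (fun n => a j + b * series (fun i => a (j.+1 + i)%N * b ^+ i) n)).
    by apply: cvgcD; [exact: cvgc_cst|apply: cvgcM; [exact: cvgc_cst|exact: hs]].
  apply/funext => n; rewrite /series/= big_nat_recl//= addn0 expr0 mulr1; congr (_ + _).
  rewrite mulr_sumr; apply: eq_bigr => i _; rewrite addnS exprS; ring.
(* A uniform bound on s is needed for the boundary term of the summed recurrence. *)
have sB j : normc (s j) <= A / (1 - rho).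
  apply/ler_addgt0Pr => e e0; have /cvgcP/(_ e e0)[N hN] := hs j.
  have := hN N (leqnn _); have := @geometric_tail R A rho (fun i => a (j + i)%N) b 0 N A0 hrho (fun k => hA _) (lexx _).
  rewrite expr0 mulr1 add0n => g1 g2.
  have -> : s j = series (fun i => a (j + i)%N * b ^+ i) N - (series (fun i => a (j + i)%N * b ^+ i) N - s j) by ring.
  by rewrite (le_trans (le_normcD _ _))// normcN lerD// ltW.
pose M := A / (1 - rho).
have M0 : 0 <= M by rewrite divr_ge0// ltW.
have S n : \sum_(k < n) normc (s k) ^+ 2 <= (A / (1 - rho) + rho * M ^+ 2) / (1 - rho).
  rewrite ler_pdivlMr// mulrBr mulr1 lerBlDr.
  have : \sum_(k < n) normc (s k) ^+ 2 <=
     (\sum_(k < n) normc (a k) ^+ 2) / (1 - rho) +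
     rho * (\sum_(k < n) normc (s k.+1) ^+ 2).
    rewrite mulr_suml mulr_sumr -big_split/=; apply: ler_sum => k _.
    by rewrite [in leLHS]sS; exact: normc2_convex.
  move/le_trans; apply; rewrite -addrA lerD//.
    by rewrite ler_wpM2r// invr_ge0 ltW.
  rewrite [X in _ <= _ + X]mulrC -mulrDr ler_wpM2l ?normc_ge0//.
  have : \sum_(k < n) normc (s k.+1) ^+ 2 <= \sum_(k < n.+1) normc (s k) ^+ 2.
    by rewrite [leRHS]big_ord_recl/= lerDr sqr_ge0.
  move/le_trans; apply; rewrite big_ord_recr/= addrC lerD2r.
  by rewrite lerXn2r ?nnegrE ?normc_ge0.
pose g k := s k.+1.
have lg : l2seq g.
  apply: (@l2seqP _ ((A / (1 - rho) + rho * M ^+ 2) / (1 - rho))) => n.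
  apply: le_trans (S n.+1); by rewrite [leRHS]big_ord_recl/= lerDr sqr_ge0.
have gB k : normc (g k) <= M by exact: sB.
have /choice[G hG] : forall z, exists l : C, `|z| < 1 ->
    series (fun k => g k * z ^+ k) @ \oo --> (l : C^o).
  move=> z; have [hz|hz] := boolP (`|z| < 1); last by exists 0.
  have [] := @series_cvg (fun k => g k * z ^+ k) M (normc z) M0.
  - by rewrite normc_ge0 -ltcR.
  - by move=> k; rewrite normcM normcX ler_wpM2r// exprn_ge0// normc_ge0.
  by move=> l hl; exists l.
exists G; split; first by exists g; split.
move=> z hz zb; apply: cvgc_unique (hG z hz) _.
have n0 : z - b != 0 by rewrite subr_eq0.
have e n : series (fun k => g k * z ^+ k) n =
   (series (fun k => a k * z ^+ k) n - F b + s n * z ^+ n) / (z - b).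
  apply: (mulIf n0); rewrite divfK// /series/=.
  elim: n => [|n IH]; first by rewrite !big_geq// mul0r sub0r expr0 mulr1 s0 addNr.
  rewrite !big_nat_recr//= mulrDl IH {1}sS /g exprS; ring.
rewrite (funext e); apply: cvgcM; last exact: cvgc_cst.
rewrite -[F z - F b]addr0; apply: cvgcD; last exact: bounded_cvg0 sB hz.
by apply: cvgcB; [exact: hF|exact: cvgc_cst].
Qed.

Lemma hardy_cst (c : C) : hardy_disk (fun _ => c).
Proof.
pose a k : C := if k is 0%N then c else 0.
exists a; split.
  apply: (@l2seqP _ (normc c ^+ 2)) => -[|n]; first by rewrite big_ord0 sqr_ge0.
  by rewrite big_ord_recl/= big1 ?addr0// => i _; rewrite !expr0n/= addr0 sqrtr0 expr0n.
move=> z _; apply: cvgc_shiftS.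
rewrite (_ : (fun n => _) = (fun _ => c)); first exact: cvgc_cst.
apply/funext => n; rewrite /series/= big_nat_recl//= expr0 mulr1 big1 ?addr0// => i _.
by rewrite mul0r.
Qed.

Lemma hardy_mulz F : hardy_disk F -> hardy_disk (fun z => z * F z).
Proof.
move=> [a [ca hF]]; have [A [A0 hA hA2]] := hardy_bounded ca.
pose g k : C := if k is j.+1 then a j else 0.
exists g; split.
  apply: (@l2seqP _ A) => -[|n]; first by rewrite big_ord0.
  by rewrite big_ord_recl/= !expr0n/= addr0 sqrtr0 expr0n/= add0r hA2.
move=> z hz; apply: cvgc_shiftS.
rewrite (_ : (fun n => _) = (fun n => z * series (fun k => a k * z ^+ k) n)).
  by apply: cvgcM; [exact: cvgc_cst|exact: hF].
apply/funext => n; rewrite /series/= big_nat_recl//= mul0r add0r mulr_sumr.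
by apply: eq_bigr => i _; rewrite exprS; ring.
Qed.

Lemma hardyD F G : hardy_disk F -> hardy_disk G -> hardy_disk (fun z => F z + G z).
Proof.
move=> [a [ca hF]] [b [cb hG]].
have [A [A0 hA hA2]] := hardy_bounded ca; have [B [B0 hB hB2]] := hardy_bounded cb.
exists (fun k => a k + b k); split.
  apply: (@l2seqP _ (2 * A + 2 * B)) => n.
  apply: (@le_trans _ _ (\sum_(k < n) (2 * normc (a k) ^+ 2 + 2 * normc (b k) ^+ 2))).
    apply: ler_sum => k _; have h := le_normcD (a k) (b k).
    have := normc_ge0 (a k + b k); have := sqr_ge0 (normc (a k) - normc (b k)); nra.
  by rewrite big_split/= -!mulr_sumr; apply: lerD; rewrite ler_wpM2l ?hA2 ?hB2.
move=> z hz.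
rewrite (_ : series _ = (fun n => series (fun k => a k * z ^+ k) n + series (fun k => b k * z ^+ k) n)).
  by apply: cvgcD; [exact: hF|exact: hG].
by apply/funext => n; rewrite /series/= -big_split/=; apply: eq_bigr => i _; rewrite mulrDl.
Qed.

Lemma hardyZ (c : C) F : hardy_disk F -> hardy_disk (fun z => c * F z).
Proof.
move=> [a [ca hF]]; have [A [A0 hA hA2]] := hardy_bounded ca.
exists (fun k => c * a k); split.
  apply: (@l2seqP _ (normc c ^+ 2 * A)) => n.
  under eq_bigr do rewrite normcM exprMn.
  by rewrite -mulr_sumr ler_wpM2l ?hA2// sqr_ge0.
move=> z hz.
rewrite (_ : series _ = (fun n => c * series (fun k => a k * z ^+ k) n)).
  by apply: cvgcM; [exact: cvgc_cst|exact: hF].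
by apply/funext => n; rewrite /series/= mulr_sumr; apply: eq_bigr => i _; rewrite mulrA.
Qed.

(** Radial limits in epsilon form, in which the algebra of limits does not involve
    the topology of the complex type. *)
Definition radlim F z (l : C) := forall e : R, 0 < e ->
  exists2 d, 0 < d & forall s : R, 1 - d < s < 1 -> normc (F (s%:C * z) - l) < e.

Lemma radlimP F z (l : C) :
  ((F (r%:C * z) : C^o) @[r --> (1 : R)^'-] --> (l : C^o)) <-> radlim F z l.
Proof.
split; first by move=> h; exact: (radial_cvgP h).
move=> h; apply: (proj2 (@cvgrPdist_lt C C^o _ _ _ _ _)) => e e0.
have eR : e = (Re e)%:C by rewrite RRe_real// gtr0_real.
have /h[d d0 hd] : 0 < Re e by rewrite -ltcR -eR.
rewrite /at_left near_withinE; apply/nbhs_ballP; exists d => // s.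
rewrite /ball/= ltr_distlC => /andP[s1 _] s2.
by rewrite eR distrC norm_normc ltcR; apply: hd; rewrite s1.
Qed.

Lemma radlimD F G z (a b : C) : radlim F z a -> radlim G z b ->
  radlim (fun z => F z + G z) z (a + b).
Proof. by move=> /radlimP h1 /radlimP h2; apply/radlimP; exact: (cvgcD h1 h2). Qed.

Lemma radlimM F G z (a b : C) : radlim F z a -> radlim G z b ->
  radlim (fun z => F z * G z) z (a * b).
Proof. by move=> /radlimP h1 /radlimP h2; apply/radlimP; exact: (cvgcM h1 h2). Qed.

Lemma radlimB F G z (a b : C) : radlim F z a -> radlim G z b ->
  radlim (fun z => F z - G z) z (a - b).
Proof. by move=> /radlimP h1 /radlimP h2; apply/radlimP; exact: (cvgcB h1 h2). Qed.

Lemma radlimV F z (a : C) : a != 0 -> radlim F z a ->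
  radlim (fun z => (F z)^-1) z a^-1.
Proof. by move=> a0 /radlimP h; apply/radlimP; exact: (cvgcV a0 h). Qed.

Lemma radlim_cst (c : C) z : radlim (fun _ => c) z c.
Proof. by move=> e e0; exists 1 => // s _; rewrite subrr normc0. Qed.

Lemma radlim_id z : radlim id z z.
Proof.
move=> e e0; have n0 : 0 < normc z + 1 by rewrite ltr_wpDl ?normc_ge0.
exists (e / (normc z + 1)); first by rewrite divr_gt0.
move=> s /andP[s1 s2].
have e1 : 1 - s%:C = (1 - s)%:C by rewrite rmorphB rmorph1.
rewrite -[X in _ - X]mul1r -mulrBl normcM normcB e1 normc_real ?subr_ge0 ?ltW//.
have : 1 - s < e / (normc z + 1) by rewrite ltrBlDr -ltrBlDl.
rewrite ltr_pdivlMr//; apply: le_lt_trans.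
by apply: ler_wpM2l; rewrite ?lerDl// subr_ge0 ltW.
Qed.

Lemma boundary_valuesP F f :
  boundary_values F f <-> ae_circle (fun z => radlim F z (f z)).
Proof.
split; rewrite /boundary_values; apply: ae_circle_imp => z _ h.
  exact: (proj1 (radlimP _ _ _) h).
exact: (proj2 (radlimP _ _ _) h).
Qed.

Lemma ae_circle_lim f g F (G : C -> C) : boundary_values F f ->
  (forall z, `|z| = 1 -> radlim F z (f z) -> radlim G z (g z)) ->
  boundary_values G g.
Proof.
move=> /boundary_valuesP hF h; apply/boundary_valuesP.
by move: hF; exact: ae_circle_imp.
Qed.

Lemma H2_L2 f : H2 f -> L2 f. Proof. by case. Qed.

(** Membership in L2 is required again because changing a function on a null set
    may destroy Borel measurability. *)
Lemma H2_ae f g : H2 f -> L2 g -> eq_circle f g -> H2 g.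
Proof.
move=> [_ [F [hF bF]]] Lg fg; split; first exact: Lg.
exists F; split; first exact: hF.
by move: bF fg; apply: ae_circle_imp2 => z _ + <-.
Qed.

Lemma H2_ext f g : H2 f -> (forall z, `|z| = 1 -> f z = g z) -> H2 g.
Proof.
move=> hf fg; apply: (H2_ae hf); last exact: ae_circleW.
by apply: L2_ext (H2_L2 hf) => t; apply: fg; exact: expi_norm1.
Qed.

Lemma H2_cst (c : C) : H2 (fun _ => c).
Proof.
split; first exact/cbounded_L2/cbounded_cst.
exists (fun _ => c); split; first exact: hardy_cst.
by apply/boundary_valuesP; apply: ae_circleW => z _; exact: radlim_cst.
Qed.

Lemma H2_mulz f : H2 f -> H2 (fun z => z * f z).
Proof.
move=> [Lf [F [hF bF]]]; split; first exact: (L2_cboundedM cbounded_id).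
exists (fun z => z * F z); split; first exact: hardy_mulz.
by apply: (ae_circle_lim bF) => z _ h; exact: (radlimM (radlim_id z) h).
Qed.

Lemma H2D f g : H2 f -> H2 g -> H2 (fun z => f z + g z).
Proof.
move=> [Lf [F [hF bF]]] [Lg [G [hG bG]]]; split; first exact: L2D.
exists (fun z => F z + G z); split; first exact: hardyD.
move/boundary_valuesP in bF; move/boundary_valuesP in bG; apply/boundary_valuesP.
by move: bF bG; apply: ae_circle_imp2 => z _; exact: radlimD.
Qed.

Lemma H2Z (c : C) f : H2 f -> H2 (fun z => c * f z).
Proof.
move=> [Lf [F [hF bF]]]; split; first exact: L2Z.
exists (fun z => c * F z); split; first exact: hardyZ.
by apply: (ae_circle_lim bF) => z _ h; exact: (radlimM (radlim_cst _ _) h).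
Qed.

(** Keeps 1 - c z away from 0 on the circle. *)
Lemma norm_gap (c z : C) : `|c| < 1 -> `|z| = 1 -> 1 - normc c <= normc (1 - c * z).
Proof.
move=> _ hz; have nz : normc z = 1 by have := hz; rewrite norm_normc => -[].
rewrite lerBlDr; have := le_normcD (1 - c * z) (c * z).
by rewrite subrK normc1 normcM nz mulr1.
Qed.

Lemma gap_neq0 (c z : C) : `|c| < 1 -> `|z| = 1 -> 1 - c * z != 0.
Proof.
move=> hc hz; have h := norm_gap hc hz; apply/eqP => e; move: h.
rewrite e normc0 leNgt subr_gt0; by rewrite norm_normc ltcR in hc; rewrite hc.
Qed.

Lemma cbounded_gapV (c : C) : `|c| < 1 -> cbounded (fun z => (1 - c * z)^-1).
Proof.
move=> hc; split.
  by apply/cmeasurableV/cmeasurableB; [exact: cmeasurable_cst|apply: cmeasurableM; [exact: cmeasurable_cst|exact: cmeasurable_id]].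
have h0 : 0 < 1 - normc c by rewrite subr_gt0; rewrite norm_normc ltcR in hc.
exists (1 - normc c)^-1 => t; rewrite normcV.
have h := norm_gap hc (expi_norm1 t).
by rewrite lef_pV2// posrE (lt_le_trans h0).
Qed.

Lemma H2_div (c : C) f : `|c| < 1 -> H2 f -> H2 (fun z => f z / (1 - c * z)).
Proof.
move=> hc [Lf [F [hF bF]]]; split.
  by apply: (L2_ext _ (L2_cboundedM (cbounded_gapV hc) Lf)) => t; rewrite mulrC.
exists (fun z => F z / (1 - c * z)); split; first exact: hardy_div.
apply: (ae_circle_lim bF) => z hz h; apply: (radlimM h).
apply: (radlimV (gap_neq0 hc hz)).
exact: (radlimB (radlim_cst _ _) (radlimM (radlim_cst _ _) (radlim_id z))).
Qed.

Lemma unit_subE (b z : C) : `|z| = 1 -> z - b = z * (1 - b * z^*).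
Proof.
move=> hz; have z0 : z != 0 by rewrite -normr_gt0 hz.
by rewrite unimod_conj// mulrBr mulr1 mulrCA divff// mulr1.
Qed.

Lemma unit_sub_neq0 (b z : C) : `|b| < 1 -> `|z| = 1 -> z - b != 0.
Proof.
move=> hb hz; rewrite subr_eq0; apply/eqP => e; move: hb; rewrite -e hz ltxx//.
Qed.

Lemma cbounded_subV (b : C) : `|b| < 1 -> cbounded (fun z => (z - b)^-1).
Proof.
move=> hb; split.
  by apply/cmeasurableV/cmeasurableB; [exact: cmeasurable_id|exact: cmeasurable_cst].
have h0 : 0 < 1 - normc b by rewrite subr_gt0; rewrite norm_normc ltcR in hb.
exists (1 - normc b)^-1 => t; rewrite normcV.
have h : 1 - normc b <= normc (expi t - b).
  rewrite (unit_subE _ (expi_norm1 t)) normcM expi_norm mul1r; apply: norm_gap => //.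
  by rewrite norm_conjC expi_norm1.
by rewrite lef_pV2// posrE (lt_le_trans h0).
Qed.

(** Division of a Hardy function by z - b with constant remainder. *)
Lemma H2_divided_diff (b : C) f : `|b| < 1 -> H2 f ->
  exists (c : C) h, H2 h /\ forall z, `|z| = 1 -> f z = c + (z - b) * h z.
Proof.
move=> hb [Lf [F [hF bF]]].
have [G [hG GE]] := hardy_divided_diff hF hb.
exists (F b), (fun z => (f z - F b) / (z - b)); split; last first.
  by move=> z hz; rewrite mulrC divfK ?unit_sub_neq0// addrC subrK.
split.
  apply: (L2_ext _ (L2_cboundedM (cbounded_subV hb) (L2B Lf (cbounded_L2 (cbounded_cst (F b)))))) => t.
  by rewrite mulrC.
exists G; split; first exact: hG.
apply: (ae_circle_lim bF) => z hz h.
have hl : radlim (fun z => (F z - F b) / (z - b)) z ((f z - F b) / (z - b)).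
  apply: (radlimM (radlimB h (radlim_cst _ _))).
  exact: (radlimV (unit_sub_neq0 hb hz) (radlimB (radlim_id z) (radlim_cst _ _))).
have hb' : normc b < 1 by rewrite norm_normc ltcR in hb.
have nz : normc z = 1 by have := hz; rewrite norm_normc => -[].
move=> e /hl[d d0 hd]; exists (Num.min d (1 - normc b)).
  by rewrite lt_min d0 subr_gt0.
move=> s /andP[s1 s2].
have [h1 h2] : 1 - d < s /\ normc b < s.
  have m1 : Num.min d (1 - normc b) <= d by rewrite ge_min lexx.
  have m2 : Num.min d (1 - normc b) <= 1 - normc b by rewrite ge_min lexx orbT.
  split; lra.
have s0 : 0 <= s := ltW (le_lt_trans (normc_ge0 b) h2).
have ns : normc (s%:C * z) = s by rewrite normcM nz mulr1 normc_real.
rewrite GE; first by apply: hd; rewrite h1.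
  by rewrite norm_normc ns ltcR.
by apply/eqP => e'; move: h2; rewrite -e' ns ltxx.
Qed.

End HardyClosure.

(** * Model spaces of finite Blaschke products *)

Section ModelSpace.
Variable R : realType.
Local Notation C := R[i].
Local Notation I := (@circle_integral R).
Implicit Types (f g h F : C -> C) (z w : C) (p q : {poly C}).

Lemma H2_horner p f : H2 f -> H2 (fun z => p.[z] * f z).
Proof.
move=> hf; elim/poly_ind: p => [|p c IH].
  by apply: (H2_ext (H2_cst 0)) => z _; rewrite horner0 mul0r.
apply: (H2_ext (H2D (H2_mulz IH) (H2Z c hf))) => z _.
by rewrite hornerMXaddC; ring.
Qed.

Lemma H2_divprod (n : nat) (c : 'I_n -> C) f : (forall j, `|c j| < 1) -> H2 f ->
  H2 (fun z => f z / \prod_(j < n) (1 - c j * z)).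
Proof.
elim: n c f => [|n IH] c f hc hf.
  by apply: (H2_ext hf) => z _; rewrite big_ord0 divr1.
apply: (H2_ext (IH (fun j => c (widen_ord (leqnSn n) j)) _ _ (H2_div (hc ord_max) hf))) => //.
by move=> z _; rewrite big_ord_recr/= invfM; ring.
Qed.

(** Division by a product of n linear factors leaves a remainder of degree < n;
    this is what makes model spaces of Blaschke products finite dimensional. *)
Lemma H2_poly_rem (n : nat) (b : 'I_n -> C) f : (forall j, `|b j| < 1) -> H2 f ->
  exists p h, [/\ (size p <= n)%N, H2 h &
    forall z, `|z| = 1 -> f z = p.[z] + (\prod_(j < n) (z - b j)) * h z].
Proof.
elim: n b => [|n IH] b hb hf.
  by exists 0, f; split; rewrite ?size_poly0// => z _; rewrite horner0 add0r big_ord0 mul1r.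
have [p [h [sp hh fE]]] := IH (fun j => b (widen_ord (leqnSn n) j)) (fun j => hb _) hf.
have [c [g [hg hE]]] := H2_divided_diff (hb ord_max) hh.
pose m := \prod_(j < n) ('X - (b (widen_ord (leqnSn n) j))%:P).
have sm : size m = n.+1.
  by rewrite /m size_prod_XsubC -[RHS]addn1 ; rewrite /index_enum -enumT size_enum_ord addn1.
exists (p + c *: m), g; split => //.
  rewrite (leq_trans (size_polyD _ _))// geq_max (leqW sp)/=.
  by rewrite (leq_trans (size_scale_leq _ _))// sm.
move=> z hz; rewrite fE// hE// big_ord_recr/= hornerD hornerZ.
have -> : m.[z] = \prod_(j < n) (z - b (widen_ord (leqnSn n) j)).
  by rewrite horner_prod; apply: eq_bigr => j _; rewrite hornerXsubC.
by ring.
Qed.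

Variables (n : nat) (b : 'I_n -> C).
Hypothesis n0 : (0 < n)%N.
Hypothesis b1 : forall j, `|b j| < 1.

(** Kept monic; [blaschke_sign] is the sign that this costs. *)
Definition blaschke_num : {poly C} := \prod_(j < n) ('X - (b j)%:P).
Definition blaschke_den : {poly C} := \prod_(j < n) (1 - (b j)^* *: 'X).
Definition blaschke_sign : C := (-1) ^+ n.
Definition blaschke z : C := \prod_(j < n) ((b j - z) / (1 - (b j)^* * z)).

Local Notation M := blaschke_num.
Local Notation Q := blaschke_den.
Local Notation sg := blaschke_sign.
Local Notation beta := blaschke.
Local Notation K := (model_space beta).

Lemma blaschke_numE z : M.[z] = \prod_(j < n) (z - b j).
Proof. by rewrite horner_prod; apply: eq_bigr => j _; rewrite hornerXsubC. Qed.
Lemma blaschke_denE z : Q.[z] = \prod_(j < n) (1 - (b j)^* * z).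
Proof. by rewrite horner_prod; apply: eq_bigr => j _; rewrite !hornerE. Qed.
Lemma size_blaschke_num : size M = n.+1.
Proof. by rewrite size_prod_XsubC /index_enum -enumT size_enum_ord. Qed.
Lemma blaschke_num_monic : M \is monic. Proof. exact: monic_prod_XsubC. Qed.
Lemma size_blaschke_den : (size Q <= n.+1)%N.
Proof.
rewrite (leq_trans (size_prod_leq _ _))//.
rewrite leq_subLR.
apply: (@leq_trans (\sum_(i < n) 2).+1).
  rewrite ltnS; apply: leq_sum => j _.
  rewrite (leq_trans (size_polyD _ _))// geq_max size_poly1/= size_polyN.
  by rewrite (leq_trans (size_scale_leq _ _))// size_polyX.
by rewrite sum_nat_const card_ord muln2 -addnn addnS.
Qed.
Lemma blaschke_den0 : Q.[0] = 1.
Proof. by rewrite blaschke_denE big1// => j _; rewrite mulr0 subr0. Qed.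
Lemma blaschke_sign_sqr : sg * sg = 1.
Proof. by rewrite /blaschke_sign -exprMn mulrNN mulr1 expr1n. Qed.
Lemma blaschke_sign_neq0 : sg != 0.
Proof. by apply/eqP => h; have := blaschke_sign_sqr; rewrite h mul0r => /eqP; rewrite eq_sym oner_eq0. Qed.

Lemma blaschkeE z : beta z = sg * M.[z] / Q.[z].
Proof.
rewrite /blaschke big_split/= prodfV -blaschke_denE; congr (_ / _).
rewrite blaschke_numE /blaschke_sign -[X in _ ^+ X]card_ord -prodr_const -big_split/=.
by apply: eq_bigr => j _; rewrite mulN1r opprB.
Qed.

Lemma blaschke_den_neq0 z : `|z| = 1 -> Q.[z] != 0.
Proof.
move=> hz; rewrite blaschke_denE; apply/prodf_neq0 => j _.
by apply: gap_neq0 => //; rewrite norm_conjC.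
Qed.
Lemma blaschke_num_neq0 z : `|z| = 1 -> M.[z] != 0.
Proof.
by move=> hz; rewrite blaschke_numE; apply/prodf_neq0 => j _; exact: unit_sub_neq0.
Qed.

Lemma unit_neq0 z : `|z| = 1 -> z != 0.
Proof. by move=> hz; rewrite -normr_gt0 hz. Qed.

(** On the circle, reflection exchanges the numerator and the denominator. *)
Lemma blaschke_den_conj z : `|z| = 1 -> (Q.[z])^* = z ^- n * M.[z].
Proof.
move=> hz; rewrite blaschke_denE blaschke_numE rmorph_prod/= -[X in z ^- X]card_ord -exprVn -prodr_const.
rewrite -big_split/=; apply: eq_bigr => j _.
rewrite conjB conj1 conjM conjK (unimod_conj hz); have := unit_neq0 hz => zz; field.
by rewrite zz.
Qed.

Lemma blaschke_num_conj z : `|z| = 1 -> (M.[z])^* = z ^- n * Q.[z].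
Proof.
move=> hz; have := congr1 Num.conj (blaschke_den_conj hz).
rewrite conjK conjM conjV conjX (unimod_conj hz) exprVn invrK => ->.
by rewrite mulKf// expf_neq0// unit_neq0.
Qed.

Lemma blaschke_conj z : `|z| = 1 -> (beta z)^* = (beta z)^-1.
Proof.
move=> hz; rewrite blaschkeE !conjM conjV blaschke_den_conj// blaschke_num_conj// conjX conjN conj1.
have := unit_neq0 hz; have := blaschke_num_neq0 hz; have := blaschke_den_neq0 hz; have := blaschke_sign_neq0.
rewrite -/sg => s0 q0 m0 z0; have zn : z ^+ n != 0 by rewrite expf_neq0.
rewrite !invfM !invrK.
rewrite -[X in _ = X]mul1r -{1}blaschke_sign_sqr; field.
by rewrite ?s0 ?m0 ?zn ?q0.
Qed.

Lemma blaschke_norm z : `|z| = 1 -> `|beta z| = 1.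
Proof.
move=> hz; apply/eqP; rewrite -(@pexpr_eq1 _ _ 2)// normCK blaschke_conj//.
rewrite divff// blaschkeE mulf_neq0 ?invr_eq0 ?blaschke_den_neq0// mulf_neq0 ?blaschke_sign_neq0 ?blaschke_num_neq0//.
Qed.

Lemma blaschke_neq0 z : `|z| = 1 -> beta z != 0.
Proof. by move=> hz; apply: unit_neq0; exact: blaschke_norm. Qed.

Definition ratfun p z := p.[z] / Q.[z].

Lemma H2_div_blaschke_den f : H2 f -> H2 (fun z => f z / Q.[z]).
Proof.
have hc j : `|(b j)^*| < 1 by rewrite norm_conjC.
by move=> hf; apply: (H2_ext (H2_divprod hc hf)) => z _; rewrite blaschke_denE.
Qed.

Lemma H2_ratfun p : H2 (ratfun p).
Proof.
by apply: (H2_ext (H2_div_blaschke_den (H2_horner p (H2_cst 1)))) => z _; rewrite mulr1.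
Qed.

Lemma cmeasurable_blaschke : cmeasurable beta.
Proof.
apply: (@cmeasurable_ext _ (fun z => sg * M.[z] / Q.[z])); first by move=> t; rewrite blaschkeE.
apply: cmeasurableM; last by apply: cmeasurableV; exact: cmeasurable_horner.
by apply: cmeasurableM; [exact: cmeasurable_cst|exact: cmeasurable_horner].
Qed.

Lemma cbounded_blaschke : cbounded beta.
Proof.
split; first exact: cmeasurable_blaschke.
exists 1 => t; have := blaschke_norm (expi_norm1 t); rewrite norm_normc => -[->] //.
Qed.

(** The conjugate reciprocal polynomial for degree < n: on the circle,
    z^(n-1) conj(p). *)
Definition crev p : {poly C} := \poly_(i < n) (p`_(n.-1 - i))^*.

Lemma crevE p z : (size p <= n)%N -> `|z| = 1 ->
  (p.[z])^* = z ^- n.-1 * (crev p).[z].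
Proof.
move=> sp hz; have z0 := unit_neq0 hz.
rewrite (horner_coef_wide _ sp) horner_poly rmorph_sum/= mulr_sumr.
rewrite (reindex_inj rev_ord_inj)/=; apply: eq_bigr => i _.
have hi : (i <= n.-1)%N by rewrite -ltnS prednK.
have e : (n - i.+1 = n.-1 - i)%N by rewrite subnS predn_sub.
rewrite e conjM conjX (unimod_conj hz) mulrCA; congr (_ * _).
by rewrite exprVn -{2}(subnK hi) exprD invfM mulfVK// expf_neq0.
Qed.

Lemma crevK p : (size p <= n)%N -> crev (crev p) = p.
Proof.
move=> sp; apply/polyP => i; rewrite coef_poly.
case: ltnP => hi; last by rewrite nth_default// (leq_trans sp).
have hi' : (i <= n.-1)%N by rewrite -ltnS prednK.
by rewrite coef_poly (leq_ltn_trans (leq_subr _ _)) ?prednK// subKn// conjK.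
Qed.

Lemma ratfun_conj p z : (size p <= n)%N -> `|z| = 1 ->
  (ratfun p z)^* = z * (crev p).[z] / M.[z].
Proof.
move=> sp hz; have z0 := unit_neq0 hz; have m0 := blaschke_num_neq0 hz.
rewrite /ratfun conjM conjV crevE// blaschke_den_conj// invfM invrK -{2}(prednK n0) exprS.
by field; rewrite m0 expf_neq0.
Qed.

Lemma cbounded_ratfun p : cbounded (ratfun p).
Proof.
have hq : cbounded (fun z => \prod_(j < n) (1 - (b j)^* * z)^-1).
  elim: n b b1 => [|k IH] c hc.
    by apply: (cbounded_ext _ (cbounded_cst 1)) => t; rewrite big_ord0.
  have h1 : `|(c ord_max)^*| < 1 by rewrite norm_conjC.
  have h2 := IH (fun j => c (widen_ord (leqnSn k) j)) (fun j => hc _).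
  by apply: (cbounded_ext _ (cboundedM h2 (cbounded_gapV h1))) => t; rewrite big_ord_recr.
by apply: (cbounded_ext _ (cboundedM (cbounded_horner p) hq)) => t; rewrite /ratfun blaschke_denE prodfV.
Qed.

(** On the circle conj(p / Q) beta is z times a fraction of the same type, so
    the inner product with beta h is a positive moment of a Hardy function. *)
Lemma model_ratfun p : (size p <= n)%N -> K (ratfun p).
Proof.
move=> sp; split; first exact: H2_ratfun.
move=> h hh.
have Lv := H2_L2 (H2_ratfun p); have Lh := L2_cboundedM cbounded_blaschke (H2_L2 hh).
rewrite (inner_conj Lh Lv); apply/eqP; rewrite conjC_eq0; apply/eqP.
have hk : H2 (fun z => sg * ((crev p).[z] * h z / Q.[z])).
  exact/H2Z/H2_div_blaschke_den/H2_horner.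
rewrite -(H2_integral_mulz hk); apply: eq_circle_integral => t; have hz := expi_norm1 t.
rewrite ratfun_conj// blaschkeE.
have m0 := blaschke_num_neq0 hz; have q0 := blaschke_den_neq0 hz; field.
by rewrite m0 q0.
Qed.

Lemma model_L2 f : K f -> L2 f. Proof. by case=> /H2_L2. Qed.

Lemma model_lin c f g : K f -> K g -> K (fun z => c * f z + g z).
Proof.
move=> [hf of_] [hg og]; split; first exact/H2D/hg/H2Z.
move=> h hh; have Lh := L2_cboundedM cbounded_blaschke (H2_L2 hh).
rewrite innerDl//; [|exact/L2Z/H2_L2|exact/H2_L2].
by rewrite innerZl// ?og// ?of_// ?mulr0 ?addr0//; exact/H2_L2.
Qed.

Lemma model_ae f g : K f -> L2 g -> eq_circle f g -> K g.
Proof.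
move=> [hf of_] Lg fg; split; first exact: H2_ae fg.
move=> h hh; rewrite -(of_ h hh); have Lh := L2_cboundedM cbounded_blaschke (H2_L2 hh).
apply: inner_ae; try exact: L2_cmeasurable.
- exact/L2_cmeasurable/H2_L2.
- by move: fg; apply: ae_circle_imp.
- exact: ae_circleW.
Qed.

(** Divide Q f by the numerator of beta: f = p / Q + beta h. Then beta h lies in
    the model space and is orthogonal to itself. *)
Lemma model_span f : K f -> exists2 p : {poly C}, (size p <= n)%N & eq_circle f (ratfun p).
Proof.
move=> Kf; have [hf _] := Kf.
have [p [h [sp hh fE]]] := H2_poly_rem b1 (H2_horner Q hf).
exists p => //.
have Kw := model_lin (-1) (model_ratfun sp) Kf.
have [hw ow] := Kw.
have wE z : `|z| = 1 -> (-1) * ratfun p z + f z = beta z * (sg * h z).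
  move=> hz; have q0 := blaschke_den_neq0 hz; apply: (mulfI q0).
  rewrite mulrDr fE// blaschkeE /ratfun -blaschke_numE.
  have -> : Q.[z] * (sg * M.[z] / Q.[z] * (sg * h z)) = (sg * sg) * M.[z] * h z.
    by field; rewrite q0.
  by rewrite blaschke_sign_sqr; field; rewrite q0.
have ww : inner (fun z => (-1) * ratfun p z + f z) (fun z => (-1) * ratfun p z + f z) = 0.
  rewrite -(ow _ (H2Z sg hh)); apply: eq_circle_integral => t.
  by congr (_ * Num.conj _); exact/wE/expi_norm1.
have := inner_eq0 (H2_L2 hw) ww.
by apply: ae_circle_imp => z _ /eqP; rewrite mulN1r addrC subr_eq0 => /eqP.
Qed.

(** Subtracting the value at 0, which is p(0) since Q(0) = 1, leaves z times a
    function of the Hardy space. *)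
Lemma ratfun_mean p : I (ratfun p) = p.[0].
Proof.
have : root (p - p.[0] *: Q) 0 by rewrite /root !hornerE blaschke_den0 mulr1 subrr.
move=> /factor_theorem[r hr].
have hz : H2 (fun z => r.[z] * 1 / Q.[z]) by exact/H2_div_blaschke_den/H2_horner/H2_cst.
have cz : cintegrable (fun z => z * (r.[z] * 1 / Q.[z])).
  exact: L2_cintegrable (L2_cboundedM cbounded_id (H2_L2 hz)).
transitivity (I (fun z => p.[0] + z * (r.[z] * 1 / Q.[z]))).
  apply: eq_circle_integral => t; have q0 := blaschke_den_neq0 (expi_norm1 t).
  have := congr1 (fun q => q.[expi t]) hr.
  rewrite hornerD hornerN hornerZ hornerM hornerD hornerN hornerX hornerC subr0 => e.
  rewrite /ratfun -[p.[expi t]](subrK (p.[0] * Q.[expi t])) e.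
  by field; rewrite q0.
rewrite circle_integralD//; last exact: cintegrable_cst.
rewrite H2_integral_mulz// addr0.
transitivity (p.[0] * I (fun _ => 1)); last by rewrite circle_integral1 mulr1.
rewrite -circle_integralZ; last exact: cintegrable_cst.
by apply: eq_circle_integral => t; rewrite mulr1.
Qed.

Section Kernel.
Variable zt : C.
Hypothesis zt1 : `|zt| = 1.
Let d := beta zt.

Let d0 : d != 0. Proof. exact: blaschke_neq0. Qed.
Let dd : d * d^* = 1. Proof. by rewrite blaschke_conj// divff. Qed.

(** The quotient of A - d Q by X - zt for beta = A / Q and d = beta zt: it carries
    the boundary kernel at zt, its conjugate and the derivative of beta. *)
Definition kernel_poly : {poly C} := (sg *: M - d *: Q) %/ ('X - zt%:P).
Local Notation P := kernel_poly.
Lemma kernel_polyE : sg *: M - d *: Q = P * ('X - zt%:P).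
Proof.
rewrite divpK// dvdp_XsubCl /root hornerD hornerN !hornerZ /d blaschkeE divfK ?subrr//.
exact: blaschke_den_neq0.
Qed.

Lemma kernel_polyE_eval z : sg * M.[z] - d * Q.[z] = P.[z] * (z - zt).
Proof.
have := congr1 (fun q => q.[z]) kernel_polyE.
by rewrite hornerD hornerN !hornerZ hornerM hornerD hornerN hornerX hornerC.
Qed.

Lemma size_kernel_poly : (size P <= n)%N.
Proof.
have [->|P0] := eqVneq P 0; first by rewrite size_poly0.
have : (size (P * ('X - zt%:P))%R <= n.+1)%N.
  rewrite -kernel_polyE (leq_trans (size_polyD _ _))// geq_max size_polyN.
  by rewrite !(leq_trans (size_scale_leq _ _))// ?size_blaschke_num// size_blaschke_den.
by rewrite size_Mmonic ?monicXsubC// size_XsubC addn2/= ltnS.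
Qed.

Definition kernel_ratfun := ratfun (d^* * zt *: P).

Lemma size_kernel_ratfun : (size (d^* * zt *: P) <= n)%N.
Proof. exact: leq_trans (size_scale_leq _ _) size_kernel_poly. Qed.

Lemma kernel_ratfunE z : `|z| = 1 -> z != zt -> boundary_kernel beta zt z = kernel_ratfun z.
Proof.
move=> hz zz; have q0 := blaschke_den_neq0 hz; have t0 := unit_neq0 zt1.
have zz' : zt - z != 0 by rewrite subr_eq0 eq_sym.
have e := kernel_polyE_eval z.
have -> : boundary_kernel beta zt z = (1 - d^* * beta z) / (1 - zt^* * z) by [].
have -> : 1 - zt^* * z = (zt - z) / zt.
  by rewrite (unimod_conj zt1); field; rewrite t0.
rewrite /kernel_ratfun /ratfun hornerZ -dd blaschkeE.
have -> : d * d^* - d^* * (sg * M.[z] / Q.[z]) = - d^* * (sg * M.[z] - d * Q.[z]) / Q.[z].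
  by field; rewrite q0.
rewrite e; field.
by rewrite q0 zz' t0.
Qed.

Lemma kernel_ratfun_ae : eq_circle kernel_ratfun (boundary_kernel beta zt).
Proof.
move: (ae_circle_neq zt); apply: ae_circle_imp => z hz /eqP h.
by rewrite kernel_ratfunE.
Qed.

(** Away from zt the kernel is a bounded fraction; at zt its denominator is 0, so
    its value is 0. *)
Lemma boundary_kernel_bounded : cbounded (boundary_kernel beta zt).
Proof.
have mb : cmeasurable (boundary_kernel beta zt).
  apply: cmeasurableM.
    apply: cmeasurableB; first exact: cmeasurable_cst.
    by apply: cmeasurableM; [exact: cmeasurable_cst|exact: cmeasurable_blaschke].
  apply/cmeasurableV/cmeasurableB; first exact: cmeasurable_cst.
  by apply: cmeasurableM; [exact: cmeasurable_cst|exact: cmeasurable_id].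
split; first exact: mb.
have [_ [N hN]] := cbounded_ratfun (d^* * zt *: P).
exists N => t; have [h|h] := eqVneq (expi t) zt; last first.
  by rewrite kernel_ratfunE ?expi_norm1//; exact: hN.
rewrite h /boundary_kernel mulrC unimod_conj// mulVf ?unit_neq0// subrr invr0 mul0r.
by rewrite normc0; apply: le_trans (normc_ge0 _) (hN t).
Qed.

Lemma model_kernel : K (boundary_kernel beta zt).
Proof.
exact: (model_ae (model_ratfun size_kernel_ratfun) (cbounded_L2 boundary_kernel_bounded) kernel_ratfun_ae).
Qed.

Lemma kernel_ratfun_conj z : `|z| = 1 -> z != zt ->
  (boundary_kernel beta zt z)^* = z * sg * P.[z] / M.[z].
Proof.
move=> hz zz; have q0 := blaschke_den_neq0 hz; have m0 := blaschke_num_neq0 hz.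
have z0 := unit_neq0 hz; have s0 := blaschke_sign_neq0.
have zz' : z - zt != 0 by rewrite subr_eq0.
rewrite /boundary_kernel conjM conjV !conjB !conjM !conj1 !conjK -/d.
rewrite (blaschke_conj hz) (unimod_conj hz) blaschkeE.
have -> : 1 - d * (sg * M.[z] / Q.[z])^-1 = sg * (sg * M.[z] - d * Q.[z]) / M.[z].
  have -> : 1 - d * (sg * M.[z] / Q.[z])^-1 = (sg * M.[z] - d * Q.[z]) / (sg * M.[z]).
    by field; rewrite ?q0 ?m0 ?s0.
  rewrite -[X in X / _]mul1r -{1}blaschke_sign_sqr; field; by rewrite ?m0 ?s0.
by rewrite kernel_polyE_eval; field; rewrite ?m0 ?z0 ?zz'.
Qed.

(** Write p = f1 A + (X - zt) r with A the numerator of beta. Against the conjugate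
    kernel z P / A, the first term gives a vanishing moment, and the second gives
    another one plus a multiple of conj of (reversed r) / Q, whose mean is the
    top coefficient of r; that coefficient is determined by f1. *)
Lemma ratfun_reproducing p : (size p <= n)%N ->
  inner (ratfun p) (boundary_kernel beta zt) = ratfun p zt.
Proof.
move=> sp; have q0 := blaschke_den_neq0 zt1; have m0 := blaschke_num_neq0 zt1; have s0 := blaschke_sign_neq0.
pose f1 := p.[zt] / (sg * M.[zt]).
have : root (p - f1 *: (sg *: M)) zt.
  by rewrite /root hornerD hornerN !hornerZ divfK ?subrr// mulf_neq0.
move=> /factor_theorem[r hr].
have er z : p.[z] = f1 * (sg * M.[z]) + r.[z] * (z - zt).
  have := congr1 (fun q => q.[z]) hr.
  rewrite hornerD hornerN !hornerZ hornerM hornerD hornerN hornerX hornerC => <-.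
  by rewrite addrC subrK.
have sr : (size r <= n)%N.
  have [->|r0] := eqVneq r 0; first by rewrite size_poly0.
  have : (size (r * ('X - zt%:P))%R <= n.+1)%N.
    rewrite -hr (leq_trans (size_polyD _ _))// geq_max size_polyN (leqW sp)/=.
    by rewrite !(leq_trans (size_scale_leq _ _))// size_blaschke_num.
  by rewrite size_Mmonic ?monicXsubC// size_XsubC addn2/= ltnS.
(* The coefficient of degree n: p has none, and the numerator is monic. *)
have rn : r`_n.-1 = - (f1 * sg).
  have := congr1 (fun q : {poly C} => q`_n) hr.
  rewrite coefB !coefZ mulrBr coefB coefMX coefMC eqn0Ngt n0/=.
  rewrite (nth_default 0 sr) mul0r subr0 (nth_default 0 sp) sub0r => <-.
  have /monicP := blaschke_num_monic; rewrite /lead_coef size_blaschke_num/= => ->.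
  by rewrite mulr1.
pose g z := f1 * ratfun P z + ratfun r z.
have hg : H2 g by apply: H2D; [apply/H2Z; exact: H2_ratfun|exact: H2_ratfun].
pose v := ratfun (crev r).
have cg : cintegrable (fun z => z * g z) := L2_cintegrable (L2_cboundedM cbounded_id (H2_L2 hg)).
have cv : cintegrable (fun z => (v z)^*) by apply: cintegrableJ; exact: cbounded_cintegrable (cbounded_ratfun _).
have cv' : cintegrable (fun z => - (d * sg) * (v z)^*) by exact: cintegrableZ.
have sk : (size (crev r) <= n)%N by exact: size_poly.
have mk := boundary_kernel_bounded.
transitivity (I (fun z => z * g z + - (d * sg) * (v z)^*)).
  apply: circle_integral_ae.
  - by apply: cmeasurableM; [exact: (cbounded_ratfun p).1|apply: cmeasurableJ; exact: mk.1].
  - by apply: cmeasurableD; exact: cintegrable_cmeasurable.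
  move: (ae_circle_neq zt); apply: ae_circle_imp => z hz /eqP zz.
  have q0' := blaschke_den_neq0 hz; have m0' := blaschke_num_neq0 hz.
  rewrite /v (ratfun_conj sk hz) (crevK sr) (kernel_ratfun_conj hz zz) /g /ratfun er.
  have -> : (f1 * (sg * M.[z]) + r.[z] * (z - zt)) / Q.[z] * (z * sg * P.[z] / M.[z]) =
     (sg * sg) * f1 * z * P.[z] / Q.[z] + r.[z] * z * sg * (P.[z] * (z - zt)) / Q.[z] / M.[z].
    by field; rewrite ?q0' ?m0'.
  rewrite -kernel_polyE_eval blaschke_sign_sqr.
  have -> : r.[z] * z * sg * (sg * M.[z] - d * Q.[z]) / Q.[z] / M.[z] =
      (sg * sg) * r.[z] * z / Q.[z] - d * sg * (r.[z] * z / M.[z]).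
    by field; rewrite ?q0' ?m0'.
  by rewrite blaschke_sign_sqr; field; rewrite ?q0' ?m0'.
rewrite (circle_integralD cg cv') (H2_integral_mulz hg) add0r circle_integralZ// circle_integral_conj; last exact: cbounded_cintegrable (cbounded_ratfun _).
rewrite /v ratfun_mean horner_coef0 coef_poly n0 subn0 conjK rn /ratfun /f1 /d blaschkeE.
rewrite -[RHS]mul1r -{1}blaschke_sign_sqr; field.
by rewrite ?q0 ?m0 ?s0.
Qed.

End Kernel.
End ModelSpace.

(** * Clark bases and orthogonal projections *)

Section ClarkBasis.
Variable R : realType.
Local Notation C := R[i].
Local Notation Re := complex.Re.
Implicit Types (f g h F : C -> C) (z w : C) (p q : {poly C}).

(** Convergence along any filter, for the derivative of a complex function. *)
Definition clim (T : Type) (G : set_system T) (u : T -> C) (l : C) :=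
  forall e : R, 0 < e -> G (fun x => normc (u x - l) < e).

Section PolyLimit.
Context (T : Type) (G : set_system T) {FG : Filter G}.
Implicit Types (u v : T -> C).

Lemma climP u (l : C) : (u @ G --> (l : C^o)) <-> clim G u l.
Proof.
split.
- move=> h e e0.
  have /(_ e%:C) := proj1 (@cvgrPdist_lt C C^o T G FG u l) h.
  rewrite ltcR => /(_ e0).
  by apply: filterS => x; rewrite distrC norm_normc ltcR.
- move=> h; apply: (proj2 (@cvgrPdist_lt C C^o T G FG u l)) => e e0.
  have eR : e = (Re e)%:C by rewrite RRe_real// gtr0_real.
  have /h : 0 < Re e by rewrite -ltcR -eR.
  by apply: filterS => x; rewrite eR distrC norm_normc ltcR.
Qed.

Lemma climD u v (a b : C) : clim G u a -> clim G v b -> clim G (fun x => u x + v x) (a + b).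
Proof.
by move=> /climP h1 /climP h2; apply/climP; exact: (cvgcD h1 h2).
Qed.
Lemma climM u v (a b : C) : clim G u a -> clim G v b -> clim G (fun x => u x * v x) (a * b).
Proof. by move=> /climP h1 /climP h2; apply/climP; exact: (cvgcM h1 h2). Qed.
Lemma climV u (a : C) : a != 0 -> clim G u a -> clim G (fun x => (u x)^-1) a^-1.
Proof. by move=> a0 /climP h; apply/climP; exact: (cvgcV a0 h). Qed.
Lemma climc (a : C) : clim G (fun=> a) a.
Proof. by move=> e e0; rewrite subrr normc0; apply: filterS filterT. Qed.

Lemma clim_horner u (a : C) p : clim G u a -> clim G (fun x => p.[u x]) p.[a].
Proof.
move=> hu; elim/poly_ind: p => [|p c IH].
  rewrite (_ : (fun x => _) = (fun _ => 0)); last by apply/funext => x; rewrite horner0.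
  by rewrite horner0; exact: climc.
rewrite (_ : (fun x => _) = (fun x => p.[u x] * u x + c)); last first.
  by apply/funext => x; rewrite hornerMXaddC.
rewrite hornerMXaddC.
exact: (climD (climM IH hu) (climc c)).
Qed.

Lemma clim_neq0 u (a : C) : a != 0 -> clim G u a -> G (fun x => u x != 0).
Proof.
move=> a0 /(_ (normc a)) h.
have : 0 < normc a by have := a0; rewrite -normr_gt0 norm_normc ltcR.
move=> /h; apply: filterS => x hx; apply/eqP => e; move: hx.
by rewrite e sub0r normcN ltxx.
Qed.

Lemma clim_near u v (a : C) : G (fun x => u x = v x) -> clim G u a -> clim G v a.
Proof. by move=> uv hu e /hu; apply: filterS2 uv => x ->. Qed.
Lemma clim_quotient u f (p q : {poly C}) (a : C) : q.[a] != 0 ->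
  (forall z, q.[z] != 0 -> f z - f a = (z - a) * (p.[z] / q.[z])) ->
  clim G u 0 -> G (fun x => u x != 0) ->
  clim G (fun x => (u x)^-1 * (f (u x + a) - f a)) (p.[a] / q.[a]).
Proof.
move=> qa hf hu h0.
have ha : clim G (fun x => u x + a) a.
  by have := climD hu (climc a); rewrite add0r.
have hl := climM (clim_horner p ha) (climV qa (clim_horner q ha)).
have qn := clim_neq0 qa (clim_horner q ha).
refine (clim_near _ hl).
move: h0 qn; apply: filterS2 => x h0 qh.
by rewrite hf// addrK mulrA mulVf// mul1r.
Qed.
End PolyLimit.

(** If f - f a is divisible by z - a with a fraction as quotient, the derivative
    is the value of that fraction. The restriction to q z <> 0 is needed because
    division by 0 breaks the factorization elsewhere. *)
Lemma derive1_quotient f (p q : {poly C}) (a : C) : q.[a] != 0 ->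
  (forall z, q.[z] != 0 -> f z - f a = (z - a) * (p.[z] / q.[z])) ->
  derive1 (f : C -> C^o) a = p.[a] / q.[a].
Proof.
move=> qa hf.
have h0 : clim ((0 : C^o)^') (fun x : C^o => (x : C)) 0.
  move=> e e0; apply/nbhs_ballP; exists e%:C; first by rewrite /= ltcR.
  by move=> x /=; rewrite /ball/= sub0r normrN norm_normc ltcR subr0 => he _.
have n0 : ((0 : C^o)^') (fun x : C^o => (x : C) != 0).
  by apply: (@nearW _ (nbhs (0 : C^o))).
have h4 := proj2 (climP _ _) (clim_quotient qa hf h0 n0).
apply: (@cvg_lim C^o); first exact: norm_hausdorff.
exact: h4.
Qed.

Variables (n : nat) (b : 'I_n -> C).
Hypothesis n0 : (0 < n)%N.
Hypothesis b1 : forall j, `|b j| < 1.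
Local Notation beta := (blaschke b).
Local Notation Q := (blaschke_den b).
Local Notation M := (blaschke_num b).
Local Notation sg := (blaschke_sign R n).
Local Notation K := (model_space beta).

Variables (zeta : 'I_n -> C) (d : C).
Hypothesis zeta_inj : injective zeta.
Hypothesis zeta1 : forall j, `|zeta j| = 1.
Hypothesis zetad : forall j, beta (zeta j) = d.

Local Notation k j := (boundary_kernel beta (zeta j)).
Local Notation P j := (kernel_poly b (zeta j)).

Lemma clark_d1 : `|d| = 1.
Proof. by rewrite -(zetad (Ordinal n0)) blaschke_norm. Qed.

Lemma clark_poly_eval j z : sg * M.[z] - d * Q.[z] = (P j).[z] * (z - zeta j).
Proof. by rewrite -(zetad j) kernel_polyE_eval. Qed.

Lemma clark_poly j : sg *: M - d *: Q = P j * ('X - (zeta j)%:P).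
Proof. by rewrite -(zetad j) kernel_polyE. Qed.

(** All kernel polynomials divide the same polynomial A - d Q, whose value at
    another Clark point vanishes. *)
Lemma kernel_poly_root i j : i != j -> (P j).[zeta i] = 0.
Proof.
move=> ij; have := clark_poly_eval j (zeta i).
rewrite (clark_poly_eval i) subrr mulr0 => /esym/eqP.
by rewrite mulf_eq0 subr_eq0 (inj_eq zeta_inj) (negbTE ij) orbF => /eqP.
Qed.

Lemma blaschke0_lt1 : `|beta 0| < 1.
Proof.
rewrite /blaschke normr_prod.
have -> : \prod_(i < n) `|(b i - 0) / (1 - (b i)^* * 0)| = \prod_(i < n) `|b i|.
  by apply: eq_bigr => i _; rewrite mulr0 !subr0 divr1.
move: b1 n0; elim: n b => // m IH c c1 _; rewrite big_ord_recl.
case: m IH c c1 => [|m] IH c c1; first by rewrite big_ord0 mulr1.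
apply: mulr_ilt1 => //; first by rewrite prodr_ge0.
exact: IH.
Qed.

(** Otherwise A - d Q would have a double root, so a polynomial of degree < n with
    n roots would vanish, and beta 0 = d would have modulus 1. *)
Lemma kernel_poly_neq0 j : (P j).[zeta j] != 0.
Proof.
apply/eqP => h.
have h0 : P j = 0.
  apply: (@roots_geq_poly_eq0 _ _ [seq zeta i | i : 'I_n]).
  - apply/allP => _ /mapP[i _ ->]; rewrite /root.
    by have [->|ij] := eqVneq i j; [rewrite h|rewrite kernel_poly_root].
  - by rewrite map_inj_uniq ?enum_uniq.
  - by rewrite size_map size_enum_ord; exact: size_kernel_poly.
have := clark_poly_eval j 0; rewrite h0 horner0 mul0r blaschke_den0 mulr1 => /eqP.
rewrite subr_eq0 => /eqP e; have := blaschke0_lt1.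
by rewrite blaschkeE blaschke_den0 divr1 e clark_d1 ltxx.
Qed.

Lemma derive_clark j : derive1 (beta : C -> C^o) (zeta j) = (P j).[zeta j] / Q.[zeta j].
Proof.
apply: derive1_quotient; first exact: blaschke_den_neq0.
move=> z q0; have q1 := blaschke_den_neq0 b1 (zeta1 j).
rewrite zetad mulrA (mulrC (z - _)) -clark_poly_eval blaschkeE; field.
exact: q0.
Qed.

Lemma abs_deriv_neq0 j : abs_deriv beta (zeta j) != 0.
Proof.
by rewrite /abs_deriv derive_clark normr_eq0 mulf_neq0 ?invr_eq0 ?kernel_poly_neq0// blaschke_den_neq0.
Qed.

(** By reproduction the inner product is a value of a kernel polynomial, which for
    equal points is the derivative of beta up to a unimodular factor; it is
    non-negative, so the factor can be dropped with a modulus. *)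
Lemma kernel_inner i j : inner (k i) (k j) = (i == j)%:R * abs_deriv beta (zeta j).
Proof.
have Li := boundary_kernel_bounded b1 (zeta1 i); have Lj := boundary_kernel_bounded b1 (zeta1 j).
have ke := kernel_ratfun_ae b1 (zeta1 i).
have -> : inner (k i) (k j) = inner (kernel_ratfun b (zeta i)) (k j).
  apply: inner_ae; [exact: Li.1|exact: (cbounded_ratfun b1 _).1|exact: Lj.1|exact: Lj.1| |].
    by move: ke; apply: ae_circle_imp.
  exact: ae_circleW.
have e : inner (kernel_ratfun b (zeta i)) (k j) = d^* * zeta i * (P i).[zeta j] / Q.[zeta j].
  rewrite ratfun_reproducing//; last exact: size_kernel_ratfun.
  by rewrite zetad /ratfun hornerZ.
rewrite e; have [ij|ij] := eqVneq i j; last by rewrite kernel_poly_root 1?eq_sym// mulr0 mul0r mul0r.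
subst j; rewrite mul1r.
have : 0 <= inner (k i) (k i) by exact: inner_ge0.
have -> : inner (k i) (k i) = inner (kernel_ratfun b (zeta i)) (k i).
  apply: inner_ae; [exact: Li.1|exact: (cbounded_ratfun b1 _).1|exact: Lj.1|exact: Lj.1| |].
    by move: ke; apply: ae_circle_imp.
  exact: ae_circleW.
rewrite e => /ger0_norm <-.
rewrite /abs_deriv derive_clark -mulrA normrM normrM norm_conjC clark_d1 zeta1.
by rewrite mulr1 mul1r.
Qed.

Lemma L2norm_kernel j : L2norm (k j) = sqrtC (abs_deriv beta (zeta j)).
Proof. by rewrite /L2norm kernel_inner eqxx mul1r. Qed.

Lemma clark_norm_neq0 j : sqrtC (abs_deriv beta (zeta j)) != 0.
Proof. by rewrite sqrtC_eq0 abs_deriv_neq0. Qed.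

Lemma sqrt_conj j : (sqrtC (abs_deriv beta (zeta j)))^* = sqrtC (abs_deriv beta (zeta j)).
Proof. by apply: conj_Creal; rewrite ger0_real// sqrtC_ge0 normr_ge0. Qed.

Variables (arg : C -> R) (lambda : C).
Local Notation w j := (clark_weight arg lambda (zeta j)).
Local Notation e j := (modified_clark_vector arg beta lambda (zeta j)).
Local Notation ra j := (sqrtC (abs_deriv beta (zeta j))).

Lemma weight_neq0 j : w j != 0. Proof. exact: expi_neq0. Qed.
Lemma weight_conj j : (w j)^* = (w j)^-1. Proof. exact: expi_conj. Qed.

Lemma clark_vecE j z : e j z = (w j / ra j) * k j z.
Proof. by rewrite /modified_clark_vector /clark_vector L2norm_kernel mulrA. Qed.

Lemma clark_bounded j : cbounded (e j).
Proof.
apply: (cbounded_ext _ (cboundedM (cbounded_cst (w j / ra j)) (boundary_kernel_bounded b1 (zeta1 j)))) => t.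
by rewrite clark_vecE.
Qed.

Lemma clark_L2 j : L2 (e j). Proof. exact/cbounded_L2/clark_bounded. Qed.

Lemma clark_model j : K (e j).
Proof.
have K1 := model_kernel n0 b1 (zeta1 j).
have K0 : K (ratfun b 0) by apply: model_ratfun => //; rewrite size_poly0.
have := model_lin b1 (w j / ra j) K1 K0.
move/(model_ae b1) => /(_ _ (clark_L2 j)); apply; apply: ae_circleW => z _.
by rewrite /ratfun horner0 mul0r addr0 clark_vecE.
Qed.

Lemma clark_orthonormal i j : inner (e i) (e j) = (i == j)%:R.
Proof.
have Li := boundary_kernel_bounded b1 (zeta1 i); have Lj := boundary_kernel_bounded b1 (zeta1 j).
have hm j' : e j' = (fun z => (w j' / ra j') * k j' z) by apply/funext => z; exact: clark_vecE.
rewrite hm innerZl; [|exact: cbounded_L2|exact: clark_L2].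
rewrite inner_conj; [|exact: clark_L2|exact: cbounded_L2].
rewrite hm innerZl; [|exact: cbounded_L2|exact: cbounded_L2].
rewrite kernel_inner (eq_sym j i).
case: (eqVneq i j) => [<-|ij]; last first.
  move: (abs_deriv _ _) (w i / ra i) (w j / ra j) => x y y'.
  by rewrite mul0r mulr0 conjC0 mulr0.
rewrite mul1r !conjM conjV sqrt_conj weight_conj.
have -> : (abs_deriv beta (zeta i))^* = ra i * ra i.
  by rewrite -{1}[abs_deriv _ _]sqrtCK expr2 conjM sqrt_conj.
rewrite -[RHS]/(1 : C); have := clark_norm_neq0 i; have := weight_neq0 i.
move: (ra i) (w i) => x y y0 x0; field.
by rewrite x0 y0.
Qed.

(** Lagrange interpolation of the numerator at the Clark points spans the model
    space, and orthonormality identifies the coefficients. *)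
Lemma clark_expansion f : K f ->
  eq_circle f (fun z => \sum_j inner f (e j) * e j z).
Proof.
move=> Kf; have [p sp fp] := model_span n0 b1 Kf.
pose c j : C := p.[zeta j] / (P j).[zeta j] / (d^* * zeta j) / (w j / ra j).
have pE : p = \sum_j (p.[zeta j] / (P j).[zeta j]) *: P j.
  apply/eqP; rewrite -subr_eq0; apply/eqP.
  apply: (@roots_geq_poly_eq0 _ _ [seq zeta i | i : 'I_n]).
  - apply/allP => _ /mapP[i _ ->]; rewrite /root hornerD hornerN horner_sum.
    rewrite (bigD1 i)//= big1 ?addr0; last first.
      by move=> j ji; rewrite hornerZ (@kernel_poly_root i j) ?mulr0// eq_sym.
    by rewrite hornerZ divfK ?kernel_poly_neq0// subrr.
  - by rewrite map_inj_uniq ?enum_uniq.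
  - rewrite size_map size_enum_ord (leq_trans (size_polyD _ _))// geq_max sp size_polyN.
    apply: (leq_trans (size_sum _ _ _)); apply/bigmax_leqP => j _.
    by rewrite (leq_trans (size_scale_leq _ _))// size_kernel_poly.
have fe : eq_circle f (fun z => \sum_j c j * e j z).
  have ke : ae_circle (fun z => forall j, kernel_ratfun b (zeta j) z = k j z).
    have : ae_circle (fun z => forall j, z <> zeta j).
      have -> : (fun z => forall j, z <> zeta j) = (fun z => forall x, x \in enum 'I_n -> z <> zeta x).
        by apply/funext => z; apply/propext; split => h x; [move=> _; exact: h|apply: h; rewrite mem_enum].
      elim: (enum 'I_n) => [|j r IH]; first exact: ae_circleW.
      move: (ae_circle_neq (zeta j)) IH; apply: ae_circle_imp2 => z _ h1 h2 x.
      by rewrite in_cons => /orP[/eqP->//|]; exact: h2.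
    by apply: ae_circle_imp => z hz h j; rewrite kernel_ratfunE//; apply/eqP.
  move: fp ke; apply: ae_circle_imp2 => z hz -> ke.
  rewrite /ratfun {1}pE horner_sum mulr_suml; apply: eq_bigr => j _.
  rewrite clark_vecE -ke /kernel_ratfun /ratfun !hornerZ zetad /c.
  have h1 := clark_norm_neq0 j; have h2 := weight_neq0 j; have h3 := kernel_poly_neq0 j.
  have h4 := blaschke_den_neq0 b1 hz; have h5 := unit_neq0 (zeta1 j).
  have h6 : d^* != 0 by rewrite conjC_eq0; exact/unit_neq0/clark_d1.
  by field; rewrite ?h1 ?h2 ?h3 ?h4 ?h5 ?h6.
have [hc _] := inner_orthonormal_sum c clark_L2 clark_orthonormal.
have hc' j : inner f (e j) = c j.
  have LS : L2 (fun z => \sum_i c i * e i z).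
    by apply: L2_sum => i; exact/L2Z/clark_L2.
  have me := L2_cmeasurable (clark_L2 j).
  rewrite -hc.
  apply: (inner_ae (L2_cmeasurable (model_L2 Kf)) (L2_cmeasurable LS) me me fe).
  exact: ae_circleW.
by move: fe; apply: ae_circle_imp => z _ ->; apply: eq_bigr => j _; rewrite hc'.
Qed.

Lemma model_sum (c : 'I_n -> C) : K (fun z => \sum_j c j * e j z).
Proof.
have K0 : K (ratfun b 0) by apply: model_ratfun => //; rewrite size_poly0.
have h (r : seq 'I_n) : K (fun z => \sum_(j <- r) c j * e j z + ratfun b 0 z).
  elim: r => [|j r IH].
    rewrite (_ : (fun z => _) = ratfun b 0)//; apply/funext => z.
    by rewrite big_nil add0r.
  have := model_lin b1 (c j) (clark_model j) IH.
  rewrite (_ : (fun z => _) = (fun z => \sum_(j0 <- j :: r) c j0 * e j0 z + ratfun b 0 z))//.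
  by apply/funext => z; rewrite big_cons addrA.
have := h (index_enum 'I_n).
rewrite (_ : (fun z => _) = (fun z => \sum_j c j * e j z))//.
by apply/funext => z; rewrite /ratfun horner0 mul0r addr0.
Qed.

(** The projection is found as the finite sum over the Clark basis; this makes
    the choice of a representative meaningful. *)
Lemma orth_projP g : L2 g -> K (orth_proj K g) /\
  forall v, K v -> inner (fun z => g z - orth_proj K g z) v = 0.
Proof.
move=> Lg.
pose u z := \sum_j inner g (e j) * e j z.
have Ku : K u by exact: model_sum.
have Lu := model_L2 Ku.
have LS c : L2 (fun z => \sum_j c j * e j z) by exact: model_L2 (model_sum c).
have [hu _] := inner_orthonormal_sum (fun j => inner g (e j)) clark_L2 clark_orthonormal.
have ou v : K v -> inner (fun z => g z - u z) v = 0.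
  move=> Kv; have Lv := model_L2 Kv; have Lw := L2B Lg Lu.
  have ev := clark_expansion Kv.
  rewrite (inner_conj Lv Lw); apply/eqP; rewrite conjC_eq0; apply/eqP.
  have -> : inner v (fun z => g z - u z) =
     inner (fun z => \sum_j inner v (e j) * e j z) (fun z => g z - u z).
    have mw := L2_cmeasurable Lw.
    apply: (inner_ae (L2_cmeasurable Lv) (L2_cmeasurable (LS _)) mw mw ev).
    exact: ae_circleW.
  rewrite (inner_suml _ _ clark_L2 Lw).
  apply: big1 => j _; rewrite (inner_conj Lw (clark_L2 j)) (innerBl Lg Lu (clark_L2 j)).
  by rewrite hu subrr conjC0 mulr0.
exact: (@xgetI _ (fun _ => 0)
   [set u | K u /\ forall v, K v -> inner (fun z => g z - u z) v = 0] u (conj Ku ou)).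
Qed.

Lemma orth_proj_coef g j : L2 g -> inner (orth_proj K g) (e j) = inner g (e j).
Proof.
move=> Lg; have [Kp op] := orth_projP Lg; have := op _ (clark_model j).
rewrite (innerBl Lg (model_L2 Kp) (clark_L2 j)).
by move/eqP; rewrite subr_eq0 => /eqP ->.
Qed.

Lemma orth_proj_contraction g : L2 g ->
  inner (orth_proj K g) (orth_proj K g) <= inner g g.
Proof.
move=> Lg; have [Kp op] := orth_projP Lg; move: (orth_proj K g) Kp op => u Ku ou.
have Lu := model_L2 Ku; have := ou _ Ku; have Lw := L2B Lg Lu.
rewrite (innerBl Lg Lu Lu) => /eqP; rewrite subr_eq0 => /eqP gu.
have ug : inner u g = inner u u.
  by rewrite (inner_conj Lg Lu) gu -(inner_conj Lu Lu).
have := inner_ge0 (fun z => g z - u z).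
rewrite (innerBl Lg Lu Lw) (inner_conj Lw Lg) (inner_conj Lw Lu).
rewrite (innerBl Lg Lu Lg) (innerBl Lg Lu Lu) gu ug subrr conjC0 subr0.
rewrite conjB -(inner_conj Lg Lg) -(inner_conj Lu Lu).
by rewrite subr_ge0.
Qed.

End ClarkBasis.

(** * Hermite interpolation at the two families of nodes *)

Section Interpolation.
Variables (F : fieldType) (m n : nat).
Variables (eta : 'I_m -> F) (zeta : 'I_n -> F).
Variables (U V : {poly F}) (P : 'I_m -> {poly F}) (Q : 'I_n -> {poly F}).
Hypotheses (m0 : (0 < m)%N) (n0 : (0 < n)%N).
Hypotheses (eta_inj : injective eta) (zeta_inj : injective zeta).
Hypothesis UE : forall p, U = P p * ('X - (eta p)%:P).
Hypothesis VE : forall s, V = Q s * ('X - (zeta s)%:P).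
Hypothesis Pn0 : forall p, (P p).[eta p] != 0.
Hypothesis Qn0 : forall s, (Q s).[zeta s] != 0.
Hypothesis sP : forall p, (size (P p) <= m)%N.
Hypothesis sQ : forall s, (size (Q s) <= n)%N.

(** A linear form on polynomials of degree < m + n, given by its values on the
    powers of X. *)
Definition coef_form (l : nat -> F) (f : {poly F}) := \sum_(k < m + n) l k * f`_k.

Lemma coef_formB l f g : coef_form l (f - g) = coef_form l f - coef_form l g.
Proof.
by rewrite /coef_form -sumrB; apply: eq_bigr => k _; rewrite coefB mulrBr.
Qed.
Lemma coef_formZ l c f : coef_form l (c *: f) = c * coef_form l f.
Proof.
by rewrite /coef_form mulr_sumr; apply: eq_bigr => k _; rewrite coefZ mulrCA.
Qed.

(** The identity on which the separation of variables rests. *)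
Lemma node_difference p s : (eta p - zeta s) *: (P p * Q s) = P p * V - U * Q s.
Proof. by rewrite (VE s) (UE p) -mul_polyC polyCB; ring. Qed.

Lemma coef_form_node l p s : (eta p - zeta s) * coef_form l (P p * Q s) =
  coef_form l (P p * V) - coef_form l (U * Q s).
Proof. by rewrite -coef_formZ node_difference coef_formB. Qed.

(** A cofactor of one root of W vanishes at the other roots. *)
Lemma eval_other (k : nat) (x : 'I_k -> F) (W : {poly F}) (S : 'I_k -> {poly F}) i j :
  injective x -> (forall i, W = S i * ('X - (x i)%:P)) -> i != j -> (S j).[x i] = 0.
Proof.
move=> xi WE ij; have := congr1 (fun f => f.[x i]) (etrans (esym (WE i)) (WE j)).
rewrite !hornerM !hornerXsubC subrr mulr0 => /esym/eqP.
by rewrite mulf_eq0 subr_eq0 (inj_eq xi) (negbTE ij) orbF => /eqP.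
Qed.

Lemma U_root z : U.[z] = 0 -> exists p, eta p = z.
Proof.
move=> Uz; case: (boolP [exists p, eta p == z]) => [/existsP[p /eqP e]|]; first by exists p.
rewrite negb_exists => /forallP h.
have p0 : 'I_m by exact: Ordinal m0.
have : P p0 = 0.
  apply: (@roots_geq_poly_eq0 _ _ (z :: [seq eta i | i <- enum 'I_m & i != p0])).
  - rewrite /= /root; apply/andP; split.
      have := Uz; rewrite (UE p0) hornerM hornerXsubC => /eqP.
      by rewrite mulf_eq0 subr_eq0 (eq_sym z) (negbTE (h p0)) orbF.
    apply/allP => x /mapP[i hi ->]; move: hi; rewrite mem_filter => /andP[ip _].
    by rewrite /root (eval_other eta_inj UE ip).
  - rewrite /= map_inj_uniq// (filter_uniq _ (enum_uniq _)) andbT.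
    by apply/negP => /mapP[i hi e]; have := h i; rewrite e eqxx.
  - have hc : (1 + count (predC (pred1 p0)) (enum 'I_m))%N = m.
      have := count_predC (pred1 p0) (enum 'I_m).
      by rewrite size_enum_ord count_uniq_mem ?enum_uniq// mem_enum.
    apply: (leq_trans (sP p0)); rewrite /= size_map size_filter.
    exact: eq_leq (esym hc).
by move=> e; have := Pn0 p0; rewrite e horner0 eqxx.
Qed.

Let common s := [pick p | eta p == zeta s].
(** One basis polynomial for each point of the second family: if that point is
    common, a single factor for the double root of U V is left out twice. *)
Let node s := if common s is Some p then P p * Q s else U * Q s.

Lemma node_at s : (node s).[zeta s] != 0.
Proof.
rewrite /node /common; case: pickP => [p /eqP e|h]; rewrite hornerM mulf_neq0//.
  by rewrite -e.
by apply/eqP => /U_root[p e]; have := h p; rewrite e eqxx.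
Qed.

Lemma node_other s s' : s != s' -> (node s').[zeta s] = 0.
Proof.
move=> ss; have h := eval_other zeta_inj VE ss.
by rewrite /node; case: (common s') => [p|]; rewrite hornerM h mulr0.
Qed.

Lemma V_at s : V.[zeta s] = 0.
Proof. by rewrite (VE s) hornerM hornerXsubC subrr mulr0. Qed.

Lemma V_neq0 : V != 0.
Proof.
have s0 : 'I_n by exact: Ordinal n0.
rewrite (VE s0) mulf_neq0 ?polyXsubC_eq0//.
by apply/eqP => e; have := Qn0 s0; rewrite e horner0 eqxx.
Qed.

(** Evaluation at zeta_s isolates the node polynomial of s. Afterwards V can be
    cancelled, and evaluation at eta_p isolates P_p. *)
Lemma hermite_free (a : 'I_m -> F) (b : 'I_n -> F) :
  \sum_p a p *: (P p * V) + \sum_s b s *: node s = 0 ->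
  (forall p, a p = 0) /\ (forall s, b s = 0).
Proof.
move=> h.
have b0 s : b s = 0.
  have := congr1 (fun f => f.[zeta s]) h; rewrite hornerD !horner_sum horner0.
  rewrite big1 ?add0r; last by move=> p _; rewrite hornerZ hornerM V_at !mulr0.
  rewrite (bigD1 s)//= big1 ?addr0; last first.
    by move=> s' ss; rewrite hornerZ node_other ?mulr0// eq_sym.
  by move/eqP; rewrite hornerZ mulf_eq0 (negbTE (node_at s)) orbF => /eqP.
split => // p.
have : (\sum_p a p *: P p) * V = 0.
  rewrite -[RHS]h [X in _ = _ + X]big1 ?addr0; last by move=> s _; rewrite b0 scale0r.
  by rewrite mulr_suml; apply: eq_bigr => i _; rewrite scalerAl.
move/eqP; rewrite mulf_eq0 (negbTE V_neq0) orbF => /eqP h2.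
have := congr1 (fun f => f.[eta p]) h2; rewrite horner_sum horner0.
rewrite (bigD1 p)//= big1 ?addr0; last first.
  by move=> i ip; rewrite hornerZ (eval_other eta_inj UE) ?mulr0// eq_sym.
by move/eqP; rewrite hornerZ mulf_eq0 (negbTE (Pn0 p)) orbF => /eqP.
Qed.

Lemma size_UV : (size U <= m.+1)%N /\ (size V <= n.+1)%N.
Proof.
split.
  rewrite (UE (Ordinal m0)) (leq_trans (size_polyMleq _ _))//.
  by rewrite size_XsubC addn2/= ltnS.
rewrite (VE (Ordinal n0)) (leq_trans (size_polyMleq _ _))//.
by rewrite size_XsubC addn2/= ltnS.
Qed.

Lemma size_nodes : (forall p, (size (P p * V)%R <= m + n)%N) /\
  (forall s, (size (node s) <= m + n)%N).
Proof.
have [sU sV] := size_UV; split=> [p|s].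
  rewrite (leq_trans (size_polyMleq _ _))//.
  by rewrite -subn1 leq_subLR add1n -addnS leq_add.
rewrite /node; case: (common s) => [p|].
  by rewrite (leq_trans (size_polyMleq _ _))// (leq_trans (leq_pred _))// leq_add.
rewrite (leq_trans (size_polyMleq _ _))//.
by rewrite -subn1 leq_subLR add1n -addSn leq_add.
Qed.

Lemma hermite_interpolation (x : 'I_m -> F) (y : 'I_n -> F) :
  exists l, (forall p, coef_form l (P p * V) = x p) /\
            (forall s, coef_form l (node s) = y s).
Proof.
pose f (i : 'I_(m + n)) := match fintype.split i with inl p => P p * V | inr s => node s end.
pose v : 'cV[F]_(m + n) := \col_i match fintype.split i with inl p => x p | inr s => y s end.
pose A : 'M[F]_(m + n) := \matrix_(i, k) (f i)`_k.
have fl p : f (lshift n p) = P p * V by rewrite /f -/(unsplit (inl p)) unsplitK.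
have fr s : f (rshift m s) = node s by rewrite /f -/(unsplit (inr s)) unsplitK.
have Af : row_free A.
  apply: inj_row_free => u uA.
  have hu : \sum_p u 0 (lshift n p) *: (P p * V) + \sum_s u 0 (rshift m s) *: node s = 0.
    have -> : \sum_p u 0 (lshift n p) *: (P p * V) + \sum_s u 0 (rshift m s) *: node s =
       \sum_i u 0 i *: f i.
      by rewrite big_split_ord/=; congr (_ + _); apply: eq_bigr => i _; rewrite ?fl ?fr.
    apply/polyP => k; rewrite coef0 coef_sum.
    have [kn|kn] := ltnP k (m + n); last first.
      have [h1 h2] := size_nodes.
      rewrite big1// => i _; rewrite coefZ nth_default ?mulr0// (leq_trans _ kn)//.
      by rewrite /f; case: (fintype.split i).
    have := congr1 (fun B : 'rV[F]_(m + n) => B 0 (Ordinal kn)) uA; rewrite !mxE => e.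
    by rewrite -[RHS]e; apply: eq_bigr => i _; rewrite coefZ !mxE.
  have [h1 h2] := hermite_free hu.
  apply/rowP => i; rewrite mxE; rewrite -(splitK i); case: (fintype.split i) => j /=; [exact: h1|exact: h2].
have Au : A \in unitmx by rewrite -row_free_unit.
pose lv := invmx A *m v.
have lE : A *m lv = v by rewrite mulKVmx.
pose l (k : nat) := if insub k is Some i then lv i 0 else 0.
have cE i : coef_form l (f i) = v i 0.
  rewrite -lE mxE /coef_form; apply: eq_bigr => k _.
  by rewrite /l valK [A i k]mxE mulrC.
exists l; split=> [p|s].
- by rewrite -fl cE mxE (unsplitK (inl p : 'I_m + 'I_n)).
- by rewrite -fr cE mxE (unsplitK (inr s : 'I_m + 'I_n)).
Qed.

(** The differences (eta_p - zeta_s) D(s, p) separate because P_p V and U Q_s do.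
    Conversely the entries at common points, where the difference carries no
    information, are prescribed directly through [hermite_interpolation]. *)
Theorem representable_iff_separated (D : 'I_n -> 'I_m -> F) :
  (exists l, forall s p, D s p = coef_form l (P p * Q s)) <->
  (exists x y, forall s p, (eta p - zeta s) * D s p = x p - y s).
Proof.
split.
  move=> [l hl]; exists (fun p => coef_form l (P p * V)), (fun s => coef_form l (U * Q s)).
  by move=> s p; rewrite hl coef_form_node.
move=> [x [y h]].
have [l [hx hy]] := hermite_interpolation x
  (fun s => if common s is Some p then D s p else y s).
exists l => s p.
have := hy s; rewrite /node; case E: (common s) => [q|].
  move: E; rewrite /common; case: pickP => // q' /eqP e [e']; subst q'.
  move=> hq; have [->|pq] := eqVneq p q; first by rewrite hq.
  have pz : eta p - zeta s != 0 by rewrite subr_eq0 -e (inj_eq eta_inj).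
  apply: (mulfI pz); rewrite h coef_form_node hx.
  have -> : U * Q s = P q * V by rewrite (UE q) (VE s) e; ring.
  rewrite hx; have := h s q; rewrite e subrr mul0r => /esym/eqP.
  by rewrite subr_eq0 => /eqP ->.
move: E; rewrite /common; case: pickP => // e _ hq.
have pz : eta p - zeta s != 0 by rewrite subr_eq0 e.
by apply: (mulfI pz); rewrite h coef_form_node hx hq.
Qed.

End Interpolation.

(** * Entry formulas as a separation of variables *)

Section Formulas.
Variables (F : fieldType) (m n : nat).
Variables (eta : 'I_m -> F) (zeta : 'I_n -> F).
Variables (ra wa : 'I_m -> F) (rb wb : 'I_n -> F) (t : 'M[F]_(n, m)).
Hypotheses (ra0 : forall p, ra p != 0) (wa0 : forall p, wa p != 0).
Hypotheses (rb0 : forall s, rb s != 0) (wb0 : forall s, wb s != 0).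
Variables (p1 : 'I_m) (s1 : 'I_n).

(** Clears norms and weights from the entries, so that only differences of points
    are left in the formulas. *)
Definition scaled_entry s p := ra p * rb s * wa p * wb s * t s p.
Let T s p := (eta p - zeta s) * scaled_entry s p.
Let separated := exists x y, forall s p, T s p = x p - y s.

Lemma eq_rhs (X Y Z : F) : X = Y -> (Z = X) <-> (Z = Y).
Proof. by move=> ->. Qed.

Lemma solve_entry s p X : eta p != zeta s ->
  (t s p = X / (ra p * rb s * wa p * wb s * (eta p - zeta s))) <-> (T s p = X).
Proof.
move=> h; have d0 : ra p * rb s * wa p * wb s * (eta p - zeta s) != 0.
  by rewrite !mulf_neq0// subr_eq0.
have -> : T s p = t s p * (ra p * rb s * wa p * wb s * (eta p - zeta s)).
  by rewrite /T /scaled_entry; ring.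
by split=> [->|<-]; rewrite ?divfK ?mulfK.
Qed.

(** The entry formula is the relation for T divided by the non-zero factors of
    [scaled_entry]; likewise in the next two lemmas. *)
Lemma disjoint_formula s p : eta p != zeta s ->
  (t s p =
         ra p1 / ra p * (wa p1 / wa p)
           * ((eta p1 - zeta s) / (eta p - zeta s)) * t s p1
         + ra p1 * rb s1 / (ra p * rb s) * (wa p1 * wb s1 / (wa p * wb s))
           * ((zeta s1 - eta p1) / (eta p - zeta s)) * t s1 p1
         + rb s1 / rb s * (wb s1 / wb s)
           * ((eta p - zeta s1) / (eta p - zeta s)) * t s1 p) <->
  T s p = T s p1 - T s1 p1 + T s1 p.
Proof.
move=> h; rewrite -solve_entry//.
have h' : eta p - zeta s != 0 by rewrite subr_eq0.
apply: eq_rhs.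
rewrite /T /scaled_entry; field.
by rewrite h' wb0 wa0 rb0 ra0.
Qed.

Lemma common_formula s (s' p : 'I_m) : eta p != zeta s -> eta s' = zeta s ->
  eta p1 = zeta s1 ->
  (t s p =
         ra s' * rb s1 / (ra p * rb s) * (wa s' * wb s1 / (wa p * wb s))
           * ((eta p1 - zeta s) / (eta p - zeta s)) * t s1 s'
         + rb s1 / rb s * (wb s1 / wb s)
           * ((eta p - zeta s1) / (eta p - zeta s)) * t s1 p) <->
  T s p = T s1 p - T s1 s'.
Proof.
move=> h es e1; rewrite -solve_entry//.
have h' : eta p - zeta s != 0 by rewrite subr_eq0.
apply: eq_rhs.
rewrite /T /scaled_entry es e1; field.
by rewrite h' wb0 wa0 rb0 ra0.
Qed.

Lemma private_formula s p : eta p != zeta s ->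
  (t s p =
         ra p1 / ra p * (wa p1 / wa p)
           * ((eta p1 - zeta s) / (eta p - zeta s)) * t s p1
         + rb s1 / rb s * (wb s1 / wb s)
           * ((eta p - zeta s1) / (eta p - zeta s)) * t s1 p) <->
  T s p = T s p1 + T s1 p.
Proof.
move=> h; rewrite -solve_entry//.
have h' : eta p - zeta s != 0 by rewrite subr_eq0.
apply: eq_rhs.
rewrite /T /scaled_entry; field.
by rewrite h' wb0 wa0 rb0 ra0.
Qed.

Lemma separated_disjoint : (forall s p, eta p != zeta s) ->
  separated <-> (forall p s, T s p = T s p1 - T s1 p1 + T s1 p).
Proof.
move=> h; split=> [[x [y hxy]] p s|hT]; first by rewrite !hxy; ring.
exists (fun p => T s1 p), (fun s => T s1 p1 - T s p1) => s p.
by rewrite hT; ring.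
Qed.

(** At a common point T vanishes, so x and y agree there. The converse takes
    x = T(1, .), and y from the same row at common points, from the first column
    with opposite sign elsewhere. *)
Lemma separated_common (l : nat) : (l <= m)%N -> eta p1 = zeta s1 ->
  (forall (i : 'I_m) (j : 'I_n), (i < l)%N -> i = j :> nat -> eta i = zeta j) ->
  separated <->
  (forall (p : 'I_m) (s : 'I_n) (s' : 'I_m), s' = s :> nat -> (s < l)%N ->
     s != p :> nat -> T s p = T s1 p - T s1 s') /\
  (forall (p : 'I_m) (s : 'I_n), (l <= s)%N -> T s p = T s p1 + T s1 p).
Proof.
move=> lm e1 he.
have Tcommon (s : 'I_n) (p : 'I_m) : p = s :> nat -> (s < l)%N -> T s p = 0.
  by move=> ps sl; rewrite /T (he p s) ?subrr ?mul0r// ps.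
split=> [[x [y hxy]]|[h1 h2]].
  have e1' : x p1 = y s1.
    by apply/eqP; rewrite -subr_eq0 -hxy /T e1 subrr mul0r.
  split=> [p s s' ss sl _|p s _]; last by rewrite !hxy e1'; ring.
  have := Tcommon s s' ss sl; rewrite hxy => /eqP; rewrite subr_eq0 => /eqP e2.
  by rewrite !hxy e2; ring.
exists (fun p => T s1 p), (fun s : 'I_n => if (s < l)%N then T s1 (insubd p1 (s : nat)) else - T s p1).
move=> /= s p; case: ltnP => sl; last by rewrite opprK addrC h2.
have ss : insubd p1 (s : nat) = s :> nat.
  by rewrite val_insubd (leq_trans sl lm).
have [sp|sp] := eqVneq (s : nat) p; last exact: h1.
rewrite (_ : insubd p1 (s : nat) = p); first by rewrite subrr Tcommon.
by apply: val_inj; rewrite /= ss.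
Qed.

End Formulas.

(** * Counting the common points *)

Section CommonPoints.
Lemma card_eq_leW (T U : Type) (A : set T) (B : set U) : A #= B -> A #<= B.
Proof. by rewrite card_eq_le => /andP[]. Qed.

Variables (K : Type) (m n l : nat) (eta : 'I_m -> K) (zeta : 'I_n -> K).
Hypothesis hl : range eta `&` range zeta #= `I_l.

Lemma common_card_le : (l <= m)%N /\ (l <= n)%N.
Proof.
have h := hl; rewrite card_eq_sym in h.
have hle (k : nat) (f : 'I_k -> K) : range eta `&` range zeta `<=` range f -> (l <= k)%N.
  move=> sub; rewrite -card_le_II.
  apply: card_le_trans (card_eq_leW h) _.
  apply: card_le_trans (subset_card_le sub) _.
  apply: card_le_trans (card_image_le _ _) _.
  by apply: card_eq_leW; rewrite card_eq_sym; exact: card_II.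
by split; [apply: (hle _ eta) => x []|apply: (hle _ zeta) => x []].
Qed.

Hypotheses (zeta_inj : injective zeta).
Hypothesis hcommon : forall (i : 'I_m) (j : 'I_n),
  (i < l)%N -> i = j :> nat -> eta i = zeta j.

(** Another common point would give l + 1 of them: the first l ones and that one. *)
Lemma not_common (p : 'I_m) (s : 'I_n) : (l <= s)%N -> eta p <> zeta s.
Proof.
move=> ls eps; have [lm ln] := common_card_le.
pose g (i : nat) : 'I_n := if (i < l)%N then insubd s i else s.
have gv i : (i < l)%N -> g i = i :> nat.
  by move=> il; rewrite /g il val_insubd (leq_trans il ln).
have gl i : (i < l.+1)%N -> (i < l)%N = false -> i = l /\ g i = s.
  rewrite ltnS => h1 h2; split; last by rewrite /g h2.
  by apply/eqP; rewrite eqn_leq h1 leqNgt h2.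
(* phi lists the first l points and then the extra point. *)
pose phi i := zeta (g i).
have inj : {in `I_l.+1 &, injective phi}.
  move=> i j; rewrite !inE /= => hi hj /zeta_inj e.
  have e' := congr1 val e; case hil: (i < l)%N; case hjl : (j < l)%N.
  - by rewrite -(gv i hil) -(gv j hjl).
  - have [_ gj] := gl j hj hjl; move: e'; rewrite gj /= gv// => e'.
    by move: hil; rewrite e' ltnNge ls.
  - have [_ gi] := gl i hi hil; move: e'; rewrite gi /= gv// => e'.
    by move: hjl; rewrite -e' ltnNge ls.
  - by have [-> _] := gl i hi hil; have [-> _] := gl j hj hjl.
have sub : phi @` `I_l.+1 `<=` range eta `&` range zeta.
  move=> _ [i hi <-]; split; last by exists (g i).
  case hil: (i < l)%N; last by have [_ gi] := gl i hi hil; exists p => //; rewrite /phi gi.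
  exists (Ordinal (leq_trans hil lm)) => //.
  by apply: hcommon => //=; rewrite gv.
have : (l.+1 <= l)%N.
  rewrite -card_le_II; have h := inj_card_eq inj; rewrite card_eq_sym in h.
  apply: card_le_trans (card_eq_leW h) _.
  by apply: card_le_trans (subset_card_le sub) _; exact: card_eq_leW.
by rewrite ltnn.
Qed.
End CommonPoints.

(** * Matrices of asymmetric truncated Toeplitz operators *)

Section ToeplitzMatrix.
Variable R : realType.
Local Notation C := R[i].
Local Notation I := (@circle_integral R).
Implicit Types (f g h phi : C -> C) (z : C).

(** The weight is a square root of lambda / eta, which makes the entry formulas
    symmetric in the two bases. *)
Lemma weight_sqr (arg : C -> R) (lambda eta : C) : is_arg arg ->
  `|lambda| = 1 -> `|eta| = 1 -> clark_weight arg lambda eta ^+ 2 * eta = lambda.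
Proof.
move=> harg hl he; rewrite /clark_weight expiX.
rewrite -{2}(harg _ he) -expiD -[RHS](harg _ hl); congr expi.
rewrite mulr2n; lra.
Qed.

Lemma inner_cboundedM phi f (N : R) : 0 <= N -> (forall t, normc (phi (expi t)) <= N) ->
  cmeasurable phi -> L2 f ->
  inner (fun z => phi z * f z) (fun z => phi z * f z) <= (N ^+ 2)%:C * inner f f.
Proof.
move=> N0 hN mphi Lf.
have Lg : L2 (fun z => phi z * f z) by apply: L2_cboundedM => //; split; [|exists N].
have /L2E[_ i1] := Lf; have /L2E[_ i2] := Lg.
rewrite !innerxx -rmorphM lecR mulrCA ler_wpM2l ?invr_ge0 ?mulr_ge0 ?pi_ge0//.
rewrite -RintegralZl//; last exact: measurable_period.
apply: le_Rintegral => //; first exact: measurable_period.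
  exact: integrable_realM.
move=> t _; rewrite normcM exprMn ler_wpM2r ?sqr_ge0//.
by rewrite lerXn2r ?nnegrE ?normc_ge0.
Qed.

Variables (m n : nat) (a : 'I_m -> C) (b : 'I_n -> C).
Hypotheses (m0 : (0 < m)%N) (n0 : (0 < n)%N).
Hypotheses (a1 : forall j, `|a j| < 1) (b1 : forall j, `|b j| < 1).
Local Notation alpha := (blaschke a).
Local Notation beta := (blaschke b).
Local Notation KA := (model_space alpha).
Local Notation KB := (model_space beta).

Variables (eta : 'I_m -> C) (da : C) (zeta : 'I_n -> C) (db : C).
Hypotheses (eta_inj : injective eta) (zeta_inj : injective zeta).
Hypotheses (eta1 : forall j, `|eta j| = 1) (zeta1 : forall j, `|zeta j| = 1).
Hypotheses (etad : forall j, alpha (eta j) = da) (zetad : forall j, beta (zeta j) = db).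

Variables (arg : C -> R) (lambda1 lambda2 : C).
Hypothesis harg : is_arg arg.
Hypothesis hl1 : `|lambda1| = 1.

Local Notation ea p := (modified_clark_vector arg alpha lambda1 (eta p)).
Local Notation eb s := (modified_clark_vector arg beta lambda2 (zeta s)).
Local Notation ra p := (sqrtC (abs_deriv alpha (eta p))).
Local Notation rb s := (sqrtC (abs_deriv beta (zeta s))).
Local Notation wa p := (clark_weight arg lambda1 (eta p)).
Local Notation wb s := (clark_weight arg lambda2 (zeta s)).
Local Notation PA p := (kernel_poly a (eta p)).
Local Notation PB s := (kernel_poly b (zeta s)).
Local Notation QA := (blaschke_den a).
Local Notation MB := (blaschke_num b).
Local Notation sB := (blaschke_sign R n).

(** The constant that the rescaling of [toeplitz_entry] leaves. *)
Let kappa : C := da^* * lambda1 * sB.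
Let kappa0 : kappa != 0.
Proof.
rewrite !mulf_neq0 ?conjC_eq0 ?blaschke_sign_neq0//; last exact: unit_neq0.
exact/unit_neq0/(clark_d1 m0 a1 eta1 etad).
Qed.

(** Values of the linear form attached to a symbol on the powers of X. *)
Definition toeplitz_moment phi (k : nat) : C :=
  I (fun z => phi z * (z ^+ k.+1 / (QA.[z] * MB.[z]))).

Lemma cbounded_QM : cbounded (fun z => (QA.[z] * MB.[z])^-1).
Proof.
have h1 : cbounded (fun z => 1 / QA.[z]).
  apply: (cbounded_ext _ (cbounded_ratfun a1 1)) => t; by rewrite /ratfun hornerC.
have h2 : cbounded (fun z => (ratfun b 1 z)^*) by apply: cboundedJ; exact: cbounded_ratfun.
have h3 : cbounded (fun z => (z : C)^-1 ^+ n) by exact: cbounded_invX.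
apply: (cbounded_ext _ (cboundedM h1 (cboundedM h2 h3))) => t.
have hz := expi_norm1 t; have z0 := unit_neq0 hz.
rewrite /ratfun hornerC !mul1r conjV (blaschke_den_conj _ hz) invfM exprVn.
have := blaschke_den_neq0 a1 hz; have := blaschke_num_neq0 b1 hz.
have zn : expi t ^+ n != 0 by rewrite expf_neq0.
move: zn; set x := expi t ^+ n => x0 q0 m0'; field.
by rewrite ?x0 ?q0 ?m0'.
Qed.

Lemma cintegrable_moment phi k : L2 phi ->
  cintegrable (fun z => phi z * (z ^+ k.+1 / (QA.[z] * MB.[z]))).
Proof.
move=> Lp; apply: L2_cintegrable.
have hb : cbounded (fun z => z ^+ k.+1 / (QA.[z] * MB.[z])).
  exact: (cboundedM (cboundedX k.+1 cbounded_id) cbounded_QM).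
by apply: (L2_ext _ (L2_cboundedM hb Lp)) => t; rewrite mulrC.
Qed.

(** The product of a kernel for alpha and a conjugate kernel for beta is z times
    a polynomial over the fixed denominator QA MB. *)
Lemma kernel_moment phi p s : L2 phi ->
  inner (fun z => phi z * boundary_kernel alpha (eta p) z) (boundary_kernel beta (zeta s)) =
  da^* * eta p * sB * coef_form m n (toeplitz_moment phi) (PA p * PB s).
Proof.
move=> Lp; set f := PA p * PB s; set c := da^* * eta p * sB.
have sf : (size f <= m + n)%N.
  rewrite (leq_trans (size_polyMleq _ _))// (leq_trans (leq_pred _))// leq_add//.
    exact: size_kernel_poly.
  exact: size_kernel_poly.
have -> : inner (fun z => phi z * boundary_kernel alpha (eta p) z) (boundary_kernel beta (zeta s)) =
    I (fun z => \sum_(k < m + n) (c * f`_k) * (phi z * (z ^+ k.+1 / (QA.[z] * MB.[z])))).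
  apply: circle_integral_ae.
  - apply: cmeasurableM.
      by apply: cmeasurableM; [exact: L2_cmeasurable Lp|exact: (boundary_kernel_bounded a1 (eta1 p)).1].
    by apply: cmeasurableJ; exact: (boundary_kernel_bounded b1 (zeta1 s)).1.
  - apply: cmeasurable_sum => k; apply: cmeasurableM; first exact: cmeasurable_cst.
    by apply: cintegrable_cmeasurable; exact: cintegrable_moment.
  move: (ae_circle_neq (eta p)) (ae_circle_neq (zeta s)); apply: ae_circle_imp2.
  move=> z hz /eqP ze /eqP zz.
  rewrite (kernel_ratfunE a1 (eta1 p) hz ze) /kernel_ratfun /ratfun hornerZ etad.
  rewrite (kernel_ratfun_conj b1 (zeta1 s) hz zz).
  have q0 := blaschke_den_neq0 a1 hz; have mb0 := blaschke_num_neq0 b1 hz.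
  transitivity (c * (phi z * (z * f.[z] / (QA.[z] * MB.[z])))).
    rewrite /f hornerM /c; field.
    by rewrite ?q0 ?mb0.
  rewrite (horner_coef_wide _ sf) !(mulr_sumr, mulr_suml).
  by apply: eq_bigr => k _; rewrite exprS; ring.
rewrite (circle_integral_sum _ _).2; last by move=> k; apply: cintegrableZ; exact: cintegrable_moment.
rewrite /coef_form mulr_sumr; apply: eq_bigr => k _.
rewrite circle_integralZ; last exact: cintegrable_moment.
by rewrite -/(toeplitz_moment phi k); ring.
Qed.

Lemma scaling_identity (x y u v w dd s lam L : C) : x != 0 -> y != 0 -> u != 0 ->
  v != 0 -> u ^+ 2 * w = lam ->
  x * y * u * v * ((u / x) * ((v^-1 / y) * (dd * w * s * L))) = dd * lam * s * L.
Proof. by move=> x0 y0 u0 v0 <-; field; rewrite ?x0 ?y0 ?v0. Qed.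

Lemma toeplitz_entry phi p s : L2 phi ->
  ra p * rb s * wa p * wb s * inner (fun z => phi z * ea p z) (eb s) =
  kappa * coef_form m n (toeplitz_moment phi) (PA p * PB s).
Proof.
move=> Lp.
have ra0 := clark_norm_neq0 m0 a1 eta_inj eta1 etad p.
have rb0 := clark_norm_neq0 n0 b1 zeta_inj zeta1 zetad s.
have Lk := cbounded_L2 (boundary_kernel_bounded b1 (zeta1 s)).
have Lpk : L2 (fun z => phi z * boundary_kernel alpha (eta p) z).
  apply: (L2_ext _ (L2_cboundedM (boundary_kernel_bounded a1 (eta1 p)) Lp)) => t.
  by rewrite mulrC.
have eaE : (fun z => phi z * ea p z) =
    (fun z => (wa p / ra p) * (phi z * boundary_kernel alpha (eta p) z)).
  apply/funext => z; rewrite (clark_vecE m0 a1 eta_inj eta1 etad).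
  exact: mulrCA.
have ebE : eb s = (fun z => (wb s / rb s) * boundary_kernel beta (zeta s) z).
  by apply/funext => z; rewrite (clark_vecE n0 b1 zeta_inj zeta1 zetad).
rewrite eaE ebE (innerZl _ Lpk (L2Z _ Lk)) (inner_conj (L2Z _ Lk) Lpk).
rewrite (innerZl _ Lk Lpk) (conjM (wb s / rb s)) -(inner_conj Lk Lpk).
rewrite (conjM (wb s)) (conjV (rb s)) sqrt_conj (expi_conj _).
rewrite (kernel_moment p s Lp).
have wa0 : wa p != 0 := expi_neq0 _.
have wb0 : wb s != 0 := expi_neq0 _.
have h := scaling_identity da^* sB (coef_form m n (toeplitz_moment phi) (PA p * PB s))
  ra0 rb0 wa0 wb0 (weight_sqr harg hl1 (eta1 p)).
exact: h.
Qed.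

(** A trigonometric polynomial times QA MB / z has the prescribed moments, by
    orthogonality of the powers of z. *)
Lemma moment_exists (l : nat -> C) : exists2 phi : C -> C, cbounded phi &
  forall k, (k < m + n)%N -> kappa * toeplitz_moment phi k = l k.
Proof.
pose phi z := QA.[z] * MB.[z] * z^-1 * \sum_(j < m + n) (l j / kappa) * z^-1 ^+ j.
have bphi : cbounded phi.
  apply: cboundedM.
    apply: cboundedM; first by apply: cboundedM; exact: cbounded_horner.
    by apply: (cbounded_ext _ (cbounded_invX R 1)) => t; rewrite expr1.
  have h (r : seq 'I_(m + n)) : cbounded (fun z => \sum_(j <- r) (l j / kappa) * z^-1 ^+ j).
    elim: r => [|j r IH].
      by apply: (cbounded_ext _ (cbounded_cst 0)) => t; rewrite big_nil.
    apply: (cbounded_ext _ (cboundedD (cboundedM (cbounded_cst (l j / kappa)) (cbounded_invX R j)) IH)) => t.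
    by rewrite big_cons.
  exact: h.
exists phi => // k kN; rewrite /toeplitz_moment.
transitivity (kappa * I (fun z => \sum_(j < m + n) (l j / kappa) * (z ^+ k * (z ^+ j)^*))).
  congr (_ * _); apply: eq_circle_integral => t; have hz := expi_norm1 t.
  have z0 := unit_neq0 hz; have q0 := blaschke_den_neq0 a1 hz; have mb0 := blaschke_num_neq0 b1 hz.
  transitivity (expi t ^+ k * \sum_(j < m + n) l j / kappa * (expi t)^-1 ^+ j).
    rewrite /phi exprS; field.
    by rewrite ?q0 ?mb0 ?z0.
  rewrite mulr_sumr; apply: eq_bigr => j _.
  by rewrite conjX (unimod_conj hz) mulrCA.
have ce j : cintegrable (fun z : C => z ^+ k * (z ^+ j)^*).
  by apply: cintegrable_inner; exact/cbounded_L2/cboundedX/cbounded_id.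
rewrite (circle_integral_sum _ _).2; last by move=> j; exact: cintegrableZ.
rewrite (bigD1 (Ordinal kN))//= big1 ?addr0; last first.
  move=> j jk; rewrite circle_integralZ// -/(inner (fun z => z ^+ k) (fun z => z ^+ j)) inner_exp.
  case: eqP => [e|_]; last by rewrite mulr0.
  by move: jk; rewrite -val_eqE /= e eqxx.
rewrite circle_integralZ// -/(inner (fun z => z ^+ k) (fun z => z ^+ k)) inner_exp eqxx mulr1.
by rewrite mulrC divfK.
Qed.

Section Operator.
Variables (A : (C -> C) -> (C -> C)) (t : 'M[C]_(n, m)).
Hypothesis hA : linear_transformation KA KB A.
Hypothesis ht : matrix_representation (fun p => ea p) (fun s => eb s) A t.

Let ea_model p : KA (ea p) := clark_model m0 a1 eta_inj eta1 etad arg lambda1 p.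
Let eb_model s : KB (eb s) := clark_model n0 b1 zeta_inj zeta1 zetad arg lambda2 s.
Let eb_L2 s : L2 (eb s) := model_L2 (eb_model s).
Let eb_on i j : inner (eb i) (eb j) = (i == j)%:R :=
  clark_orthonormal n0 b1 zeta_inj zeta1 zetad arg lambda2 i j.
Let KA_sum c : KA (fun z => \sum_p c p * ea p z) :=
  model_sum m0 a1 eta_inj eta1 etad arg lambda1 c.

Lemma matrix_entry p s : inner (A (ea p)) (eb s) = t s p.
Proof.
have [Amap _ _] := hA.
have LA := model_L2 (Amap _ (ea_model p)).
have LS : L2 (fun z => \sum_s0 t s0 p * eb s0 z).
  by apply: L2_sum => i; apply: L2Z; exact: eb_L2.
have [h _] := inner_orthonormal_sum (fun s => t s p) eb_L2 eb_on.
rewrite -[RHS](h s).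
have me := L2_cmeasurable (eb_L2 s).
apply: (inner_ae (L2_cmeasurable LA) (L2_cmeasurable LS) me me (ht p)).
exact: ae_circleW.
Qed.

(** Linearity is assumed up to almost everywhere equality; membership is carried
    along because it is only assumed on the model space. The value at 0 is found
    from (-1) 0 + 0 = 0. *)
Lemma linear_sum (r : seq 'I_m) (c : 'I_m -> C) :
  KA (fun z => \sum_(p <- r) c p * ea p z) /\
  eq_circle (A (fun z => \sum_(p <- r) c p * ea p z))
    (fun z => \sum_(p <- r) c p * A (ea p) z).
Proof.
have [Amap Aae Alin] := hA.
have Kz : KA (fun _ => 0).
  have := KA_sum (fun _ => 0); rewrite (_ : (fun z => _) = (fun _ => 0))//.
  by apply/funext => z; apply: big1 => p _; rewrite mul0r.
elim: r => [|p r [IH1 IH2]].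
  rewrite (_ : (fun z => _) = (fun _ => 0)); last first.
    by apply/funext => z; rewrite big_nil.
  split; first exact: Kz.
  have := Alin (-1) _ _ Kz Kz.
  rewrite (_ : (fun z : C => -1 * 0 + 0) = (fun _ => 0)); last first.
    by apply/funext => z; rewrite mulr0 addr0.
  by apply: ae_circle_imp => z _ ->; rewrite big_nil mulN1r addNr.
have e : (fun z => \sum_(p <- p :: r) c p * ea p z) =
    (fun z => c p * ea p z + \sum_(p <- r) c p * ea p z).
  by apply/funext => z; rewrite big_cons.
rewrite e; split.
  exact: (model_lin a1 (c p) (ea_model p) IH1).
have h := Alin (c p) _ _ (ea_model p) IH1.
by move: h IH2; apply: ae_circle_imp2 => z _ -> ->; rewrite big_cons.
Qed.

Lemma toeplitz_matrix_entry phi p s : L2 phi ->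
  (forall f, KA f -> eq_circle (A f) (asym_toeplitz_op beta phi f)) ->
  t s p = inner (fun z => phi z * ea p z) (eb s).
Proof.
move=> Lp hphi; have [Amap _ _] := hA.
have Lg : L2 (fun z => phi z * ea p z).
  apply: (L2_ext _ (L2_cboundedM (clark_bounded m0 a1 eta_inj eta1 etad arg lambda1 p) Lp)) => x.
  by rewrite mulrC.
have [Ko _] := orth_projP n0 b1 zeta_inj zeta1 zetad arg lambda2 Lg.
rewrite -(orth_proj_coef n0 b1 zeta_inj zeta1 zetad arg lambda2 s Lg) -matrix_entry.
have me := L2_cmeasurable (eb_L2 s).
apply: (inner_ae (L2_cmeasurable (model_L2 (Amap _ (ea_model p)))) (L2_cmeasurable (model_L2 Ko)) me me).
  exact: (hphi _ (ea_model p)).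
exact: ae_circleW.
Qed.

(** A bounded operator is determined by its entries: both sides are expanded in
    the two Clark bases. Boundedness follows from that of the symbol, since the
    projection is a contraction. *)
Lemma toeplitz_of_entries phi : cbounded phi ->
  (forall p s, t s p = inner (fun z => phi z * ea p z) (eb s)) ->
  asym_truncated_toeplitz alpha beta A.
Proof.
move=> bphi hphi; have [Amap Aae Alin] := hA.
have Lg f : KA f -> L2 (fun z => phi z * f z).
  by move=> Kf; apply: L2_cboundedM; [exact: bphi|exact: model_L2 Kf].
exists phi; split; first exact: cbounded_L2.
  have [mphi [N hN]] := bphi.
  have N0 : 0 <= N := le_trans (normc_ge0 _) (hN 0).
  exists N => f Kf.
  have h1 := orth_proj_contraction n0 b1 zeta_inj zeta1 zetad arg lambda2 (Lg f Kf).
  have h2 := inner_cboundedM N0 hN mphi (model_L2 Kf).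
  have h3 := le_trans h1 h2.
  rewrite /L2norm -(@ler_pXn2r _ 2)// ?nnegrE ?mulr_ge0 ?sqrtC_ge0 ?inner_ge0 ?ler0c//.
  rewrite exprMn !sqrtCK; move: h3; rewrite rmorphXn; exact.
move=> f Kf.
have fE := clark_expansion m0 a1 eta_inj eta1 etad arg lambda1 Kf.
set c := fun p => inner f (ea p) in fE *.
have [KS AS] := linear_sum (index_enum 'I_m) c.
have Af := Aae _ _ Kf KS fE.
have [Ko _] := orth_projP n0 b1 zeta_inj zeta1 zetad arg lambda2 (Lg f Kf).
have oE := clark_expansion n0 b1 zeta_inj zeta1 zetad arg lambda2 Ko.
have oc s : inner (asym_toeplitz_op beta phi f) (eb s) = \sum_p c p * t s p.
  rewrite /asym_toeplitz_op.
  rewrite (orth_proj_coef n0 b1 zeta_inj zeta1 zetad arg lambda2 s (Lg f Kf)).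
  have me := L2_cmeasurable (eb_L2 s).
  have LgS : L2 (fun z => \sum_p c p * (phi z * ea p z)).
    by apply: L2_sum => p; apply: L2Z; exact: Lg (ea_model p).
  transitivity (inner (fun z => \sum_p c p * (phi z * ea p z)) (eb s)).
    apply: (inner_ae (L2_cmeasurable (Lg f Kf)) (L2_cmeasurable LgS) me me); last exact: ae_circleW.
    move: fE; apply: ae_circle_imp => z _ ->; rewrite mulr_sumr.
    by apply: eq_bigr => p _; rewrite mulrCA.
  rewrite (inner_suml _ _ (fun p => Lg _ (ea_model p)) (eb_L2 s)).
  by apply: eq_bigr => p _; rewrite hphi.
have ht' : ae_circle (fun z => forall p, A (ea p) z = \sum_(s < n) t s p * eb s z).
  have h (r : seq 'I_m) : ae_circle (fun z => forall p, p \in r -> A (ea p) z = \sum_(s < n) t s p * eb s z).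
    elim: r => [|p r IH]; first exact: ae_circleW.
    move: (ht p) IH; apply: ae_circle_imp2 => z _ h1 h2 q.
    by rewrite in_cons => /orP[/eqP->//|]; exact: h2.
  move: (h (enum 'I_m)); apply: ae_circle_imp => z _ h1 p; apply: h1.
  by rewrite mem_enum.
have A1 : eq_circle (A f) (fun z => \sum_p c p * A (ea p) z).
  by move: Af AS; apply: ae_circle_imp2 => z _ ->.
have A2 : eq_circle (A f) (fun z => \sum_s (\sum_p c p * t s p) * eb s z).
  move: A1 ht'; apply: ae_circle_imp2 => z _ -> hz.
  rewrite (eq_bigr (fun p => \sum_(s < n) c p * t s p * eb s z)); last first.
    by move=> p _; rewrite hz mulr_sumr; apply: eq_bigr => s _; rewrite mulrA.
  by rewrite exchange_big/=; apply: eq_bigr => s _; rewrite mulr_suml.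
move: A2 oE; apply: ae_circle_imp2 => z _ -> oz.
rewrite /asym_toeplitz_op oz; apply: eq_bigr => s _; congr (_ * _).
by rewrite -oc.
Qed.
Lemma toeplitz_iff_representable :
  asym_truncated_toeplitz alpha beta A <->
  exists l, forall s p,
    scaled_entry (fun p => ra p) (fun p => wa p) (fun s => rb s) (fun s => wb s) t s p =
    coef_form m n l (PA p * PB s).
Proof.
have kc phi p s : kappa * coef_form m n (toeplitz_moment phi) (PA p * PB s) =
    coef_form m n (fun k => kappa * toeplitz_moment phi k) (PA p * PB s).
  by rewrite /coef_form mulr_sumr; apply: eq_bigr => k _; rewrite mulrA.
split.
  move=> [phi [Lp _ hphi]]; exists (fun k => kappa * toeplitz_moment phi k) => s p.
  rewrite -kc -(toeplitz_entry p s Lp) -(toeplitz_matrix_entry p s Lp hphi).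
  by [].
move=> [l hl].
have [phi bphi hphi] := moment_exists l.
apply: (toeplitz_of_entries bphi) => p s.
have ra0 := clark_norm_neq0 m0 a1 eta_inj eta1 etad p.
have rb0 := clark_norm_neq0 n0 b1 zeta_inj zeta1 zetad s.
have wa0 : wa p != 0 := expi_neq0 _.
have wb0 : wb s != 0 := expi_neq0 _.
have c0 := mulf_neq0 (mulf_neq0 (mulf_neq0 ra0 rb0) wa0) wb0.
apply: (mulfI c0); rewrite (toeplitz_entry p s (cbounded_L2 bphi)) kc.
rewrite -[LHS]/(scaled_entry (fun p => ra p) (fun p => wa p) (fun s => rb s) (fun s => wb s) t s p) hl.
by apply: eq_bigr => k _; rewrite hphi.
Qed.
End Operator.
End ToeplitzMatrix.

(** * The characterization *)

Theorem theorem3p6 (R : realType) (m n : nat) (hm : (0 < m)%N) (hn : (0 < n)%N)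
    (alpha beta : R[i] -> R[i])
    (halpha : finite_blaschke m alpha) (hbeta : finite_blaschke n beta)
    (arg : R[i] -> R) (harg : is_arg arg)
    (lambda1 lambda2 : R[i])
    (hlambda1 : `|lambda1| = 1) (hlambda2 : `|lambda2| = 1)
    (eta : 'I_m -> R[i]) (zeta : 'I_n -> R[i])
    (heta : clark_points alpha lambda1 eta)
    (hzeta : clark_points beta lambda2 zeta)
    (l : nat) (hl : range eta `&` range zeta #= `I_l)
    (hcommon : forall (i : 'I_m) (j : 'I_n),
      (i < l)%N -> i = j :> nat -> eta i = zeta j)
    (A : (R[i] -> R[i]) -> (R[i] -> R[i]))
    (hA : linear_transformation (model_space alpha) (model_space beta) A)
    (t : 'M[R[i]]_(n, m))
    (ht : matrix_representation
      (fun p => modified_clark_vector arg alpha lambda1 (eta p))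
      (fun s => modified_clark_vector arg beta lambda2 (zeta s)) A t) :
  let p1 : 'I_m := Ordinal hm in
  let s1 : 'I_n := Ordinal hn in
  let ra (p : 'I_m) : R[i] := sqrtC (abs_deriv alpha (eta p)) in
  let rb (s : 'I_n) : R[i] := sqrtC (abs_deriv beta (zeta s)) in
  let wa (p : 'I_m) : R[i] := clark_weight arg lambda1 (eta p) in
  let wb (s : 'I_n) : R[i] := clark_weight arg lambda2 (zeta s) in
  (l = 0%N ->
    (asym_truncated_toeplitz alpha beta A <->
     forall (p : 'I_m) (s : 'I_n),
       t s p =
         ra p1 / ra p * (wa p1 / wa p)
           * ((eta p1 - zeta s) / (eta p - zeta s)) * t s p1
         + ra p1 * rb s1 / (ra p * rb s) * (wa p1 * wb s1 / (wa p * wb s))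
           * ((zeta s1 - eta p1) / (eta p - zeta s)) * t s1 p1
         + rb s1 / rb s * (wb s1 / wb s)
           * ((eta p - zeta s1) / (eta p - zeta s)) * t s1 p))
  /\
  ((0 < l)%N ->
    (asym_truncated_toeplitz alpha beta A <->
     (forall (p : 'I_m) (s : 'I_n) (s' : 'I_m),
       s' = s :> nat -> (s < l)%N -> s != p :> nat ->
       t s p =
         ra s' * rb s1 / (ra p * rb s) * (wa s' * wb s1 / (wa p * wb s))
           * ((eta p1 - zeta s) / (eta p - zeta s)) * t s1 s'
         + rb s1 / rb s * (wb s1 / wb s)
           * ((eta p - zeta s1) / (eta p - zeta s)) * t s1 p)
     /\
     (forall (p : 'I_m) (s : 'I_n),
       (l <= s)%N ->
       t s p =
         ra p1 / ra p * (wa p1 / wa p)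
           * ((eta p1 - zeta s) / (eta p - zeta s)) * t s p1
         + rb s1 / rb s * (wb s1 / wb s)
           * ((eta p - zeta s1) / (eta p - zeta s)) * t s1 p))).

Proof.
move=> p1 s1 ra rb wa wb.
have [a [a1 alphaE]] := halpha; have [b [b1 betaE]] := hbeta.
have {}alphaE : alpha = blaschke a := alphaE.
have {}betaE : beta = blaschke b := betaE.
subst alpha beta.
have [eta_inj eta1 etaP] := heta; have [zeta_inj zeta1 zetaP] := hzeta.
have etad j : blaschke a (eta j) = clark_value (blaschke a) lambda1.
  by apply/etaP; exists j.
have zetad j : blaschke b (zeta j) = clark_value (blaschke b) lambda2.
  by apply/zetaP; exists j.
have ra0 p : ra p != 0 := clark_norm_neq0 hm a1 eta_inj eta1 etad p.
have rb0 s : rb s != 0 := clark_norm_neq0 hn b1 zeta_inj zeta1 zetad s.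
have wa0 p : wa p != 0 := expi_neq0 _.
have wb0 s : wb s != 0 := expi_neq0 _.
have rep := toeplitz_iff_representable hm hn a1 b1 eta_inj zeta_inj eta1 zeta1
  etad zetad harg hlambda1 hA ht.
have sep := representable_iff_separated hm hn eta_inj zeta_inj
  (clark_poly a1 eta1 etad) (clark_poly b1 zeta1 zetad)
  (kernel_poly_neq0 hm a1 eta_inj eta1 etad) (kernel_poly_neq0 hn b1 zeta_inj zeta1 zetad)
  (fun p => size_kernel_poly a1 (eta1 p)) (fun s => size_kernel_poly b1 (zeta1 s))
  (scaled_entry ra wa rb wb t).
have {rep} main := iff_trans rep sep.
have [lm _] := common_card_le hl.
split=> [l0|l0].
  subst l.
  have dis s p : eta p != zeta s by apply/eqP; exact: (not_common hl zeta_inj hcommon).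
  apply: iff_trans main _; apply: iff_trans (separated_disjoint _ _ _ _ _ p1 s1 dis) _.
  by split=> h p s; apply/(disjoint_formula t ra0 wa0 rb0 wb0 p1 s1 (dis s p)); exact: h.
have e1 : eta p1 = zeta s1 by apply: hcommon.
apply: iff_trans main _.
apply: iff_trans (separated_common ra wa rb wb t lm e1 hcommon) _.
have dis1 (s : 'I_n) (p s' : 'I_m) : s' = s :> nat -> (s < l)%N -> s != p :> nat -> eta p != zeta s.
  move=> ss sl sp; rewrite -(hcommon s' s) ?ss// (inj_eq eta_inj) -val_eqE /= ss eq_sym//.
have dis2 (p : 'I_m) (s : 'I_n) : (l <= s)%N -> eta p != zeta s.
  by move=> ls; apply/eqP; exact: (not_common hl zeta_inj hcommon).
split=> -[h1 h2]; split.
- move=> p s s' ss sl sp.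
  have es : eta s' = zeta s by apply: hcommon; rewrite ?ss.
  by apply/(common_formula t ra0 wa0 rb0 wb0 (dis1 s p s' ss sl sp) es e1); exact: h1.
- by move=> p s ls; apply/(private_formula t ra0 wa0 rb0 wb0 p1 s1 (dis2 p s ls)); exact: h2.
- move=> p s s' ss sl sp.
  have es : eta s' = zeta s by apply: hcommon; rewrite ?ss.
  by apply/(common_formula t ra0 wa0 rb0 wb0 (dis1 s p s' ss sl sp) es e1); exact: h1.
- by move=> p s ls; apply/(private_formula t ra0 wa0 rb0 wb0 p1 s1 (dis2 p s ls)); exact: h2.
Qed.
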